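(* Let $R$ be a fine enough rectangulation of a compact, metrizable, smooth and path-connected manifold $M$, and let $X$ be the natural graph associated to $R$. Then the classical fundamental group of $M$ is isomorphic to the discrete fundamental group of $X$ at scale $1$: $\pi_1(M)\cong A_{1,1}(X)$.
   Context: **Rectangulations.** $M$ carries a fixed metric compatible with its topology, with respect to which lengths of curves are measured. A rectangulation $R$ of $M$ is a decomposition of $M$ as a finite regular cell complex all of whose closed cells are combinatorial cubes (in particular every 2-cell is a rectangle bounded by four edges), whose edges (sides) are curves of finite length. The natural graph $X$ associated to $R$ has the vertices of $R$ as vertices, two of them being adjacent when they are joined by an edge of $R$; it is regarded as a metric space with the shortest-path distance $d$. Let $\ell>0$ be the infimum of the lengths of all non-contractible loops on $M$ (with $\ell=\infty$ if there are none). $R$ is fine enough if each side of the rectangulation has length at most $\ell/5$. **Discrete fundamental group at scale $r$** (used for $r=1$). An $r$-path in a metric space $(X,d)$ is a finite sequence $x_0x_1\ldots x_{n+1}$ with $d(x_i,x_{i+1})\le r$ for all $i$. Fix $p\in X$; an $r$-loop based at $p$ is an $r$-path with $x_0=x_{n+1}=p$. Let $\mathcal C_r(X,p)$ be the set of $r$-loops based at $p$, with the operation of concatenation of sequences. Let $\sim_r$ be the equivalence relation generated by the following: (i) $x_0\ldots x_{n+1}\sim_r x_0\ldots x_{n+1}p$; (ii) two $r$-loops $x_0\ldots x_{n+1}$ and $y_0\ldots y_{n+1}$ of the same length are equivalent if there is a finite matrix of points of $X$ with first row $x_0,\dots,x_{n+1}$ and last row $y_0,\dots,y_{n+1}$ such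 that every row is an $r$-loop based at $p$ and every column is an $r$-path. Then $A_{1,r}(X,p)=\mathcal C_r(X,p)/\sim_r$ is a group under concatenation. If any two points of $X$ can be joined by an $r$-path, it is independent of $p$ up to isomorphism and is denoted $A_{1,r}(X)$. *)

(* Defs.v *)
From HB Require Import structures.
From mathcomp Require Import all_boot all_order all_algebra.
From mathcomp Require Import all_classical all_reals all_analysis.
From mathcomp Require Import generic_quotient lra zify.

Set Implicit Arguments.
Unset Strict Implicit.
Unset Printing Implicit Defensive.

Import Order.TTheory GRing.Theory Num.Theory.
Import numFieldNormedType.Exports.

Local Open Scope classical_set_scope.
Local Open Scope ring_scope.
Local Open Scope quotient_scope.

Definition group_isomorphic (G H : groupType) : Prop :=
  exists f : G -> H, bijective f /\ {morph f : x y / (x * y)%g}.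

Section continuity.
Context {R : realType}.
Implicit Types S T U : topologicalType.

Lemma within_comp S T U (A : set T) (f : T -> U) (phi : S -> T) :
  {within A, continuous f} -> continuous phi -> (forall x, A (phi x)) ->
  continuous (f \o phi).
Proof.
move=> /subspace_continuousP cf cphi Aphi x.
apply: cvg_trans (cf _ (Aphi x)) => B /= nB.
have : nbhs x (phi @^-1` [set y | A y -> B (f y)]) by exact: cphi.
by apply: filterS => y /= /(_ (Aphi y)).
Qed.

Lemma glue_continuous S T (h : S -> R) (f g : S -> T) :
  continuous h -> continuous f -> continuous g ->
  (forall x, h x = 0 -> f x = g x) ->
  continuous (fun x => if h x <= 0 then f x else g x).
Proof.
move=> ch cf cg fg.
have cA : closed (h @^-1` [set y | y <= 0]).
  by apply: preimage_closed => //; exact: closed_le.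
have cB : closed (h @^-1` [set y | 0 <= y]).
  by apply: preimage_closed => //; exact: closed_ge.
have := @withinU_continuous S T _ _ (fun x => if h x <= 0 then f x else g x) cA cB.
have -> : h @^-1` [set y | y <= 0] `|` h @^-1` [set y | 0 <= y] = setT.
  by apply/seteqP; split => // x _ /=; apply/orP; exact: le_total.
move=> H x; rewrite /continuous_at -(nbhs_subspaceT x).
apply: (H _ _ x) => {H x}.
- apply: (subspace_eq_continuous (f := f)); last exact: continuous_subspaceT.
  by move=> x; rewrite inE /= => x0; rewrite /from_subspace /= x0.
- apply: (subspace_eq_continuous (f := g)); last exact: continuous_subspaceT.
  move=> x; rewrite inE /= => x0; rewrite /from_subspace /=; case: ifPn => // x0'; apply/esym.
  by apply/fg/eqP; rewrite eq_le x0 x0'.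
Qed.

Lemma pair_cont S T U (f : S -> T) (g : S -> U) : continuous f ->
  continuous g -> continuous (fun x => (f x, g x)).
Proof. by move=> cf cg x; apply: cvg_pair; [exact: cf|exact: cg]. Qed.

Lemma fst_cont S T : continuous (@fst S T).
Proof. by move=> x; exact: cvg_fst. Qed.

Lemma snd_cont S T : continuous (@snd S T).
Proof. by move=> x; exact: cvg_snd. Qed.

Lemma comp_cont S T U (f : S -> T) (g : T -> U) : continuous g ->
  continuous f -> continuous (fun x => g (f x)).
Proof. by move=> cg cf x; apply: continuous_comp; [exact: cf|exact: cg]. Qed.

Lemma cst_cont S T (y : T) : continuous (fun _ : S => y).
Proof. exact: cst_continuous. Qed.

Lemma id_cont S : continuous (fun x : S => x).
Proof. by move=> x; exact: cvg_id. Qed.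

Lemma add_cont S (f g : S -> R) : continuous f -> continuous g ->
  continuous (fun x => f x + g x).
Proof. by move=> cf cg x; apply: cvgD; [exact: cf|exact: cg]. Qed.

Lemma sub_cont S (f g : S -> R) : continuous f -> continuous g ->
  continuous (fun x => f x - g x).
Proof. by move=> cf cg x; apply: cvgB; [exact: cf|exact: cg]. Qed.

Lemma mul_cont S (f g : S -> R) : continuous f -> continuous g ->
  continuous (fun x => f x * g x).
Proof. by move=> cf cg x; apply: cvgM; [exact: cf|exact: cg]. Qed.

Lemma min_cont S (f g : S -> R) : continuous f -> continuous g ->
  continuous (fun x => Num.min (f x) (g x)).
Proof.
move=> cf cg.
rewrite (_ : (fun _ => _) = fun x => if (f - g) x <= 0 then f x else g x).
  apply: glue_continuous => //.
    by move=> x; apply: continuousB; [exact: cf|exact: cg].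
  by move=> x /eqP; rewrite subr_eq0 => /eqP.
by apply/funext => x; rewrite minEle subr_le0.
Qed.

Lemma max_cont S (f g : S -> R) : continuous f -> continuous g ->
  continuous (fun x => Num.max (f x) (g x)).
Proof.
move=> cf cg.
rewrite (_ : (fun _ => _) = fun x => if (f - g) x <= 0 then g x else f x).
  apply: glue_continuous => //.
    by move=> x; apply: continuousB; [exact: cf|exact: cg].
  by move=> x /eqP; rewrite subr_eq0 => /eqP.
by apply/funext => x; rewrite maxEle subr_le0.
Qed.

End continuity.

Local Ltac cont := repeat first [ assumption | exact: cst_cont | exact: id_cont
  | exact: fst_cont | exact: snd_cont | apply: sub_cont | apply: add_cont
  | apply: mul_cont | apply: min_cont | apply: max_cont | apply: pair_cont ].

Section unit_interval.
Context {R : realType}.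
Implicit Types s t : R.

Definition clamp t : R := Num.max 0 (Num.min 1 t).

Lemma clamp_in t : `[0, 1]%classic (clamp t).
Proof.
by rewrite /clamp /= in_itv /= le_max lexx /= ge_max ler01 /= ge_min lexx.
Qed.

Lemma clamp_id t : `[0, 1]%classic t -> clamp t = t.
Proof.
rewrite /= in_itv /= => /andP[t0 t1].
by rewrite /clamp min_r // max_r.
Qed.

Lemma clamp_cont : continuous clamp.
Proof.
rewrite /clamp; cont.
Qed.

Lemma in01_0 : `[0, 1]%classic (0 : R). Proof. by rewrite /= in_itv /= lexx ler01. Qed.
Lemma in01_1 : `[0, 1]%classic (1 : R). Proof. by rewrite /= in_itv /= lexx ler01. Qed.

End unit_interval.

Section fundamental_group.
Context (R : realType) {T : topologicalType} (p : T).
Implicit Types s t : R.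
Local Notation I01 := (`[0, 1]%classic : set R).

Record loop := Loop {
  loop_fun :> R -> T;
  loop_continuous : {within I01, continuous loop_fun};
  loop_at0 : loop_fun 0 = p;
  loop_at1 : loop_fun 1 = p }.

(* Homotopy rel endpoints; the first coordinate is the homotopy parameter. *)
Definition homotopic (f g : loop) : Prop :=
  exists H : R * R -> T,
    [/\ {within I01 `*` I01, continuous H},
        (forall t, I01 t -> H (0, t) = f t),
        (forall t, I01 t -> H (1, t) = g t) &
        (forall s, I01 s -> H (s, 0) = p /\ H (s, 1) = p)].

Lemma loop_clamp_continuous (f : loop) : continuous (f \o clamp).
Proof.
apply: within_comp (clamp_cont) clamp_in; exact: loop_continuous.
Qed.

Lemma homotopic_clamp (f g : loop) (H : R * R -> T) : continuous H ->
  (forall t, I01 t -> H (0, t) = f t) -> (forall t, I01 t -> H (1, t) = g t) ->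
  (forall s, I01 s -> H (s, 0) = p /\ H (s, 1) = p) -> homotopic f g.
Proof. by move=> cH *; exists H; split=> //; exact: continuous_subspaceT. Qed.

Lemma homotopicP (f g : loop) : homotopic f g -> exists H : R * R -> T,
  [/\ continuous H, (forall t, I01 t -> H (0, t) = f t),
      (forall t, I01 t -> H (1, t) = g t) &
      (forall s, H (s, 0) = p /\ H (s, 1) = p)].
Proof.
move=> [H [cH H0 H1 Hp]].
exists (H \o (fun x => (clamp x.1, clamp x.2))); split.
- apply: within_comp cH _ _ => [|x]; last by split; exact: clamp_in.
  by apply: pair_cont; apply: (comp_cont clamp_cont); cont.
- by move=> t It /=; rewrite clamp_id ?clamp_id ?H0 //; exact: in01_0.
- by move=> t It /=; rewrite clamp_id ?clamp_id ?H1 //; exact: in01_1.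
- move=> s /=; rewrite (clamp_id in01_0) (clamp_id in01_1).
  exact/Hp/clamp_in.
Qed.

Lemma homotopic_reparam (f g : loop) (h : loop) (phi psi : R -> R) :
  continuous phi -> continuous psi ->
  (forall t, I01 t -> I01 (phi t)) -> (forall t, I01 t -> I01 (psi t)) ->
  (forall t, I01 t -> f t = h (phi t)) -> (forall t, I01 t -> g t = h (psi t)) ->
  phi 0 = psi 0 -> phi 1 = psi 1 -> homotopic f g.
Proof.
move=> cphi cpsi Iphi Ipsi fE gE e0 e1.
pose c (x : R * R) : R := (1 - x.1) * phi x.2 + x.1 * psi x.2.
have I01c x : I01 x.1 -> I01 x.2 -> I01 (c x).
  move=> I1 /[dup] /Iphi + /Ipsi; move: I1; rewrite /c /= !in_itv /=.
  move: (phi _) (psi _) => a b /andP[s0 s1] /andP[a0 a1] /andP[b0 b1].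
  apply/andP; split; first by rewrite addr_ge0 // mulr_ge0 // subr_ge0.
  rewrite -[leRHS](subrK x.1) lerD //; last by rewrite ler_piMr.
  by rewrite ler_piMr // subr_ge0.
apply: (@homotopic_clamp _ _ ((h \o clamp) \o c)).
- apply: (@comp_cont _ _ _ c (h \o clamp)); first exact: loop_clamp_continuous.
  rewrite /c; cont.
  + by apply: (comp_cont cphi); cont.
  + by apply: (comp_cont cpsi); cont.
- move=> t It /=; rewrite clamp_id; last by apply: I01c => //=; exact: in01_0.
  by rewrite /c /= subr0 mul1r mul0r addr0 fE.
- move=> t It /=; rewrite clamp_id; last by apply: I01c => //=; exact: in01_1.
  by rewrite /c /= subrr mul0r mul1r add0r gE.
- move=> s Is; rewrite /= !clamp_id; try by apply: I01c => //=; exact: in01_0.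
  rewrite /c /= -e0 -e1 -!mulrDl !subrK !mul1r -!fE ?loop_at0 ?loop_at1 //.
  + exact: in01_1.
  + exact: in01_0.
  by apply: I01c => //=; exact: in01_1.
Qed.

Lemma homotopic_eq (f g : loop) : (forall t, I01 t -> f t = g t) -> homotopic f g.
Proof.
move=> fg; by apply: (@homotopic_reparam _ _ g id id) => //; exact: id_cont.
Qed.

Lemma homotopic_refl f : homotopic f f.
Proof. exact: homotopic_eq. Qed.

Lemma homotopic_sym f g : homotopic f g -> homotopic g f.
Proof.
move=> /homotopicP[H [cH H0 H1 Hp]].
apply: (@homotopic_clamp _ _ (fun x => H (1 - x.1, x.2))).
- by apply: (comp_cont cH); cont.
- by move=> t It /=; rewrite subr0 H1.
- by move=> t It /=; rewrite subrr H0.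
- by move=> s _; exact: Hp.
Qed.

Lemma homotopic_trans f g h : homotopic f g -> homotopic g h -> homotopic f h.
Proof.
move=> /homotopicP[H [cH H0 H1 Hp]] /homotopicP[K [cK K0 K1 Kp]].
pose L (x : R * R) := if x.1 - 2^-1 <= 0 then H (2 * x.1, clamp x.2)
  else K (2 * x.1 - 1, clamp x.2).
have cc : continuous (fun x : R * R => clamp x.2).
  by apply: (comp_cont clamp_cont); cont.
apply: (@homotopic_clamp _ _ L).
- rewrite /L; apply: (@glue_continuous R (R * R)%type T (fun x => x.1 - 2^-1)).
  + cont.
  + by apply: (comp_cont cH); cont.
  + by apply: (comp_cont cK); cont.
  + move=> x /eqP; rewrite subr_eq0 => /eqP ->; rewrite mulfV // subrr.
    by rewrite H1 ?K0 //; exact: clamp_in.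
- move=> t It; rewrite /L /= sub0r oppr_le0 invr_ge0 ler0n mulr0.
  by rewrite H0 clamp_id.
- move=> t It; rewrite /L /= subr_le0 leNgt invf_lt1 // ltr1n /= mulr1.
  by rewrite (_ : 2 - 1 = 1) ?K1 ?clamp_id //; apply/eqP; rewrite subr_eq.
- move=> s _; rewrite /L /= (clamp_id in01_0) (clamp_id in01_1).
  by have [? ?] := Hp (2 * s); have [? ?] := Kp (2 * s - 1); case: ifP.
Qed.

Lemma loop_cst_continuous : {within I01, continuous (cst p : R -> T)}.
Proof. by apply: continuous_subspaceT; exact: cst_continuous. Qed.

Definition loop_cst : loop := Loop loop_cst_continuous erefl erefl.

Section inverse.
Variable f : loop.

Lemma loop_inv_continuous : {within I01, continuous (fun t => f (1 - t))}.
Proof.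
apply: (@subspace_eq_continuous _ I01 _ ((f \o clamp) \o (fun t => 1 - t))).
  move=> t; rewrite inE /= in_itv /= => /andP[t0 t1].
  by rewrite /from_subspace /= clamp_id // /= in_itv /= subr_ge0 t1 /= gerBl.
apply: continuous_subspaceT.
apply: (@comp_cont R R T (fun t => 1 - t) (f \o clamp)); last by cont.
exact: loop_clamp_continuous.
Qed.

Lemma loop_inv_at0 : f (1 - 0) = p. Proof. by rewrite subr0 loop_at1. Qed.

Lemma loop_inv_at1 : f (1 - 1) = p. Proof. by rewrite subrr loop_at0. Qed.

Definition loop_inv : loop :=
  Loop loop_inv_continuous loop_inv_at0 loop_inv_at1.

End inverse.

Definition loop_concat_fun (f g : R -> T) t :=
  if t <= 2^-1 then f (2 * t) else g (2 * t - 1).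

Lemma half_in01 t : I01 t -> t <= 2^-1 -> I01 (2 * t).
Proof.
rewrite /= !in_itv /= => /andP[t0 t1] t2.
by rewrite mulr_ge0 //= mulrC -ler_pdivlMr // div1r.
Qed.

Lemma half_in01' t : I01 t -> ~~ (t <= 2^-1) -> I01 (2 * t - 1).
Proof.
rewrite /= !in_itv /= -ltNge => /andP[t0 t1] t2.
by rewrite subr_ge0 lerBlDr -{1}(@mulfV R 2) // !ler_pM2l // ltW //= -[1 + 1]mulr1 ler_pM2l.
Qed.

Lemma concat_continuous (f g : R -> T) : continuous f -> continuous g ->
  f 1 = g 0 -> continuous (loop_concat_fun f g).
Proof.
move=> cf cg fg.
rewrite (_ : loop_concat_fun f g =
  fun t => if t - 2^-1 <= 0 then f (2 * t) else g (2 * t - 1)); last first.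
  by apply/funext => t; rewrite subr_le0.
apply: (@glue_continuous _ _ _ (fun t => t - 2^-1)).
- cont.
- by apply: (comp_cont cf); cont.
- by apply: (comp_cont cg); cont.
- by move=> t /eqP; rewrite subr_eq0 => /eqP ->; rewrite mulfV // subrr.
Qed.

Section concat.
Variables f g : loop.

Lemma loop_concat_continuous : {within I01, continuous (loop_concat_fun f g)}.
Proof.
apply: (@subspace_eq_continuous _ I01 _ (loop_concat_fun (f \o clamp) (g \o clamp))).
  move=> t; rewrite inE => It; rewrite /from_subspace /loop_concat_fun; case: ifPn => t2 /=.
  - by rewrite clamp_id //; exact: half_in01.
  - by rewrite clamp_id //; exact: half_in01'.
apply: continuous_subspaceT; apply: concat_continuous; try exact: loop_clamp_continuous.
by rewrite /= (clamp_id in01_0) (clamp_id in01_1) loop_at0 loop_at1.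
Qed.

Lemma loop_concat_at0 : loop_concat_fun f g 0 = p.
Proof. by rewrite /loop_concat_fun invr_ge0 ler0n mulr0 loop_at0. Qed.

Lemma loop_concat_at1 : loop_concat_fun f g 1 = p.
Proof.
rewrite /loop_concat_fun leNgt invf_lt1 // ltr1n /= mulr1.
by rewrite (_ : 2 - 1 = 1) ?loop_at1 //; apply/eqP; rewrite subr_eq.
Qed.

Definition loop_concat : loop :=
  Loop loop_concat_continuous loop_concat_at0 loop_concat_at1.

End concat.

Lemma homotopic_concat f f' g g' : homotopic f f' -> homotopic g g' ->
  homotopic (loop_concat f g) (loop_concat f' g').
Proof.
move=> /homotopicP[H [cH H0 H1 Hp]] /homotopicP[K [cK K0 K1 Kp]].
pose L (x : R * R) := if x.2 - 2^-1 <= 0 then H (x.1, 2 * x.2)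
  else K (x.1, 2 * x.2 - 1).
apply: (@homotopic_clamp _ _ L).
- rewrite /L; apply: (@glue_continuous R (R * R)%type T (fun x => x.2 - 2^-1)).
  + cont.
  + by apply: (comp_cont cH); cont.
  + by apply: (comp_cont cK); cont.
  + move=> x /eqP; rewrite subr_eq0 => /eqP ->; rewrite mulfV // subrr.
    by rewrite (Hp _).2 (Kp _).1.
- move=> t It; rewrite /L /= /loop_concat_fun subr_le0.
  case: ifPn => t2; first by rewrite H0 //; exact: half_in01.
  by rewrite K0 //; exact: half_in01'.
- move=> t It; rewrite /L /= /loop_concat_fun subr_le0.
  case: ifPn => t2; first by rewrite H1 //; exact: half_in01.
  by rewrite K1 //; exact: half_in01'.
- move=> s _; rewrite /L /= sub0r oppr_le0 invr_ge0 ler0n mulr0 (Hp _).1; split=> //.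
  rewrite subr_le0 leNgt invf_lt1 // ltr1n /= mulr1.
  by rewrite (_ : 2 - 1 = 1) ?(Kp _).2 //; apply/eqP; rewrite subr_eq.
Qed.

Lemma homotopic_concat_cstl f : homotopic (loop_concat loop_cst f) f.
Proof.
apply: (@homotopic_reparam _ _ f (fun t => Num.max 0 (2 * t - 1)) id) => //.
- by rewrite /=; cont.
- exact: id_cont.
- move=> t; rewrite /= !in_itv /= => /andP[t0 t1].
  by rewrite le_max lexx /= ge_max ler01 /=; lra.
- move=> t It; rewrite /= /loop_concat_fun; case: ifPn => t2.
  + rewrite max_l ?loop_at0 // subr_le0.
    by have /itvP := half_in01 It t2; move=> ->.
  + by rewrite max_r //; have /itvP := half_in01' It t2; move=> ->.
- by rewrite mulr0 sub0r max_l // oppr_le0.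
- by rewrite mulr1 max_r; lra.
Qed.

Lemma homotopic_concat_cstr f : homotopic (loop_concat f loop_cst) f.
Proof.
apply: (@homotopic_reparam _ _ f (fun t => Num.min (2 * t) 1) id) => //.
- by rewrite /=; cont.
- exact: id_cont.
- move=> t; rewrite /= !in_itv /= => /andP[t0 t1].
  by rewrite ge_min lexx orbT andbT le_min ler01 andbT mulr_ge0.
- move=> t It; rewrite /= /loop_concat_fun; case: ifPn => t2.
  + by rewrite min_l //; have /itvP := half_in01 It t2; move=> ->.
  + rewrite min_r ?loop_at1 //.
    by move: t2; rewrite -ltNge; lra.
- by rewrite mulr0 min_l.
- by rewrite mulr1 min_r; lra.
Qed.

Lemma homotopic_concatA f g h :
  homotopic (loop_concat f (loop_concat g h)) (loop_concat (loop_concat f g) h).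
Proof.
apply: homotopic_sym.
apply: (@homotopic_reparam _ _ (loop_concat f (loop_concat g h))
  (fun t => Num.min (2 * t) (Num.min (t + 4^-1) ((t + 1) / 2))) id) => //.
- by rewrite /=; cont.
- exact: id_cont.
- move=> t; rewrite /= !in_itv /= => /andP[t0 t1].
  apply/andP; split; first by rewrite !le_min; apply/and3P; split; lra.
  by rewrite !ge_min; apply/orP; right; apply/orP; right; lra.
- move=> t; rewrite /= in_itv /= => /andP[t0 t1].
  rewrite /loop_concat_fun.
  have [t4|t4] := leP t 4^-1.
    rewrite min_l; last by rewrite le_min; apply/andP; split; lra.
    have -> : t <= 2^-1 by lra.
    have -> : 2 * t <= 2^-1 by lra.
    by [].
  have [t2|t2] := leP t 2^-1.
    rewrite [Num.min (t + _) _]min_l; last lra.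
    rewrite min_r; last lra.
    have -> : (2 * t <= 2^-1) = false by apply/negbTE; rewrite -ltNge; lra.
    have -> : (t + 4^-1 <= 2^-1) = false by apply/negbTE; rewrite -ltNge; lra.
    have -> : 2 * (t + 4^-1) - 1 <= 2^-1 by lra.
    by congr (g _); lra.
  rewrite [Num.min (t + _) _]min_r; last lra.
  rewrite min_r; last lra.
  have -> : ((t + 1) / 2 <= 2^-1) = false by apply/negbTE; rewrite -ltNge; lra.
  have -> : (2 * ((t + 1) / 2) - 1 <= 2^-1) = false by apply/negbTE; rewrite -ltNge; lra.
  by congr (h _); lra.
- by rewrite min_l; [lra|rewrite le_min; apply/andP; split; lra].
- by rewrite [Num.min (1 + _) _]min_r; [rewrite min_r; lra|lra].
Qed.

Lemma homotopic_concat_invr f : homotopic (loop_concat f (loop_inv f)) loop_cst.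
Proof.
apply: (@homotopic_reparam _ _ f (fun t => Num.min (2 * t) (2 - 2 * t)) (fun=> 0)) => //.
- by rewrite /=; cont.
- exact: cst_cont.
- move=> t; rewrite /= !in_itv /= => /andP[t0 t1].
  apply/andP; split; first by rewrite le_min; apply/andP; split; lra.
  by have [?|?] := leP t 2^-1; rewrite ge_min; apply/orP; [left|right]; lra.
- by move=> t _; exact: in01_0.
- move=> t It; rewrite /= /loop_concat_fun; case: ifPn => t2.
  + by rewrite min_l //; lra.
  + rewrite min_r; last by move: t2; rewrite -ltNge; lra.
    by congr (f _); lra.
- by move=> t _; rewrite /= loop_at0.
- by rewrite mulr0 min_l //; lra.
- by rewrite min_r; lra.
Qed.

Lemma homotopic_inv f g : homotopic f g -> homotopic (loop_inv f) (loop_inv g).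
Proof.
move=> /homotopicP[H [cH H0 H1 Hp]].
have Isub t : I01 t -> I01 (1 - t).
  by rewrite /= !in_itv /= => /andP[? ?]; apply/andP; split; lra.
apply: (@homotopic_clamp _ _ (fun x => H (x.1, 1 - x.2))).
- by apply: (comp_cont cH); cont.
- by move=> t It /=; rewrite H0 //; exact: Isub.
- by move=> t It /=; rewrite H1 //; exact: Isub.
- by move=> s _ /=; rewrite subrr subr0; have [] := Hp s.
Qed.

Lemma loop_invK f : homotopic (loop_inv (loop_inv f)) f.
Proof. by apply: homotopic_eq => t _ /=; congr (f _); lra. Qed.

Lemma homotopic_concat_invl f : homotopic (loop_concat (loop_inv f) f) loop_cst.
Proof.
apply: homotopic_trans (homotopic_concat_invr (loop_inv f)).
apply: homotopic_concat; first exact: homotopic_refl.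
exact/homotopic_sym/loop_invK.
Qed.

HB.instance Definition _ := gen_eqMixin loop.
HB.instance Definition _ := gen_choiceMixin loop.

Definition homotopicb (f g : loop) : bool := `[< homotopic f g >].

Lemma homotopicb_equiv : equiv_class_of homotopicb.
Proof.
split.
- by move=> f; apply/asboolP; exact: homotopic_refl.
- by move=> f g; apply/asboolP/asboolP; exact: homotopic_sym.
- move=> g f h /asboolP fg /asboolP gh; apply/asboolP.
  exact: homotopic_trans gh.
Qed.

Canonical homotopic_equiv := EquivRelPack homotopicb_equiv.

Definition pi1 := {eq_quot homotopicb}.
HB.instance Definition _ : EqQuotient loop homotopicb pi1 := EqQuotient.on pi1.
HB.instance Definition _ := Choice.on pi1.

Lemma pi1_eq (f g : loop) : \pi_pi1 f = \pi_pi1 g <-> homotopic f g.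
Proof.
split=> [/eqP|fg]; first by rewrite eqmodE => /asboolP.
by apply/eqP; rewrite eqmodE; exact/asboolP.
Qed.

Lemma pi1_repr (f : loop) : homotopic (repr (\pi_pi1 f)) f.
Proof. by apply/pi1_eq; rewrite reprK. Qed.

Definition pi1_one : pi1 := \pi_pi1 loop_cst.
Definition pi1_mul (x y : pi1) : pi1 := \pi_pi1 (loop_concat (repr x) (repr y)).
Definition pi1_inv (x : pi1) : pi1 := \pi_pi1 (loop_inv (repr x)).

Lemma pi1_mulE f g : pi1_mul (\pi_pi1 f) (\pi_pi1 g) = \pi_pi1 (loop_concat f g).
Proof. by apply/pi1_eq; apply: homotopic_concat; exact: pi1_repr. Qed.

Lemma pi1_invE f : pi1_inv (\pi_pi1 f) = \pi_pi1 (loop_inv f).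
Proof. by apply/pi1_eq; apply: homotopic_inv; exact: pi1_repr. Qed.

Lemma pi1_mulA : associative pi1_mul.
Proof.
elim/quotW => f; elim/quotW => g; elim/quotW => h.
by rewrite (pi1_mulE g h) (pi1_mulE f g) !pi1_mulE; apply/pi1_eq; exact: homotopic_concatA.
Qed.

Lemma pi1_mul1x : left_id pi1_one pi1_mul.
Proof.
elim/quotW => f; rewrite !pi1_mulE; apply/pi1_eq; exact: homotopic_concat_cstl.
Qed.

Lemma pi1_mulx1 : right_id pi1_one pi1_mul.
Proof.
elim/quotW => f; rewrite !pi1_mulE; apply/pi1_eq; exact: homotopic_concat_cstr.
Qed.

Lemma pi1_mulVx : left_inverse pi1_one pi1_inv pi1_mul.
Proof.
elim/quotW => f; rewrite pi1_invE pi1_mulE; apply/pi1_eq.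
exact: homotopic_concat_invl.
Qed.

Lemma pi1_mulxV : right_inverse pi1_one pi1_inv pi1_mul.
Proof.
elim/quotW => f; rewrite pi1_invE pi1_mulE; apply/pi1_eq.
exact: homotopic_concat_invr.
Qed.

HB.instance Definition _ :=
  isGroup.Build pi1 pi1_mulA pi1_mul1x pi1_mulx1 pi1_mulVx pi1_mulxV.

End fundamental_group.

(* Distances are allowed to be +oo, as for a graph that is not known to be
   connected. *)
Record emetric (R : realType) := EMetric {
  epoint :> Type;
  edist : epoint -> epoint -> \bar R;
  edistxx : forall x, edist x x = 0%E;
  edist_eq0 : forall x y, edist x y = 0%E -> x = y;
  edistC : forall x y, edist x y = edist y x;
  edist_triangle : forall x y z, (edist x z <= edist x y + edist y z)%E }.

Lemma map_ord_split (T : Type) m n (f : 'I_(m + n) -> T) :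
  [seq f j | j : 'I_(m + n)] =
  [seq f (lshift n j) | j : 'I_m] ++ [seq f (rshift m j) | j : 'I_n].
Proof.
have E : enum 'I_(m + n) =
    [seq lshift n j | j <- enum 'I_m] ++ [seq rshift m j | j <- enum 'I_n].
  apply: (inj_map (@ord_inj _)); rewrite map_cat val_enum_ord iotaD add0n.
  congr (_ ++ _); first by rewrite -val_enum_ord -map_comp; exact: eq_map.
  by rewrite -[m in LHS]addn0 iotaDl -val_enum_ord -!map_comp; exact: eq_map.
by rewrite /image_mem E map_cat -!map_comp.
Qed.

Section discrete_fundamental_group.
Context {R : realType} {X : emetric R} (r : {posnum R}) (p : X).

Definition rstep (x y : X) : bool := (edist x y <= r%:num%:E)%E.

Definition rpath (s : seq X) : bool := sorted rstep s.

Definition is_rloop (s : seq X) : Prop :=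
  [/\ (1 < size s)%N, rpath s, head p s = p & last p s = p].

Record rloop := Rloop { rloop_seq :> seq X; rloopP : is_rloop rloop_seq }.

Definition rloop_grid (a b : rloop) : Prop :=
  exists m n (F : 'M[X]_(m.+1, n)),
    [/\ [seq F ord0 j | j : 'I_n] = a,
        [seq F ord_max j | j : 'I_n] = b,
        (forall i, is_rloop [seq F i j | j : 'I_n]) &
        (forall j, rpath [seq F i j | i : 'I_m.+1])].

Inductive rloop_sim : rloop -> rloop -> Prop :=
| rloop_sim_refl a : rloop_sim a a
| rloop_sim_sym a b : rloop_sim a b -> rloop_sim b a
| rloop_sim_trans a b c : rloop_sim a b -> rloop_sim b c -> rloop_sim a c
| rloop_sim_stutter (a b : rloop) : rloop_seq b = rcons a p -> rloop_sim a b
| rloop_sim_grid (a b : rloop) : rloop_grid a b -> rloop_sim a b.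

Lemma rstep_refl x : rstep x x.
Proof. by rewrite /rstep edistxx lee_fin. Qed.

Lemma rstep_sym x y : rstep x y = rstep y x.
Proof. by rewrite /rstep edistC. Qed.

Lemma map_nth_ord (s : seq X) n : size s = n -> [seq nth p s j | j : 'I_n] = s.
Proof.
move=> <-; rewrite -[RHS](mkseq_nth p) /mkseq -val_enum_ord -map_comp.
exact: eq_map.
Qed.

Lemma rpath_const (T : finType) (x : X) : rpath [seq x | i : T].
Proof.
rewrite /image_mem; elim: (enum _) => //= _ [//|j s] /= IH.
by rewrite rstep_refl.
Qed.

Lemma rpathP s : reflect
  (forall i j, (i < size s)%N -> (j < size s)%N -> (i <= j.+1)%N ->
     (j <= i.+1)%N -> rstep (nth p s i) (nth p s j)) (rpath s).
Proof.
apply: (iffP (sortedP p)) => [H i j ilt jlt ij ji|H i ilt].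
  have [e|[e|e]] : i = j \/ i = j.+1 \/ j = i.+1 by lia.
  - by rewrite e rstep_refl.
  - by rewrite e rstep_sym H // -e.
  - by rewrite e H // -e.
by apply: H => //; lia.
Qed.

Lemma rloop_nth0 (a : rloop) : nth p a 0 = p.
Proof. by case: a => [[|x s] [//= _ _ -> _]]. Qed.

Lemma rloop_nth_last (a : rloop) : nth p a (size a).-1 = p.
Proof. by case: a => s [/= _ _ _ {2}<-]; rewrite nth_last. Qed.

Lemma rloop_near_grid (a b : rloop) : size a = size b ->
  (forall i, (i < size a)%N -> rstep (nth p a i) (nth p b i)) -> rloop_grid a b.
Proof.
move=> sab H.
pose F : 'M[X]_(2, size a) := \matrix_(i, j) nth p (if i == ord0 then a else b) j.
have E i : [seq F i j | j : 'I_(size a)] = (if i == ord0 then a else b).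
  rewrite -[RHS](@map_nth_ord _ (size a)); last by case: ifP.
  by apply: eq_map => j; rewrite mxE.
exists 1%N, (size a), F; split; rewrite ?E //.
- by move=> i; rewrite E; case: ifP => _; exact: rloopP.
- move=> j; rewrite /image_mem !enum_ordSl enum_ord0 /= /rpath /= !mxE /= andbT.
  exact: H.
Qed.

Lemma rloop_cat_subproof (a b : rloop) : is_rloop (a ++ b).
Proof.
case: a b => [[|x s] [//= s1 ps hs ls]] [[|y t] [//= t1 pt ht lt]].
split => //=.
- by rewrite size_cat /=; lia.
- rewrite /rpath /= cat_path; move: ps ls; rewrite /rpath /= => -> -> /=.
  by rewrite ht rstep_refl -{1}ht.
- by rewrite last_cat.
Qed.

Definition rloop_cat (a b : rloop) : rloop := Rloop (rloop_cat_subproof a b).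

Lemma rloop_one_subproof : is_rloop [:: p; p].
Proof. by split => //; rewrite /rpath /= rstep_refl. Qed.

Definition rloop_one : rloop := Rloop rloop_one_subproof.

Lemma rloop_inv_subproof (a : rloop) : is_rloop (rev a).
Proof.
have := rloop_nth0 a; have := rloop_nth_last a; case: a => s [/= s1 ps _ _] nl n0.
split; first by rewrite size_rev.
- rewrite /rpath rev_sorted; rewrite (eq_sorted (e' := rstep)) // => x y.
  exact: rstep_sym.
- by rewrite -nth0 nth_rev ?subn1 //; lia.
- by rewrite -nth_last size_rev nth_rev; [rewrite -{2}n0; congr nth; lia|lia].
Qed.

Definition rloop_inv (a : rloop) : rloop := Rloop (rloop_inv_subproof a).

Lemma rloop_eq (a b : rloop) : a = b :> seq X -> rloop_sim a b.
Proof.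
case: a b => s ps [t pt] /= st; subst t.
by rewrite (Prop_irrelevance ps pt); exact: rloop_sim_refl.
Qed.

Lemma is_rloop_rcons (a : rloop) : is_rloop (rcons a p).
Proof.
case: a => [[|x s] [//= s1 ps hs ls]]; split => //=.
- by rewrite size_rcons.
- by move: ps ls; rewrite /rpath /= rcons_path => -> ->; rewrite rstep_refl.
- by rewrite last_rcons.
Qed.

Lemma is_rloop_cons (a : rloop) : is_rloop (p :: a).
Proof.
case: a => [[|x s] [//= s1 ps hs ls]]; split => //=.
by move: ps; rewrite /rpath /= => ->; rewrite hs rstep_refl.
Qed.

Lemma rloop_shift_grid (a : rloop) :
  rloop_grid (Rloop (is_rloop_cons a)) (Rloop (is_rloop_rcons a)).
Proof.
have /rpathP pa := let: And4 _ h _ _ := rloopP a in h.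
have s1 := let: And4 h _ _ _ := rloopP a in h.
apply: rloop_near_grid => [|i]; rewrite /= ?size_rcons // => ilt.
rewrite nth_rcons; case: i ilt => [_|k klt] /=.
  by rewrite (ltnW s1) rloop_nth0 rstep_refl.
case: ltnP => kc; first by apply: pa; lia.
rewrite if_same (_ : k = (size a).-1) ?rloop_nth_last ?rstep_refl //; lia.
Qed.

Lemma rloop_shift (a : rloop) : rloop_sim (rloop_cat rloop_one a) a.
Proof.
pose b := Rloop (is_rloop_cons a); pose c := Rloop (is_rloop_rcons a).
have bc : rloop_sim b c by apply: rloop_sim_grid; exact: rloop_shift_grid.
have ca : rloop_sim c a by apply/rloop_sim_sym/rloop_sim_stutter.
apply: rloop_sim_trans ca; apply: rloop_sim_trans bc.
apply: (@rloop_sim_trans _ (Rloop (is_rloop_cons b))); first exact: rloop_eq.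
apply: (@rloop_sim_trans _ (Rloop (is_rloop_rcons b))).
  by apply: rloop_sim_grid; exact: rloop_shift_grid.
by apply/rloop_sim_sym/rloop_sim_stutter.
Qed.

Lemma rloop_sim_cat_grid (a b c : rloop) : rloop_grid a b ->
  rloop_sim (rloop_cat a c) (rloop_cat b c) /\
  rloop_sim (rloop_cat c a) (rloop_cat c b).
Proof.
move=> [m [n [F [Fa Fb Frow Fcol]]]].
pose C : 'M[X]_(m.+1, size c) := \matrix_(i, j) nth p c j.
have CE i : [seq C i j | j : 'I_(size c)] = c.
  by rewrite -[RHS](@map_nth_ord _ (size c)) //; apply: eq_map => j; rewrite mxE.
have FC i : [seq row_mx F C i j | j : 'I_(n + size c)] =
    [seq F i j | j : 'I_n] ++ c.
  rewrite map_ord_split -[in RHS](CE i); congr (_ ++ _).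
    by apply: eq_map => j; rewrite row_mxEl.
  by apply: eq_map => j; rewrite row_mxEr.
have CF i : [seq row_mx C F i j | j : 'I_(size c + n)] =
    c ++ [seq F i j | j : 'I_n].
  rewrite map_ord_split -[in RHS](CE i); congr (_ ++ _).
    by apply: eq_map => j; rewrite row_mxEl.
  by apply: eq_map => j; rewrite row_mxEr.
have Ccol j : rpath [seq C i j | i : 'I_m.+1].
  rewrite (_ : [seq _ | i : _] = [seq nth p c j | i : 'I_m.+1]).
    exact: rpath_const.
  by apply: eq_map => i; rewrite mxE.
split; apply: rloop_sim_grid.
- exists m, (n + size c)%N, (row_mx F C); split.
  + by rewrite FC Fa.
  + by rewrite FC Fb.
  + by move=> i; rewrite FC; exact: (rloop_cat_subproof (Rloop (Frow i)) c).
  + move=> j; rewrite -(splitK j); case: (fintype.split j) => k /=.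
      rewrite (_ : [seq _ | i : _] = [seq F i k | i : 'I_m.+1]) //.
      by apply: eq_map => i; rewrite row_mxEl.
    rewrite (_ : [seq _ | i : _] = [seq C i k | i : 'I_m.+1]) //.
      by apply: eq_map => i; rewrite row_mxEr.
- exists m, (size c + n)%N, (row_mx C F); split.
  + by rewrite CF Fa.
  + by rewrite CF Fb.
  + by move=> i; rewrite CF; exact: (rloop_cat_subproof c (Rloop (Frow i))).
  + move=> j; rewrite -(splitK j); case: (fintype.split j) => k /=.
      rewrite (_ : [seq _ | i : _] = [seq C i k | i : 'I_m.+1]) //.
      by apply: eq_map => i; rewrite row_mxEl.
    rewrite (_ : [seq _ | i : _] = [seq F i k | i : 'I_m.+1]) //.
      by apply: eq_map => i; rewrite row_mxEr.
Qed.

Lemma rloop_sim_cat1 (a b c : rloop) : rloop_sim a b ->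
  rloop_sim (rloop_cat a c) (rloop_cat b c) /\
  rloop_sim (rloop_cat c a) (rloop_cat c b).
Proof.
elim=> {a b} [a|a b _ [? ?]|a b d _ [h1 h2] _ [h3 h4]|a b ba|a b].
- by split; exact: rloop_sim_refl.
- by split; exact: rloop_sim_sym.
- by split; [exact: rloop_sim_trans h3|exact: rloop_sim_trans h4].
- split; last by apply: rloop_sim_stutter; rewrite /= ba rcons_cat.
  apply: rloop_sim_sym.
  have [_ h] := rloop_sim_cat_grid a (rloop_shift_grid c).
  apply: (@rloop_sim_trans _ (rloop_cat a (Rloop (is_rloop_cons c)))).
    by apply: rloop_eq; rewrite /= ba cat_rcons.
  apply: rloop_sim_trans h _.
  by apply/rloop_sim_sym/rloop_sim_stutter; rewrite /= rcons_cat.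
- exact: rloop_sim_cat_grid.
Qed.

Lemma rloop_sim_cat a a' b b' : rloop_sim a a' -> rloop_sim b b' ->
  rloop_sim (rloop_cat a b) (rloop_cat a' b').
Proof.
move=> /(rloop_sim_cat1 b)[h _] /(rloop_sim_cat1 a')[_].
exact: rloop_sim_trans.
Qed.

Lemma rloop_cat_oner a : rloop_sim (rloop_cat a rloop_one) a.
Proof.
apply/rloop_sim_sym/(@rloop_sim_trans _ (Rloop (is_rloop_rcons a))); apply: rloop_sim_stutter => //=.
by rewrite -!cats1 -catA.
Qed.

Lemma rloop_nseq n : exists c : rloop,
  rloop_seq c = nseq n.+2 p /\ rloop_sim c rloop_one.
Proof.
elim: n => [|n [c [cE c1]]]; first by exists rloop_one; split=> //; exact: rloop_sim_refl.
have H : is_rloop (nseq n.+3 p).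
  split => //.
  - apply/(sortedP p) => i; rewrite size_nseq => ilt.
    by rewrite !nth_nseq ilt (ltnW ilt) rstep_refl.
  - by rewrite -nth_last nth_nseq if_same.
exists (Rloop H); split => //; apply: rloop_sim_trans c1.
apply/rloop_sim_sym/rloop_sim_stutter.
by rewrite cE /= -cats1; congr (_ :: _ :: _); elim: n {c cE H} => //= n <-.
Qed.

Lemma rloop_cat_invr a : rloop_sim (rloop_cat a (rloop_inv a)) rloop_one.
Proof.
have /rpathP pa := let: And4 _ h _ _ := rloopP a in h.
have s1 := let: And4 h _ _ _ := rloopP a in h.
pose N := size a.
pose idx k j := minn k (minn j (N + N - j.+1)).
pose b k := mkseq (fun j => nth p a (idx k j)) (N + N).
have bP k : is_rloop (b k).
  split; first by rewrite size_mkseq /N; lia.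
  - apply/rpathP => i j; rewrite size_mkseq => ilt jlt ij ji.
    by rewrite !nth_mkseq //; apply: pa; rewrite /idx /N in ilt jlt *; lia.
  - rewrite -nth0 nth_mkseq; last by rewrite /N; lia.
    by have -> : idx k 0%N = 0%N; [rewrite /idx min0n minn0|rewrite rloop_nth0].
  - rewrite -nth_last size_mkseq nth_mkseq; last by rewrite /N; lia.
    have -> : idx k (N + N).-1 = 0%N by rewrite /idx /N; lia.
    exact: rloop_nth0.
have bS k : rloop_sim (Rloop (bP k.+1)) (Rloop (bP k)).
  apply: rloop_sim_grid; apply: rloop_near_grid; first by rewrite /= !size_mkseq.
  move=> i; rewrite /= size_mkseq => ilt; rewrite !nth_mkseq //.
  by apply: pa; rewrite /idx /N in ilt *; lia.
have b0 k : rloop_sim (Rloop (bP k)) rloop_one.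
  elim: k => [|k IH]; last exact: rloop_sim_trans IH.
  have [c [cE c1]] := rloop_nseq (N + N - 2).
  apply: rloop_sim_trans c1; apply: rloop_eq; rewrite cE -[LHS]/(b 0%N).
  apply: (@eq_from_nth _ p); first by rewrite size_mkseq size_nseq /N; lia.
  move=> i; rewrite size_mkseq => ilt; rewrite nth_mkseq // nth_nseq if_same.
  by rewrite /idx min0n rloop_nth0.
apply: rloop_sim_trans (b0 N); apply: rloop_eq => /=.
apply: (@eq_from_nth _ p); first by rewrite size_cat size_rev size_mkseq.
move=> i; rewrite size_cat size_rev => ilt; rewrite nth_mkseq // nth_cat.
case: ifP => ia; first by congr nth; rewrite /idx /N; lia.
by rewrite nth_rev; [congr nth; rewrite /idx /N|]; lia.
Qed.

Lemma rloop_cat_invl a : rloop_sim (rloop_cat (rloop_inv a) a) rloop_one.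
Proof.
apply: rloop_sim_trans (rloop_cat_invr (rloop_inv a)).
by apply: rloop_eq; rewrite /= revK.
Qed.

HB.instance Definition _ := gen_eqMixin rloop.
HB.instance Definition _ := gen_choiceMixin rloop.

Definition rloop_simb (a b : rloop) : bool := `[< rloop_sim a b >].

Lemma rloop_simb_equiv : equiv_class_of rloop_simb.
Proof.
split.
- by move=> a; apply/asboolP; exact: rloop_sim_refl.
- by move=> a b; apply/asboolP/asboolP; exact: rloop_sim_sym.
- move=> b a c /asboolP ab /asboolP bc; apply/asboolP.
  exact: rloop_sim_trans bc.
Qed.

Canonical rloop_equiv := EquivRelPack rloop_simb_equiv.

Definition discrete_pi1 := {eq_quot rloop_simb}.
HB.instance Definition _ : EqQuotient rloop rloop_simb discrete_pi1 :=
  EqQuotient.on discrete_pi1.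
HB.instance Definition _ := Choice.on discrete_pi1.

Lemma discrete_pi1_eq (a b : rloop) :
  \pi_discrete_pi1 a = \pi_discrete_pi1 b <-> rloop_sim a b.
Proof.
split=> [/eqP|ab]; first by rewrite eqmodE => /asboolP.
by apply/eqP; rewrite eqmodE; exact/asboolP.
Qed.

Lemma discrete_pi1_repr (a : rloop) : rloop_sim (repr (\pi_discrete_pi1 a)) a.
Proof. by apply/discrete_pi1_eq; rewrite reprK. Qed.

Definition discrete_pi1_one : discrete_pi1 := \pi_discrete_pi1 rloop_one.
Definition discrete_pi1_mul (x y : discrete_pi1) : discrete_pi1 :=
  \pi_discrete_pi1 (rloop_cat (repr x) (repr y)).
Definition discrete_pi1_inv (x : discrete_pi1) : discrete_pi1 :=
  \pi_discrete_pi1 (rloop_inv (repr x)).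

Lemma discrete_pi1_mulE a b :
  discrete_pi1_mul (\pi_discrete_pi1 a) (\pi_discrete_pi1 b) =
  \pi_discrete_pi1 (rloop_cat a b).
Proof.
by apply/discrete_pi1_eq; apply: rloop_sim_cat; exact: discrete_pi1_repr.
Qed.

Lemma discrete_pi1_mulA : associative discrete_pi1_mul.
Proof.
elim/quotW => a; elim/quotW => b; elim/quotW => c.
rewrite (discrete_pi1_mulE b c) (discrete_pi1_mulE a b) !discrete_pi1_mulE.
by apply/discrete_pi1_eq; apply: rloop_eq; rewrite /= catA.
Qed.

Lemma discrete_pi1_mul1x : left_id discrete_pi1_one discrete_pi1_mul.
Proof.
elim/quotW => a; rewrite discrete_pi1_mulE; apply/discrete_pi1_eq.
exact: rloop_shift.
Qed.

Lemma discrete_pi1_mulx1 : right_id discrete_pi1_one discrete_pi1_mul.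
Proof.
elim/quotW => a; rewrite discrete_pi1_mulE; apply/discrete_pi1_eq.
exact: rloop_cat_oner.
Qed.

Lemma discrete_pi1_mulVx :
  left_inverse discrete_pi1_one discrete_pi1_inv discrete_pi1_mul.
Proof.
move=> x; rewrite -{2}[x]reprK discrete_pi1_mulE; apply/discrete_pi1_eq.
exact: rloop_cat_invl.
Qed.

Lemma discrete_pi1_mulxV :
  right_inverse discrete_pi1_one discrete_pi1_inv discrete_pi1_mul.
Proof.
move=> x; rewrite -{1}[x]reprK discrete_pi1_mulE; apply/discrete_pi1_eq.
exact: rloop_cat_invr.
Qed.

HB.instance Definition _ := isGroup.Build discrete_pi1 discrete_pi1_mulA
  discrete_pi1_mul1x discrete_pi1_mulx1 discrete_pi1_mulVx discrete_pi1_mulxV.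

End discrete_fundamental_group.

Section graph_distance.
Context {R : realType} (T : eqType) (e : rel T).

Definition graph_dist (u v : T) : \bar R :=
  ereal_inf [set (size s)%:R%:E | s in [set s | path e u s /\ last u s = v]].

Lemma graph_dist_le u s : path e u s ->
  (graph_dist u (last u s) <= (size s)%:R%:E)%E.
Proof. by move=> us; apply: ereal_inf_lbound; exists s. Qed.

Lemma graph_dist_ge0 u v : (0 <= graph_dist u v)%E.
Proof. by apply: le_ereal_inf_tmp => _ [s _ <-]; rewrite lee_fin. Qed.

Lemma graph_distP u v : graph_dist u v = +oo%E \/
  exists s, [/\ path e u s, last u s = v & graph_dist u v = (size s)%:R%:E].
Proof.
have [[s0 s0P]|ns] := pselect (exists s, path e u s /\ last u s = v); last first.
  left; rewrite /graph_dist (_ : mkset _ = set0) ?image_set0 ?ereal_inf0 //.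
  by apply/seteqP; split => // s sP; case: ns; exists s.
right.
pose P n := `[< exists s, [/\ path e u s, last u s = v & size s = n] >].
have exP : exists n, P n.
  by exists (size s0); apply/asboolP; exists s0; case: s0P.
case: (ex_minnP exP) => n /asboolP[s [us sv sn]] nmin.
exists s; split => //; apply/eqP; rewrite eq_le; apply/andP; split.
  by rewrite -[in leLHS]sv; exact: graph_dist_le.
apply: le_ereal_inf_tmp => _ [t [ut tv] <-]; rewrite lee_fin ler_nat sn.
by apply: nmin; apply/asboolP; exists t.
Qed.

Lemma graph_distxx u : graph_dist u u = 0%E.
Proof.
apply/eqP; rewrite eq_le graph_dist_ge0 andbT.
exact: (@graph_dist_le u [::]).
Qed.

Lemma graph_dist_eq0 u v : graph_dist u v = 0%E -> u = v.
Proof.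
have [->//|[s [_ sv ->]]] := graph_distP u v.
by move=> [] /eqP; rewrite pnatr_eq0 size_eq0 => /eqP s0; rewrite -sv s0.
Qed.

Lemma graph_dist_triangle u v w :
  (graph_dist u w <= graph_dist u v + graph_dist v w)%E.
Proof.
have [->|[s [us sv ->]]] := graph_distP u v.
  by rewrite addye ?leey // gt_eqF // (lt_le_trans ltNy0) // graph_dist_ge0.
have [->|[t [vt tw ->]]] := graph_distP v w; first by rewrite addey ?leey.
rewrite -EFinD -natrD -size_cat -[in leLHS]tw -sv -last_cat.
by apply: graph_dist_le; rewrite cat_path us sv.
Qed.

Lemma graph_distC u v : symmetric e -> graph_dist u v = graph_dist v u.
Proof.
move=> esym.
have le x y : (graph_dist x y <= graph_dist y x)%E.
  have [->|[s [ys sx ->]]] := graph_distP y x; first by rewrite leey.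
  have : path e (last y s) (rev (belast y s)).
    by rewrite rev_path; rewrite (eq_path (e' := e)).
  move=> /graph_dist_le; rewrite size_rev size_belast sx.
  suff -> : last x (rev (belast y s)) = y by [].
  by rewrite -sx; case: s {ys sx} => //= z s; rewrite rev_cons last_rcons.
by apply/eqP; rewrite eq_le !le.
Qed.

Definition graph_emetric (esym : symmetric e) : emetric R :=
  EMetric graph_distxx graph_dist_eq0 (fun u v => graph_distC u v esym)
    graph_dist_triangle.

End graph_distance.

Section manifold.
Context {R : realType}.

(* Partial derivatives up to order k exist and are continuous; meant for an
   open set U. *)
Fixpoint Ck (k : nat) (m n : nat) (U : set 'rV[R]_m)
    (f : 'rV[R]_m -> 'rV[R]_n) : Prop :=
  (forall x, U x -> {for x, continuous f}) /\
  if k is k'.+1 then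
    forall i : 'I_m, (forall x, U x -> derivable f x (delta_mx 0 i)) /\
      Ck k' U ('D_(delta_mx 0 i) f)
  else True.

Definition smooth_on (m n : nat) (U : set 'rV[R]_m)
    (f : 'rV[R]_m -> 'rV[R]_n) : Prop := forall k, Ck k U f.

Record chart (M : topologicalType) (n : nat) := Chart {
  chart_dom : set M;
  chart_map : M -> 'rV[R]_n;
  chart_inv : 'rV[R]_n -> M;
  chart_dom_open : open chart_dom;
  chart_codom_open : open (chart_map @` chart_dom);
  chart_mapK : {in chart_dom, cancel chart_map chart_inv};
  chart_map_continuous : {within chart_dom, continuous chart_map};
  chart_inv_continuous :
    {within chart_map @` chart_dom, continuous chart_inv} }.

Record smooth_atlas (M : topologicalType) (n : nat) := SmoothAtlas {
  atlas_charts : set (chart M n);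
  atlas_cover : forall x, exists2 c, atlas_charts c & chart_dom c x;
  atlas_smooth : forall c c', atlas_charts c -> atlas_charts c' ->
    smooth_on (chart_map c @` (chart_dom c `&` chart_dom c'))
      (chart_map c' \o chart_inv c) }.

Definition path_connected (M : topologicalType) : Prop :=
  forall x y : M, exists f : R -> M,
    [/\ {within `[0, 1], continuous f}, f 0 = x & f 1 = y].

End manifold.

Section length.
Context {R : realType} {M : metricType R}.

Definition curve_length (a b : R) (f : R -> M) : \bar R :=
  ereal_sup [set (\sum_(0 <= k < size s)
      mdist (f (nth b (a :: s) k)) (f (nth b (a :: s) k.+1)))%:E
    | s in itv_partition a b].

(* A loop is null-homotopic through free loops if and only if it is trivial in
   the fundamental group at its base point. *)
Definition contractible (p : M) (g : loop R p) : Prop :=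
  homotopic g (loop_cst R p).

End length.

(* This is +oo when every loop is contractible. *)
Definition noncontractible_length {R : realType} (M : metricType R) : \bar R :=
  ereal_inf [set l | exists (p : M) (g : loop R p),
    ~ contractible g /\ l = curve_length 0 1 g].

Section cube.
Context {R : realType} (k : nat).

Definition cube : set 'rV[R]_k := [set x | forall j, x ord0 j \in `[0, 1]].

Definition open_cube : set 'rV[R]_k := [set x | forall j, x ord0 j \in `]0, 1[].

(* A face of the k-cube fixes some coordinates to an endpoint (Some _) and
   leaves the others free (None). *)
Definition cube_face := {ffun 'I_k -> option bool}.

Definition cube_face_dim (F : cube_face) : nat := #|[pred j | F j == None]|.

Definition cube_face_le (F G : cube_face) : bool :=
  [forall j, (G j == None) || (F j == G j)].

End cube.

Arguments cube {R} k _.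
Arguments open_cube {R} k _.

Section rectangulation.
Context {R : realType} (M : metricType R).

(* A finite regular cell complex on M: balls are modelled on cubes, and a
   characteristic map, being continuous and injective on a compact space, is a
   homeomorphism onto the closed cell. *)
Record regular_complex := RegularComplex {
  cell : finType;
  cell_dim : cell -> nat;
  cell_map : forall i : cell, 'rV[R]_(cell_dim i) -> M;
  closed_cell := fun i => @cell_map i @` cube (cell_dim i);
  open_cell := fun i => @cell_map i @` open_cube (cell_dim i);
  cell_boundary := fun i =>
    @cell_map i @` (cube (cell_dim i) `\` open_cube (cell_dim i));
  cell_map_continuous : forall i,
    {within cube (cell_dim i), continuous (@cell_map i)};
  cell_map_inj : forall i, {in cube (cell_dim i) &, injective (@cell_map i)};
  open_cell_cover : \bigcup_i open_cell i = [set: M];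
  open_cell_disjoint : trivIset [set: cell] open_cell;
  cell_boundaryE : forall i, cell_boundary i =
    \bigcup_(j in [set j | (cell_dim j < cell_dim i)%N /\
                           closed_cell j `<=` cell_boundary i]) closed_cell j }.

(* The poset of the closed cells contained in a given one is that of the faces of
   a cube. *)
Definition combinatorial_cube (K : regular_complex) (i : cell K) : Prop :=
  exists phi : cube_face (cell_dim i) -> cell K,
    [/\ (forall j, closed_cell j `<=` closed_cell i <-> exists F, phi F = j),
        (forall F G, closed_cell (phi F) `<=` closed_cell (phi G) <->
                     cube_face_le F G) &
        (forall F, cell_dim (phi F) = cube_face_dim F)].

(* For a 1-dimensional cell, [const_mx t] is the point t of the interval. *)
Definition edge_curve (K : regular_complex) (i : cell K) (t : R) : M :=
  @cell_map K i (const_mx t).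

Definition edge_length (K : regular_complex) (i : cell K) : \bar R :=
  curve_length 0 1 (edge_curve i).

Record rectangulation := Rectangulation {
  rect_complex :> regular_complex;
  rect_cube : forall i : cell rect_complex, combinatorial_cube i;
  rect_edge_finite : forall i : cell rect_complex,
    cell_dim i = 1%N -> (edge_length i < +oo)%E }.

Definition fine_enough (Q : rectangulation) : Prop :=
  forall i : cell Q, cell_dim i = 1%N ->
    (edge_length i <= noncontractible_length M * (5^-1)%:E)%E.

Definition vertex (Q : rectangulation) := {i : cell Q | cell_dim i == 0%N}.

Definition adjacent (Q : rectangulation) (u v : vertex Q) : bool :=
  (u != v) && `[< exists i : cell Q, [/\ cell_dim i = 1%N,
    closed_cell (val u) `<=` closed_cell i &
    closed_cell (val v) `<=` closed_cell i] >].

Lemma adjacent_sym (Q : rectangulation) : symmetric (@adjacent Q).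
Proof.
move=> u v; rewrite /adjacent eq_sym; congr (_ && _).
by apply/asboolP/asboolP => -[i [? ? ?]]; exists i.
Qed.

Definition natural_graph (Q : rectangulation) : emetric R :=
  graph_emetric (@adjacent_sym Q).

End rectangulation.

(* Main.v *)
(* Edge loops of the graph X are realized in M by the sides of the rectangulation.
   This respects discrete homotopy, since a closed chain of at most four sides has
   length at most 4l/5 < l and is therefore contractible.

   Surjectivity: remove the cells one by one, in decreasing dimension.  A path in a
   union of cells with e of maximal dimension splits into pieces lying in e and
   pieces missing its center, which are pushed radially to the boundary; and a path
   inside a cell is homotopic to a path along its sides.

   Injectivity: the discrete fundamental group defines a local system on M.  Its
   transition between two cells of which one is a face of the other is the holonomy
   along sides of the larger one; this is well defined, as in the graph of a cube
   every closed path is filled by 4-cycles.  The monodromy of this system is an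
   invariant of homotopy, and on the realization of an edge loop it is, up to
   conjugation, the class of the loop. *)
Require Import Defs.
From mathcomp Require Import all_boot all_order all_algebra.
From mathcomp Require Import all_classical all_reals all_analysis.
From mathcomp Require Import generic_quotient lra zify.

Set Implicit Arguments.
Unset Strict Implicit.
Unset Printing Implicit Defensive.

Import Order.TTheory GRing.Theory Num.Theory.
Import numFieldNormedType.Exports.

Local Open Scope classical_set_scope.
Local Open Scope ring_scope.
Local Open Scope quotient_scope.

(** * Holonomy of cocycles on the graph *)

(** Both directions rest on one notion, a flat cocycle: a function on pairs of vertices, with values
    in a group, whose products along the two halves of a 4-cycle agree. One such cocycle, [mu], has
    values in the fundamental group of M; it is flat because of the constant 1/5, and its holonomy
    is the homomorphism [realize]. The other, [univ_cocycle], has values in the discrete group, and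
    the monodromy of its local system is a map back. The composite on the discrete group is only
    conjugation by a fixed element, since the base point of M and the base vertex are unrelated, but
    this is enough for injectivity. The obstacle is that a curve may change cells infinitely often.
    No subdivision of the curve is chosen: it is extended to the whole line by [clamp], and what is
    to be shown is put in a form that propagates both ways near every parameter, so that
    connectedness of the line concludes. *)

Section holonomy.
Context {R : realType} {X : emetric R} (r : {posnum R}) {G : groupType}.
Implicit Types (u w x y z : X) (s t : seq X).

Record flat (l : X -> X -> G) : Prop := Flat {
  flatxx : forall u, l u u = 1%g;
  flat_square : forall u w y z, rstep r u w -> rstep r w z -> rstep r u y ->
    rstep r y z -> (l u w * l w z = l u y * l y z)%g }.

Fixpoint hol (l : X -> X -> G) u s : G :=
  if s is w :: s' then (l u w * hol l w s')%g else 1%g.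

Lemma hol_cat l u s t : hol l u (s ++ t) = (hol l u s * hol l (last u s) t)%g.
Proof. by elim: s u => [|w s IH] u /=; rewrite ?mul1g // IH mulgA. Qed.

Variable l : X -> X -> G.
Hypothesis lflat : flat l.

(** This is a degenerate square: [rstep] is reflexive, so flatness also governs backtracking and
    triangles. *)
Lemma flat_inv u w : rstep r u w -> (l u w * l w u = 1)%g.
Proof.
move=> uw; rewrite (flat_square lflat uw _ (rstep_refl r u) (rstep_refl r u)).
  by rewrite flatxx // mulg1.
by rewrite rstep_sym.
Qed.

(** The two walks are the sides of a ladder. Each square between consecutive rungs commutes by
    flatness, and the inner rungs cancel. *)
Lemma hol_ladder x y s t : path (rstep r) x s -> path (rstep r) y t ->
  size s = size t ->
  (forall i, (i <= size s)%N -> rstep r (nth x (x :: s) i) (nth x (y :: t) i)) ->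
  (hol l x s * l (last x s) (last y t) = l x y * hol l y t)%g.
Proof.
elim: s t x y => [|x' s IH] [|y' t] // x y /=; first by rewrite mulg1 mul1g.
move=> /andP[xx' xs] /andP[yy' yt] [st] H.
have xy := H 0%N isT; have xy' := H 1%N isT; rewrite /= in xy xy'.
rewrite -mulgA (IH t) //; last first.
  move=> i si; have := H i.+1 si; rewrite /=.
  rewrite (set_nth_default x) ?[X in _ -> rstep _ _ X](set_nth_default x) //=.
  by rewrite -st.
by rewrite !mulgA (flat_square lflat xx' xy' xy yy').
Qed.

Variable p : X.

Definition loop_hol (a : rloop r p) : G := hol l p (behead a).

Lemma rloopE (a : rloop r p) : rloop_seq a = p :: behead a.
Proof. by case: a => [[|x s] [//= _ _ -> _]]. Qed.

Lemma rloop_path (a : rloop r p) : path (rstep r) p (behead a).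
Proof. by case: a => [[|x s] [//= _ + <- _]]. Qed.

Lemma rloop_last (a : rloop r p) : last p (behead a) = p.
Proof. by case: a => [[|x s] [//= _ _ <- ->]]. Qed.

Lemma loop_hol_near (a b : rloop r p) : size a = size b ->
  (forall i, (i < size a)%N -> rstep r (nth p a i) (nth p b i)) ->
  loop_hol a = loop_hol b.
Proof.
rewrite (rloopE a) (rloopE b) /= => -[sab] H.
have := hol_ladder (rloop_path a) (rloop_path b) sab H.
by rewrite !rloop_last flatxx // mulg1 mul1g.
Qed.

Lemma loop_hol_grid (a b : rloop r p) : rloop_grid a b -> loop_hol a = loop_hol b.
Proof.
move=> [m [n [F [Fa Fb Frow Fcol]]]].
suff H i : loop_hol (Rloop (Frow i)) = loop_hol (Rloop (Frow ord0)).
  have -> : loop_hol b = loop_hol (Rloop (Frow ord_max)).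
    by rewrite /loop_hol /= Fb.
  by rewrite H /loop_hol /= Fa.
case: i => i; elim: i => [|i IH] ilt.
  by congr loop_hol; rewrite (_ : Ordinal ilt = ord0) //; exact: val_inj.
have sz k : size (Rloop (Frow k)) = n.
  by rewrite -[rloop_seq _]/[seq F k j | j : 'I_n] size_map -cardE card_ord.
rewrite -(IH (ltnW ilt)); apply: loop_hol_near => [|k]; rewrite !sz // => kn.
have nE i' : nth p (Rloop (Frow i')) k = F i' (Ordinal kn).
  rewrite -[rloop_seq _]/[seq F i' j | j : 'I_n].
  rewrite (nth_map (Ordinal kn)) -?cardE ?card_ord //.
  by congr (F _ _); apply: ord_inj; rewrite nth_enum_ord.
have cE i' (hi : (i' < m.+1)%N) :
    nth p [seq F i0 (Ordinal kn) | i0 : 'I_m.+1] i' = F (Ordinal hi) (Ordinal kn).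
  rewrite (nth_map ord0) -?cardE ?card_ord //.
  by congr (F _ _); apply: ord_inj; rewrite nth_enum_ord.
rewrite !nE -!cE; have /(rpathP r p) := Fcol (Ordinal kn).
by move=> /(_ i.+1 i); rewrite size_map -cardE card_ord => H; apply: H; lia.
Qed.

Lemma loop_hol_sim (a b : rloop r p) : rloop_sim a b -> loop_hol a = loop_hol b.
Proof.
elim=> {a b} [//|a b _ -> //|a b c _ -> //|a b|a b]; last exact: loop_hol_grid.
rewrite /loop_hol => ->; rewrite {2}rloopE /= -cats1 hol_cat rloop_last /=.
by rewrite flatxx // !mulg1.
Qed.

Lemma loop_hol_catE (a b : rloop r p) :
  loop_hol (rloop_cat a b) = (loop_hol a * loop_hol b)%g.
Proof.
rewrite /loop_hol [rloop_seq (rloop_cat a b)]/= (rloopE a) /= hol_cat rloop_last.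
by rewrite (rloopE b) /= flatxx // mul1g.
Qed.

Definition pi1_hol (x : discrete_pi1 r p) : G := loop_hol (repr x).

Lemma pi1_holE (a : rloop r p) : pi1_hol (\pi_(discrete_pi1 r p) a) = loop_hol a.
Proof. by apply: loop_hol_sim; exact: discrete_pi1_repr. Qed.

Lemma pi1_holM : {morph pi1_hol : x y / (x * y)%g}.
Proof.
elim/quotW => a; elim/quotW => b.
have -> : (\pi_(discrete_pi1 r p) a * \pi_(discrete_pi1 r p) b)%g =
  \pi_(discrete_pi1 r p) (rloop_cat a b) by exact: discrete_pi1_mulE.
by rewrite !pi1_holE loop_hol_catE.
Qed.

End holonomy.

(** * Closed walks in the discrete fundamental group *)

Section walk_classes.
Context {R : realType} {X : emetric R} (r : {posnum R}) (p : X).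
Implicit Types (u w : X) (s t : seq X).
Local Notation A := (discrete_pi1 r p).

Definition closed_walk s := path (rstep r) p s /\ last p s = p.

Lemma closed_walk_rloop s : closed_walk s -> is_rloop r p (p :: rcons s p).
Proof.
move=> [ps ls]; split => //=; first by rewrite size_rcons.
- by rewrite /rpath /= rcons_path ps ls rstep_refl.
- by rewrite last_rcons.
Qed.

(* The class of a closed walk from p, written without its starting point; the
   junk value on other sequences is 1. *)
Definition walk_class s : A :=
  if pselect (closed_walk s) is left h then \pi_A (Rloop (closed_walk_rloop h))
  else 1%g.

Lemma walk_classE s (h : closed_walk s) :
  walk_class s = \pi_A (Rloop (closed_walk_rloop h)).
Proof.
rewrite /walk_class; case: pselect => // h'.
by apply/discrete_pi1_eq; exact: rloop_eq.
Qed.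

Lemma walk_class_near s t : closed_walk s -> closed_walk t -> size s = size t ->
  (forall i, (i < size s)%N -> rstep r (nth p s i) (nth p t i)) ->
  walk_class s = walk_class t.
Proof.
move=> hs ht st H; rewrite (walk_classE hs) (walk_classE ht).
apply/discrete_pi1_eq/rloop_sim_grid/rloop_near_grid => /=.
  by rewrite !size_rcons st.
case=> [|i] /=; first by rewrite rstep_refl.
rewrite size_rcons !ltnS => si; rewrite !nth_rcons -st.
by case: ltngtP si => // [/H //|_ _]; exact: rstep_refl.
Qed.

Lemma loop_class (a : rloop r p) : \pi_A a = walk_class (behead a).
Proof.
have h : closed_walk (behead a) by split; [exact: rloop_path|exact: rloop_last].
rewrite (walk_classE h); apply/discrete_pi1_eq; apply: rloop_sim_stutter.
by rewrite /= {2}rloopE.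
Qed.

Lemma walk_class0 : walk_class [::] = 1%g.
Proof.
have h : closed_walk [::] by [].
by rewrite (walk_classE h); apply/discrete_pi1_eq/rloop_eq.
Qed.

Lemma closed_walk_stutter s t : closed_walk (s ++ t) ->
  closed_walk (s ++ last p s :: t).
Proof.
rewrite /closed_walk !cat_path !last_cat /= => -[/andP[-> ->] ->].
by rewrite rstep_refl.
Qed.

(** The defining relation only repeats the base point at the end. Inserting a repetition in the
    middle instead delays the rest of the walk by one position, which moves every entry by at most
    one step. *)
Lemma walk_class_stutter s t : closed_walk (s ++ t) ->
  walk_class (s ++ last p s :: t) = walk_class (s ++ t).
Proof.
move=> h; have h' := closed_walk_stutter h.
have hr : closed_walk (rcons (s ++ t) p).
  by case: h => pst lst; rewrite /closed_walk rcons_path last_rcons pst lst rstep_refl.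
transitivity (walk_class (rcons (s ++ t) p)); last first.
  rewrite (walk_classE h) (walk_classE hr).
  by apply/discrete_pi1_eq/rloop_sim_sym/rloop_sim_stutter.
apply: walk_class_near => //; first by rewrite size_rcons !size_cat /= addnS.
have : path (rstep r) (last p s) (rcons t p).
  by case: hr => + _; rewrite rcons_cat cat_path => /andP[].
move=> /(pathP p) H i; rewrite size_cat rcons_cat !nth_cat /= => ilt.
case: ltnP => si; first exact: rstep_refl.
have := H (i - size s)%N; rewrite size_rcons -rcons_cons nth_rcons /=.
have -> : (i - size s < (size t).+1)%N by lia.
exact.
Qed.

Lemma path_rev_walk u s : path (rstep r) u s ->
  path (rstep r) (last u s) (rev (belast u s)).
Proof.
by rewrite rev_path (eq_path (e' := rstep r)) // => x y; rewrite rstep_sym.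
Qed.

Lemma last_rev_belast_last u s : last (last u s) (rev (belast u s)) = u.
Proof. by case: s => //= x s; rewrite rev_cons last_rcons. Qed.

Lemma rev_belastK u s : rev (belast (last u s) (rev (belast u s))) = s.
Proof.
have : rev (last u s :: rev (belast u s)) = u :: s.
  by rewrite -rev_rcons -lastI revK.
by rewrite [X in rev X = _]lastI last_rev_belast_last rev_rcons => -[].
Qed.

(** A spur is removed from its tip: the tip [x] is one step from its predecessor [y], so [y x y] may
    be replaced by [y y y], and the repetitions are then dropped. *)
Lemma walk_class_fold s t q : closed_walk (s ++ t) ->
  path (rstep r) (last p s) q ->
  walk_class (s ++ q ++ rev (belast (last p s) q) ++ t) = walk_class (s ++ t).
Proof.
move=> h; elim/last_ind: q => [//|q x IH].
rewrite rcons_path => /andP[uq yx].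
rewrite -(IH uq) belast_rcons lastI rev_rcons /=; set y := last _ q.
set b := rev _; rewrite cat_rcons.
have yE : last p (s ++ q) = y by rewrite last_cat.
have hb : closed_walk ((s ++ q) ++ b ++ t).
  case: h; rewrite /closed_walk !cat_path !last_cat => /andP[-> st] lt.
  by rewrite uq path_rev_walk //= last_rev_belast_last st; split.
have h2 := closed_walk_stutter hb.
have h3 : closed_walk ((s ++ q) ++ [:: y, y & b ++ t]).
  have := @closed_walk_stutter (rcons (s ++ q) y) (b ++ t).
  by rewrite last_rcons !cat_rcons -yE; exact.
have h4 : closed_walk ((s ++ q) ++ [:: x, y & b ++ t]).
  case: h3; rewrite /closed_walk !(cat_path, last_cat) /= -/y.
  by move=> /and3P[/andP[-> ->] _ /andP[_ ->]] ->; rewrite yx rstep_sym yx.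
rewrite !catA -[(s ++ q) ++ _]catA -/y.
transitivity (walk_class ((s ++ q) ++ [:: x, y & b ++ t])).
  by rewrite -!catA.
rewrite (walk_class_near h4 h3); first last.
- move=> i _; rewrite !nth_cat; case: ifP => _; first exact: rstep_refl.
  case: (i - _)%N => [|n]; last exact: rstep_refl.
  by rewrite /= rstep_sym.
- by rewrite !size_cat.
transitivity (walk_class ((s ++ q) ++ y :: (b ++ t))).
  have := @walk_class_stutter (rcons (s ++ q) y) (b ++ t).
  by rewrite last_rcons !cat_rcons => ->; rewrite -?yE.
by rewrite -yE walk_class_stutter // -!catA.
Qed.

Lemma closed_walk_cat s t : closed_walk s -> closed_walk t -> closed_walk (s ++ t).
Proof.
by move=> [ps ls] [pt lt]; rewrite /closed_walk cat_path last_cat ls ps pt.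
Qed.

Lemma walk_class_cat s t : closed_walk s -> closed_walk t ->
  walk_class (s ++ t) = (walk_class s * walk_class t)%g.
Proof.
move=> hs ht; rewrite (walk_classE hs) (walk_classE ht).
set a := Rloop _; set b := Rloop _.
have -> : (\pi_A a * \pi_A b)%g = \pi_A (rloop_cat a b) by exact: discrete_pi1_mulE.
rewrite loop_class /=.
have hst := closed_walk_cat hs ht; case: (hs) => _ ls.
have h1 : closed_walk (s ++ p :: t) by rewrite -{1}ls; exact: closed_walk_stutter.
rewrite -rcons_cons -rcons_cat.
have h2 : closed_walk (rcons s p ++ p :: t).
  have := @closed_walk_stutter (rcons s p) t; rewrite last_rcons; apply.
  by rewrite cat_rcons.
have := @walk_class_stutter (rcons s p ++ p :: t) [::].
rewrite !cats0 => /(_ h2); case: (h2) => _ ->; rewrite cats1 => ->.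
have := @walk_class_stutter (rcons s p) t; rewrite last_rcons => ->; last first.
  by rewrite cat_rcons.
by rewrite cat_rcons -{2}ls walk_class_stutter.
Qed.

End walk_classes.

(* The universal flat cocycle: with values in the discrete fundamental group, its
   holonomy along a loop is the class of the loop. *)
Section universal_cocycle.
Context {R : realType} {X : emetric R} (r : {posnum R}) (p : X).
Variable rho : X -> seq X.
Hypothesis rhop : rho p = [::].
Hypothesis rhoP : forall u, path (rstep r) p (rho u) /\ last p (rho u) = u.
Implicit Types (u w : X) (s t : seq X).
Local Notation A := (discrete_pi1 r p).

Let back u := rev (belast p (rho u)).

Definition univ_cocycle u w : A := walk_class r p (rho u ++ w :: back w).

Let path_back u : path (rstep r) u (back u).
Proof. by have [/path_rev_walk] := rhoP u; rewrite /back => + e; rewrite e. Qed.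

Let last_back u : last u (back u) = p.
Proof.
by have [_ {1}<-] := rhoP u; rewrite last_rev_belast_last.
Qed.

Lemma closed_walk_back u s : path (rstep r) u s ->
  closed_walk r p (rho u ++ s ++ back (last u s)).
Proof.
move=> us; have [pu lu] := rhoP u; rewrite /closed_walk !cat_path !last_cat.
by rewrite lu us pu path_back last_back.
Qed.

(** At each intermediate vertex [w] the way back from [w] is followed by the way out along [rho w];
    this spur folds, so the product telescopes. *)
Lemma hol_univ_cocycle u s : path (rstep r) u s ->
  hol univ_cocycle u s = walk_class r p (rho u ++ s ++ back (last u s)).
Proof.
elim: s u => [|w s IH] u /= => [_|/andP[uw ws]].
  have [pu lu] := rhoP u.
  have := @walk_class_fold _ _ r p [::] [::] (rho u).
  by rewrite /= !cats0 => ->; rewrite ?walk_class0.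
have hw : closed_walk r p (rho u ++ w :: back w).
  by have := @closed_walk_back u [:: w]; rewrite /= uw; exact.
rewrite (IH _ ws) /univ_cocycle -walk_class_cat //; last exact: closed_walk_back.
have := @walk_class_fold _ _ r p (rcons (rho u) w) (s ++ back (last w s)) (back w).
rewrite last_rcons !cat_rcons /= => <-; last exact: path_back.
  have -> : rev (belast w (back w)) = rho w.
    by have [_ lw] := rhoP w; rewrite -[X in belast X]lw rev_belastK.
  by rewrite -!catA /= -?catA.
by have := @closed_walk_back u (w :: s); rewrite /= uw ws; exact.
Qed.

(** The two halves of the square are compared with a delay: [w z z] against [u y z], which differ by
    at most one step in each position. *)
Lemma univ_cocycle_flat : flat r univ_cocycle.
Proof.
split=> [u|u w y z uw wz uy yz].
  rewrite /univ_cocycle; have [pu lu] := rhoP u.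
  have h := @closed_walk_back u [::] isT.
  by rewrite -{2}lu walk_class_stutter //= -(@hol_univ_cocycle u [::]).
have E w' : rstep r u w' -> rstep r w' z ->
    (univ_cocycle u w' * univ_cocycle w' z)%g =
    hol univ_cocycle u [:: w'; z].
  by rewrite /= mulg1.
have [pu lu] := rhoP u.
have hw := @closed_walk_back u [:: w; z].
have hy := @closed_walk_back u [:: y; z].
rewrite !E // !hol_univ_cocycle /= ?uw ?wz ?uy ?yz //=.
have := @walk_class_stutter _ _ r p (rho u ++ [:: w; z]) (back z).
have := @walk_class_stutter _ _ r p (rho u) [:: y, z & back z].
have := @closed_walk_stutter _ _ r p (rho u ++ [:: w; z]) (back z).
have := @closed_walk_stutter _ _ r p (rho u) [:: y, z & back z].
rewrite lu last_cat -!catA /=.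
rewrite /= uy yz /= in hy; rewrite /= uw wz /= in hw.
move=> /(_ (hy isT)) h1 /(_ (hw isT)) h2 /(_ (hy isT)) <- /(_ (hw isT)) <-.
apply: walk_class_near => //; first by rewrite !size_cat.
move=> i _; rewrite !nth_cat; case: ifP => _; first exact: rstep_refl.
case: (i - _)%N => [|[|n]] /=; last exact: rstep_refl.
- by rewrite rstep_sym.
- by rewrite rstep_sym.
Qed.

Lemma hol_univ_cocycle_loop (a : rloop r p) :
  loop_hol univ_cocycle a = \pi_A a.
Proof.
rewrite /loop_hol hol_univ_cocycle; last exact: rloop_path.
by rewrite rloop_last /back rhop cats0 loop_class.
Qed.

End universal_cocycle.

(** * Monodromy of a local system over a stratified space *)

Section connectedness.
Context {R : realType}.

(** The set where [P] holds is open and closed. This takes the place of Lebesgue numbers and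
    subdivisions in all arguments along a curve. *)
Lemma locally_constant_real (P : R -> Prop) t :
  (forall x, \forall y \near x, P y <-> P x) -> P t -> forall s, P s.
Proof.
move=> H Pt s.
have cR : connected [set: R] by apply/connected_intervalP.
have oP : open [set x | P x].
  by rewrite openE => x /= Px; apply: filterS (H x) => y /= yx; exact/yx.
have cP : closed [set x | P x].
  rewrite -[X in closed X]setCK closedC openE => x /= nPx.
  by apply: filterS (H x) => y /= yx; rewrite yx.
have /(congr1 (@^~ s)) : [set x | P x] = [set: R].
  apply: cR; first by exists t.
    by exists [set x | P x] => //; rewrite setTI.
  by exists [set x | P x] => //; rewrite setTI.
by move=> /= ->.
Qed.

End connectedness.

Section monodromy.
Context {R : realType} {M : topologicalType} {G : groupType}.
Variables (sle : M -> M -> Prop) (tau : M -> M -> G).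
Hypothesis sle_near : forall x, \forall y \near x, sle x y.
Hypothesis tauM : forall x y z, sle x y -> sle y z ->
  tau x z = (tau x y * tau y z)%g.
Implicit Types (f : R -> M) (g : R -> G) (s t : R).

Let sle_refl x : sle x x. Proof. exact: nbhs_singleton (sle_near x). Qed.

Lemma tauxx x : tau x x = 1%g.
Proof. by apply: (mulgI (tau x x)); rewrite -tauM ?mulg1. Qed.

(** Parallel transport along [f]. The condition is one-sided because [tau x y] is controlled only
    when [sle x y], and [sle_near] provides this for [y] near [x] but not conversely. *)
Definition lift f g := forall t, \forall s \near t, g s = (g t * tau (f t) (f s))%g.

Lemma lift_mul f g a : lift f g -> lift f (fun t => a * g t)%g.
Proof. by move=> H t; apply: filterS (H t) => s ->; rewrite mulgA. Qed.

Lemma lift_comp f g (phi : R -> R) : continuous phi -> lift f g ->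
  lift (f \o phi) (g \o phi).
Proof. by move=> cphi H t; exact: cphi (H (phi t)). Qed.

Lemma lift_unique f g g' : lift f g -> lift f g' -> g 0 = g' 0 -> g =1 g'.
Proof.
move=> H H'; apply: (@locally_constant_real R (fun t => g t = g' t)) => t.
near=> s; have -> := near (H t) s; rewrite ?(near (H' t) s) //.
by split=> [/mulIg|->].
Unshelve. all: by end_near. Qed.


(** The property that a lift exists up to [u] is locally constant in [u]. It is stated for all real
    [u], being implied by [Q 0] when [u] is negative, so that the argument runs over the whole
    line. *)
Lemma lift_exists f : continuous f ->
  exists g, g 0 = 1%g /\ forall t, 0 <= t <= 1 ->
    \forall s \near t, g s = (g t * tau (f t) (f s))%g.
Proof.
move=> cf.
pose Q u := exists g, g 0 = 1%g /\ forall t, 0 <= t <= u ->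
    \forall s \near t, g s = (g t * tau (f t) (f s))%g.
suff : Q 1 by [].
have Qle u u' : u' <= u -> Q u -> Q u'.
  move=> u'u [g [g0 gl]]; exists g; split=> // t /andP[t0 tu'].
  by apply: gl; rewrite t0 (le_trans tu').
have Q0 : Q 0.
  exists (fun s => tau (f 0) (f s)); split=> [|t]; first exact: tauxx.
  rewrite -eq_le => /eqP <-.
  by apply: filterE => s; rewrite tauxx mul1g.
apply: (locally_constant_real _ Q0) => t0.
have /nbhs_ballP[e /= e0 He] := cf t0 _ (sle_near (f t0)).
have ext u u' : 0 <= u -> u < u' -> ball t0 e u -> ball t0 e u' -> Q u -> Q u'.
  move=> u0 uu' bu bu' [g [g0 gl]].
  have lu : forall s, u <= s <= u' -> sle (f t0) (f s).
    move=> s /andP[us su']; apply: He; move: bu bu'.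
    rewrite /ball /= !ltr_norml => /andP[? ?] /andP[? ?].
    by apply/andP; split; lra.
  (* Near [t0] every [f s] is above [f t0], so the passage from [f u] to [f s] is made through
     [f t0], even if [f u] and [f s] are not comparable. *)
  pose g' s := if s <= u then g s else
    (g u * (tau (f t0) (f u))^-1 * tau (f t0) (f s))%g.
  exists g'; split; first by rewrite /g' u0.
  move=> t /andP[t00 tu']; rewrite /g'.
  have [tu|ut] := leP t u; last first.
    have nt : \forall s \near t, u < s by exact: lt_nbhsr.
    near=> s; rewrite [s <= u]leNgt (near nt s) //= -[RHS]mulgA -tauM //.
      by apply: lu; rewrite ltW.
    by near: s; exact: cf (sle_near (f t)).
  have := gl t; rewrite t00 => /(_ tu) nt.
  case: (ltgtP t u) tu => // [tu|tu] _.
    have ntu : \forall s \near t, s < u by exact: lt_nbhsl.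
    by near=> s; rewrite ltW ?(near ntu s) // (near nt s).
  rewrite -tu; near=> s; case: ifP => _; first by near: s.
  rewrite -mulgA; congr (_ * _)%g; rewrite (@tauM (f t0) (f t) (f s)) ?mulKg //.
    by apply: lu; rewrite tu lexx ltW.
  by near: s; exact: cf (sle_near (f t)).
(* Signs: if [u] is negative and [u'] positive, the extension starts from 0, which lies between them
   and hence in the ball. *)
have {}ext u u' : ball t0 e u -> ball t0 e u' -> Q u -> Q u'.
  move=> bu bu' Qu; have [u'u|uu'] := leP u' u; first exact: Qle Qu.
  have [u0|u0] := leP 0 u; first exact: ext Qu.
  have [u'0|u'0] := leP u' 0; first exact: Qle Q0.
  apply: ext Q0 => //; move: bu bu'.
  rewrite /ball /= !ltr_norml => /andP[? ?] /andP[? ?].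
  by apply/andP; split; lra.
apply/nbhs_ballP; exists e => //= t bt; split; apply: ext => //; exact: ballxx.
Unshelve. all: by end_near. Qed.

Lemma lift_clamp_exists f : continuous f -> exists2 g, g 0 = 1%g & lift (f \o clamp) g.
Proof.
move=> cf; have [g [g0 gl]] := lift_exists cf.
exists (g \o clamp) => [|t]; first by rewrite /= clamp_id ?g0 //; exact: in01_0.
have := gl (clamp t); have := clamp_in t; rewrite /= in_itv /= => -> /(_ isT).
exact: clamp_cont.
Qed.

(** Connectedness is used in both variables: in [s] for the conclusion, and in [t] to carry the
    comparison [good] of neighbouring lifts from 0 to 1, where the fixed endpoint turns it into an
    equality. *)
Lemma lift_homotopy (H : R * R -> M) (G' : R -> R -> G) x y : continuous H ->
  (forall s, lift (fun t => H (s, t)) (G' s)) -> (forall s, G' s 0 = 1%g) ->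
  (forall s, H (s, 0) = x) -> (forall s, H (s, 1) = y) ->
  forall s s', G' s 1 = G' s' 1.
Proof.
move=> cH lG G0 Hx Hy.
suff lc s0 : \forall s \near s0, G' s 1 = G' s0 1.
  move=> s' s0; move: s'; apply: (@locally_constant_real R _ s0) => // s1.
  by near=> s; rewrite (near (lc s1) s).
suff good t : \forall s \near s0, G' s t = (G' s0 t * tau (H (s0, t)) (H (s, t)))%g.
  by near=> s; rewrite (near (good 1) s) // !Hy tauxx mulg1.
move: t; apply: (@locally_constant_real R _ 0) => [t0|]; last first.
  by apply: filterE => s; rewrite !Hx tauxx !G0 mulg1.
have /nbhs_ballP[e /= e0 He] := cH (s0, t0) _ (sle_near (H (s0, t0))).
set c := H (s0, t0) in He.
have lec s t : ball s0 e s -> ball t0 e t -> sle c (H (s, t)).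
  by move=> bs bt; apply: He; split.
(* The lift seen from the frame at [c]. As all values of [H] near (s0, t0) are above [c], it does
   not vary with [t] there. *)
pose k s t := (G' s t * (tau c (H (s, t)))^-1)%g.
have kE s t : ball s0 e s -> ball t0 (e / 2) t -> k s t = k s t0.
  move=> bs bt.
  (* Retraction of the line onto a closed interval around [t0], so that the argument on the whole
     line applies; the radius e / 2 keeps the interval inside the ball of radius [e]. *)
  pose clip (t : R) := Num.max (t0 - e / 2) (Num.min (t0 + e / 2) t).
  have clipin t' : ball t0 e (clip t').
    have lo : t0 - e / 2 <= clip t' by rewrite /clip le_max lexx.
    have hi : clip t' <= t0 + e / 2.
      by rewrite /clip ge_max ge_min lexx andbT; lra.
    by rewrite /ball /= ltr_norml; move: e0 lo hi; lra.
  have clipid t' : ball t0 (e / 2) t' -> clip t' = t'.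
    by rewrite /ball /= ltr_norml /clip => /andP[? ?]; rewrite min_r ?max_r //; lra.
  have cclip : continuous clip.
    apply: max_cont; first exact: cst_cont.
    by apply: min_cont; [exact: cst_cont|exact: id_cont].
  rewrite -(clipid t) //.
  apply: (@locally_constant_real R (fun t => k s (clip t) = k s t0) t0).
    move=> t1; have lt1 : \forall t' \near t1, k s (clip t') = k s (clip t1).
      have cHs : {for clip t1, continuous (fun t => H (s, t))}.
        by apply: continuous_comp; [exact: cvg_pair (cvg_cst _) cvg_id|exact: cH].
      suff : \forall t' \near clip t1, k s t' = k s (clip t1) by exact: cclip.
      near=> t'; rewrite /k.
      have sle1 : sle (H (s, clip t1)) (H (s, t')).
        by near: t'; exact: cHs (sle_near _).
      rewrite (near (lG s (clip t1)) t') // (@tauM c (H (s, clip t1))) //.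
        by rewrite invgM mulgA mulgK.
      exact: lec.
    by near=> t'; rewrite (near lt1 t').
  by rewrite clipid //; apply: ballxx; rewrite divr_gt0.
have goodE t : ball t0 (e / 2) t ->
    ((\forall s \near s0, G' s t = (G' s0 t * tau (H (s0, t)) (H (s, t)))%g) <->
     \forall s \near s0, k s t0 = k s0 t0).
  move=> bt; have bte : ball t0 e t.
    by apply: le_ball bt; rewrite ler_pdivrMr //; lra.
  have cHt : {for s0, continuous (fun s => H (s, t))}.
    by apply: continuous_comp; [exact: cvg_pair cvg_id (cvg_cst _)|exact: cH].
  have nH := cHt _ (sle_near (H (s0, t))).
  have bs0 : ball s0 e s0 by exact: ballxx.
  have nb : \forall s \near s0, ball s0 e s by exact: nbhsx_ballx.
  have E s : ball s0 e s -> sle (H (s0, t)) (H (s, t)) ->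
      ((G' s t = (G' s0 t * tau (H (s0, t)) (H (s, t)))%g) <-> k s t0 = k s0 t0).
    move=> bs sle1; rewrite -(kE s t) // -(kE s0 t) // /k.
    rewrite (@tauM c (H (s0, t)) (H (s, t))) //; last exact: lec.
    rewrite invgM; split=> [->|]; first by rewrite mulgA mulgK.
    by rewrite mulgA => /mulIg <-; rewrite mulgVK.
  split=> h; near=> s.
    by apply/E; [near: s|near: s; exact: nH|near: s].
  by apply/E; [near: s|near: s; exact: nH|near: s].
apply/nbhs_ballP; exists (e / 2) => /=; first by rewrite divr_gt0.
move=> t bt; rewrite goodE // goodE //.
by apply: ballxx; rewrite divr_gt0.
Unshelve. all: by end_near. Qed.

(** The lift is normalized at 0, and the value is 1 by default when there is none; [monodromyE]
    computes it from an arbitrary lift. *)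
Definition monodromy f : G :=
  if pselect (exists2 g, g 0 = 1%g & lift (f \o clamp) g) is left h
  then s2val (cid2 h) 1 else 1%g.

Lemma monodromyE f g : lift (f \o clamp) g -> monodromy f = ((g 0%R)^-1 * g 1%R)%g.
Proof.
move=> lg; rewrite /monodromy; case: pselect => [h|]; last first.
  by case; exists (fun t => (g 0%R)^-1 * g t)%g; [exact: mulVg|exact: lift_mul].
have := s2valP' (cid2 h); have := s2valP (cid2 h); move: (s2val _) => g' g'0 lg'.
have -> // := lift_unique lg' (lift_mul (g 0%R)^-1%g lg).
by rewrite g'0 mulVg.
Qed.

Lemma eq_monodromy f f' : (forall t, `[0, 1]%classic t -> f t = f' t) ->
  monodromy f = monodromy f'.
Proof.
move=> ff'; rewrite /monodromy (_ : f \o clamp = f' \o clamp) //.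
by apply/funext => t; exact/ff'/clamp_in.
Qed.

Lemma monodromy_homotopy (H : R * R -> M) x y : continuous H ->
  (forall s, H (s, 0) = x) -> (forall s, H (s, 1) = y) ->
  monodromy (fun t => H (0, t)) = monodromy (fun t => H (1, t)).
Proof.
move=> cH Hx Hy.
have cHs s : continuous (fun t => H (s, t)).
  by apply: comp_cont cH _; apply: pair_cont; [exact: cst_cont|exact: id_cont].
pose g s := s2val (cid2 (lift_clamp_exists (cHs s))).
have g0 s : g s 0 = 1%g by exact: s2valP (cid2 (lift_clamp_exists (cHs s))).
have gl s : lift ((fun t => H (s, t)) \o clamp) (g s).
  exact: s2valP' (cid2 (lift_clamp_exists (cHs s))).
rewrite (monodromyE (gl 0)) (monodromyE (gl 1)) !g0; congr (_ * _)%g.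
apply: (@lift_homotopy (fun z => H (z.1, clamp z.2)) g x y) => //.
- apply: comp_cont cH _; apply: pair_cont; first exact: fst_cont.
  by apply: comp_cont clamp_cont _; exact: snd_cont.
- by move=> s /=; rewrite clamp_id ?Hx //; exact: in01_0.
- by move=> s /=; rewrite clamp_id ?Hy //; exact: in01_1.
Qed.

(** A lift can be composed with any continuous change of parameter, monotone or not, so the reversed
    lift is a lift of the reversed path. *)
Lemma monodromy_rev f : continuous (f \o clamp) ->
  monodromy (fun t => f (1 - t)) = (monodromy f)^-1%g.
Proof.
move=> cf; have [g g0 gl] := lift_clamp_exists cf.
have cphi : continuous (fun t : R => 1 - clamp t).
  by apply: sub_cont; [exact: cst_cont|exact: clamp_cont].
have clampK t : clamp (clamp t) = clamp t :> R by rewrite clamp_id //; exact: clamp_in.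
have phiK t : clamp (1 - clamp t) = 1 - clamp t :> R.
  rewrite clamp_id //; have := clamp_in t; rewrite /= !in_itv /= => /andP[? ?].
  by apply/andP; split; lra.
have gl' : lift (f \o clamp) g.
  by move: gl; congr lift; apply/funext => t /=; rewrite clampK.
rewrite (monodromyE gl') (@monodromyE _ (g \o (fun t => 1 - clamp t))).
  rewrite /= (clamp_id in01_0) (clamp_id in01_1) subr0 subrr g0.
  by rewrite invg1 mulg1 mul1g.
have := lift_comp cphi gl'; congr lift.
by apply/funext => t; rewrite /= phiK.
Qed.

Lemma monodromy_concat f h : continuous (loop_concat_fun f h \o clamp) ->
  f 1 = h 0 ->
  monodromy (loop_concat_fun f h) = (monodromy f * monodromy h)%g.
Proof.
set F := loop_concat_fun f h => cF fh.
have [g g0 gl] := lift_clamp_exists cF.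
have clampK t : clamp (clamp t) = clamp t :> R by rewrite clamp_id //; exact: clamp_in.
have gl' : lift (F \o clamp) g.
  by move: gl; congr lift; apply/funext => t /=; rewrite clampK.
have c1 : continuous (fun t : R => clamp t * 2^-1).
  by apply: mul_cont; [exact: clamp_cont|exact: cst_cont].
have c2 : continuous (fun t : R => 2^-1 + clamp t * 2^-1).
  by apply: add_cont; [exact: cst_cont|exact: c1].
have l1 : lift (f \o clamp) (g \o (fun t => clamp t * 2^-1)).
  have := lift_comp c1 gl'; congr lift; apply/funext => t /=.
  have := clamp_in t; rewrite /= in_itv /= => /andP[t0 t1].
  rewrite clamp_id; last by rewrite /= in_itv /=; apply/andP; split; lra.
  rewrite /F /loop_concat_fun.
  have -> : clamp t * 2^-1 <= 2^-1 by lra.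
  by congr f; lra.
have l2 : lift (h \o clamp) (g \o (fun t => 2^-1 + clamp t * 2^-1)).
  have := lift_comp c2 gl'; congr lift; apply/funext => t /=.
  have := clamp_in t; rewrite /= in_itv /= => /andP[t0 t1].
  rewrite clamp_id; last by rewrite /= in_itv /=; apply/andP; split; lra.
  rewrite /F /loop_concat_fun.
  have [t2|t2] := leP (2^-1 + clamp t * 2^-1) 2^-1.
    have -> : clamp t = 0 by lra.
    by rewrite -fh; congr f; lra.
  by congr h; lra.
rewrite (monodromyE gl') (monodromyE l1) (monodromyE l2) /=.
rewrite (clamp_id in01_0) (clamp_id in01_1) mul0r mul1r addr0.
have -> : 2^-1 + 2^-1 = 1 :> R by lra.
by rewrite mulgA mulgK.
Qed.

End monodromy.

(** * Homotopy of paths *)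

Section path_homotopy.
Context {R : realType} {T : topologicalType}.
Implicit Types (f g h : R -> T) (s t : R).
Local Notation I01 := (`[0, 1]%classic : set R).

(** Homotopy relative to the endpoints. [H] is continuous on the whole plane, which avoids subspace
    topologies; the two paths count only on [0, 1]. *)
Definition path_homotopic f g := exists H : R * R -> T,
  [/\ continuous H, (forall t, I01 t -> H (0, t) = f t),
      (forall t, I01 t -> H (1, t) = g t) &
      (forall s, H (s, 0) = f 0 /\ H (s, 1) = f 1)].

Definition path_rev f t := f (1 - t).

Lemma path_homotopic_ends f g : path_homotopic f g -> f 0 = g 0 /\ f 1 = g 1.
Proof.
move=> [H [_ _ Hg He]]; have [<- <-] := He 1.
by split; apply: Hg; [exact: in01_0|exact: in01_1].
Qed.

Lemma path_homotopic_refl f : continuous f -> path_homotopic f f.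
Proof.
move=> cf; exists (fun x => f x.2); split=> //.
by apply: comp_cont cf _; exact: snd_cont.
Qed.

Lemma path_homotopic_sym f g : path_homotopic f g -> path_homotopic g f.
Proof.
move=> fg; have [e0 e1] := path_homotopic_ends fg; move: fg => [H [cH H0 H1 He]].
exists (fun x => H (1 - x.1, x.2)); split.
- apply: comp_cont cH _; apply: pair_cont; last exact: snd_cont.
  by apply: sub_cont; [exact: cst_cont|exact: fst_cont].
- by move=> t It /=; rewrite subr0 H1.
- by move=> t It /=; rewrite subrr H0.
- by move=> s /=; rewrite -e0 -e1.
Qed.

Lemma path_homotopic_trans g f h :
  path_homotopic f g -> path_homotopic g h -> path_homotopic f h.
Proof.
move=> fg; have [e0 e1] := path_homotopic_ends fg.
move: fg => [H [cH H0 H1 He]] [K [cK K0 K1 Ke]].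
have cc : continuous (fun x : R * R => clamp x.2).
  by apply: comp_cont clamp_cont _; exact: snd_cont.
have c2 : continuous (fun x : R * R => 2 * x.1).
  by apply: mul_cont; [exact: cst_cont|exact: fst_cont].
exists (fun x => if x.1 - 2^-1 <= 0 then H (2 * x.1, clamp x.2)
  else K (2 * x.1 - 1, clamp x.2)); split.
- apply: (@glue_continuous R (R * R)%type T (fun x => x.1 - 2^-1)).
  + by apply: sub_cont; [exact: fst_cont|exact: cst_cont].
  + by apply: comp_cont cH _; exact: pair_cont.
  + apply: comp_cont cK _; apply: pair_cont => //.
    by apply: sub_cont => //; exact: cst_cont.
  + move=> x /eqP; rewrite subr_eq0 => /eqP ->; rewrite mulfV // subrr.
    by rewrite H1 ?K0 //; exact: clamp_in.
- move=> t It; rewrite /= sub0r oppr_le0 invr_ge0 ler0n mulr0.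
  by rewrite clamp_id // H0.
- move=> t It; rewrite /= ifF; last by apply/negbTE; rewrite -ltNge; lra.
  by rewrite clamp_id // -K1 //; congr (K (_, _)); lra.
- move=> s /=; rewrite (clamp_id in01_0) (clamp_id in01_1).
  have [-> ->] := He (2 * s); have [-> ->] := Ke (2 * s - 1).
  by rewrite -e0 -e1 !if_same.
Qed.

Lemma concat0 f g : loop_concat_fun f g 0 = f 0.
Proof. by rewrite /loop_concat_fun invr_ge0 ler0n mulr0. Qed.

Lemma concat1 f g : loop_concat_fun f g 1 = g 1.
Proof.
rewrite /loop_concat_fun ifF; last by apply/negbTE; rewrite -ltNge; lra.
by congr g; lra.
Qed.

Lemma path_rev0 f : path_rev f 0 = f 1.
Proof. by rewrite /path_rev subr0. Qed.

Lemma path_rev1 f : path_rev f 1 = f 0.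
Proof. by rewrite /path_rev subrr. Qed.

Lemma path_rev_cont f : continuous f -> continuous (path_rev f).
Proof.
move=> cf; apply: comp_cont cf _.
by apply: sub_cont; [exact: cst_cont|exact: id_cont].
Qed.

Lemma path_homotopic_concat f f' g g' : f 1 = g 0 ->
  path_homotopic f f' -> path_homotopic g g' ->
  path_homotopic (loop_concat_fun f g) (loop_concat_fun f' g').
Proof.
move=> fg [H [cH H0 H1 He]] [K [cK K0 K1 Ke]].
have c2 : continuous (fun x : R * R => 2 * x.2).
  by apply: mul_cont; [exact: cst_cont|exact: snd_cont].
exists (fun x => if x.2 - 2^-1 <= 0 then H (x.1, 2 * x.2)
  else K (x.1, 2 * x.2 - 1)); split.
- apply: (@glue_continuous R (R * R)%type T (fun x => x.2 - 2^-1)).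
  + by apply: sub_cont; [exact: snd_cont|exact: cst_cont].
  + by apply: comp_cont cH _; apply: pair_cont => //; exact: fst_cont.
  + apply: comp_cont cK _; apply: pair_cont; first exact: fst_cont.
    by apply: sub_cont => //; exact: cst_cont.
  + move=> x /eqP; rewrite subr_eq0 => /eqP ->; rewrite mulfV // subrr.
    by rewrite (He _).2 (Ke _).1.
- move=> t It; rewrite /= /loop_concat_fun subr_le0.
  case: ifPn => t2; first by rewrite H0 //; exact: half_in01.
  by rewrite K0 //; exact: half_in01'.
- move=> t It; rewrite /= /loop_concat_fun subr_le0.
  case: ifPn => t2; first by rewrite H1 //; exact: half_in01.
  by rewrite K1 //; exact: half_in01'.
- move=> s; rewrite concat0 concat1 /= sub0r oppr_le0 invr_ge0 ler0n mulr0.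
  rewrite (He _).1; split=> //.
  rewrite ifF; last by apply/negbTE; rewrite -ltNge; lra.
  by rewrite -(Ke s).2; congr (K (_, _)); lra.
Qed.

(** The straight-line homotopy, transported by [F]. It yields reparametrization, homotopy inside a
    cell, and the comparison of the two halves of the boundary of a square. *)
Lemma path_homotopic_linear (V : normedModType R) (F : V -> T) (phi psi : R -> V) :
  continuous F -> continuous phi -> continuous psi ->
  phi 0 = psi 0 -> phi 1 = psi 1 -> path_homotopic (F \o phi) (F \o psi).
Proof.
move=> cF cphi cpsi e0 e1.
exists (fun x => F ((1 - x.1) *: phi x.2 + x.1 *: psi x.2)); split.
- apply: (@comp_cont _ V T
    (fun x : R * R => (1 - x.1) *: phi x.2 + x.1 *: psi x.2) F cF) => x.
  have c1 : continuous (fun x : R * R => 1 - x.1).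
    by apply: sub_cont; [exact: cst_cont|exact: fst_cont].
  have cp : continuous (fun x : R * R => phi x.2).
    by apply: comp_cont cphi _; exact: snd_cont.
  have cq : continuous (fun x : R * R => psi x.2).
    by apply: comp_cont cpsi _; exact: snd_cont.
  apply: cvgD; apply: cvgZ; [exact: c1|exact: cp| |exact: cq].
  exact: fst_cont.
- by move=> t _ /=; rewrite subr0 scale1r scale0r addr0.
- by move=> t _ /=; rewrite subrr scale1r scale0r add0r.
- by move=> s /=; rewrite -e0 -e1 -!scalerDl !subrK !scale1r.
Qed.

Lemma path_homotopic_eq f g : continuous f -> (forall t, I01 t -> f t = g t) ->
  path_homotopic f g.
Proof.
move=> cf fg; exists (fun x => f x.2); split=> //.
by apply: comp_cont cf _; exact: snd_cont.
Qed.

Lemma path_homotopic_reparam f (phi psi : R -> R) : continuous f ->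
  continuous phi -> continuous psi -> phi 0 = psi 0 -> phi 1 = psi 1 ->
  path_homotopic (f \o phi) (f \o psi).
Proof. by move=> cf; exact: (@path_homotopic_linear R^o f). Qed.

Lemma path_homotopic_reparam_eq h f g (phi psi : R -> R) : continuous h ->
  continuous phi -> continuous psi -> phi 0 = psi 0 -> phi 1 = psi 1 ->
  (forall t, I01 t -> f t = h (phi t)) -> (forall t, I01 t -> g t = h (psi t)) ->
  path_homotopic f g.
Proof.
move=> ch cphi cpsi e0 e1 fE gE.
have [H [cH H0 H1 He]] := path_homotopic_reparam ch cphi cpsi e0 e1.
exists H; split=> //.
- by move=> t It; rewrite H0 // fE.
- by move=> t It; rewrite H1 // gE.
- by move=> s; rewrite !fE //; [exact: in01_1|exact: in01_0].
Qed.

Lemma path_homotopic_cstl f : continuous f ->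
  path_homotopic (loop_concat_fun (fun=> f 0) f) f.
Proof.
move=> cf.
apply: (@path_homotopic_reparam_eq f _ _ (fun t => Num.max 0 (2 * t - 1)) id) => //.
- apply: max_cont; first exact: cst_cont.
  apply: sub_cont; last exact: cst_cont.
  by apply: mul_cont; [exact: cst_cont|exact: id_cont].
- exact: id_cont.
- by rewrite max_l //; lra.
- by rewrite max_r //; lra.
- move=> t _; rewrite /loop_concat_fun; case: ifPn => [t2|].
    by rewrite max_l //; lra.
  by rewrite -ltNge => t2; rewrite max_r //; lra.
Qed.

Lemma path_homotopic_cstr f : continuous f ->
  path_homotopic (loop_concat_fun f (fun=> f 1)) f.
Proof.
move=> cf.
apply: (@path_homotopic_reparam_eq f _ _ (fun t => Num.min (2 * t) 1) id) => //.
- apply: min_cont; last exact: cst_cont.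
  by apply: mul_cont; [exact: cst_cont|exact: id_cont].
- exact: id_cont.
- by rewrite min_l //; lra.
- by rewrite min_r //; lra.
- move=> t _; rewrite /loop_concat_fun; case: ifPn => [t2|].
    by rewrite min_l //; lra.
  by rewrite -ltNge => t2; rewrite min_r //; lra.
Qed.

Lemma path_homotopic_invr f : continuous f ->
  path_homotopic (loop_concat_fun f (path_rev f)) (fun=> f 0).
Proof.
move=> cf.
apply: (@path_homotopic_reparam_eq f _ _
  (fun t => Num.min (2 * t) (2 - 2 * t)) (fun=> 0)) => //.
- have c2 : continuous (fun t : R => 2 * t).
    by apply: mul_cont; [exact: cst_cont|exact: id_cont].
  by apply: min_cont => //; apply: sub_cont => //; exact: cst_cont.
- exact: cst_cont.
- by rewrite min_l //; lra.
- by rewrite min_r //; lra.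
- move=> t _; rewrite /loop_concat_fun; case: ifPn => [t2|].
    by rewrite min_l //; lra.
  by rewrite -ltNge => t2; rewrite min_r /path_rev; [congr f|]; lra.
Qed.

Lemma path_revK f : path_rev (path_rev f) = f.
Proof. by apply/funext => t; rewrite /path_rev; congr f; lra. Qed.

Lemma path_homotopic_invl f : continuous f ->
  path_homotopic (loop_concat_fun (path_rev f) f) (fun=> f 1).
Proof.
move=> cf; have := path_homotopic_invr (path_rev_cont cf).
by rewrite path_revK path_rev0.
Qed.

Lemma path_homotopicA f g h : continuous f -> continuous g -> continuous h ->
  f 1 = g 0 -> g 1 = h 0 ->
  path_homotopic (loop_concat_fun (loop_concat_fun f g) h)
    (loop_concat_fun f (loop_concat_fun g h)).
Proof.
move=> cf cg ch fg gh.
pose F := loop_concat_fun f (loop_concat_fun g h).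
have cF : continuous F.
  by apply: concat_continuous => //; [exact: concat_continuous|rewrite concat0].
(* The change of parameter is concave and piecewise linear, with slopes 2, 1 and 1/2 and breaks at
   1/4 and 1/2. *)
apply: (@path_homotopic_reparam_eq F _ _
  (fun t => Num.min (2 * t) (Num.min (t + 4^-1) ((t + 1) / 2))) id) => //.
- apply: min_cont; first by apply: mul_cont; [exact: cst_cont|exact: id_cont].
  apply: min_cont; first by apply: add_cont; [exact: id_cont|exact: cst_cont].
  apply: mul_cont; last exact: cst_cont.
  by apply: add_cont; [exact: id_cont|exact: cst_cont].
- exact: id_cont.
- by rewrite min_l; [rewrite mulr0|rewrite le_min; apply/andP; split; lra].
- by rewrite [Num.min (1 + _) _]min_r; [rewrite min_r; lra|lra].
- move=> t; rewrite /= in_itv /= => /andP[t0 t1].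
  rewrite /F /loop_concat_fun.
  have [t4|t4] := leP t 4^-1.
    rewrite min_l; last by rewrite le_min; apply/andP; split; lra.
    have -> : t <= 2^-1 by lra.
    by have -> : 2 * t <= 2^-1 by lra.
  have [t2|t2] := leP t 2^-1.
    rewrite [Num.min (t + _) _]min_l; last lra.
    rewrite min_r; last lra.
    have -> : (2 * t <= 2^-1) = false by apply/negbTE; rewrite -ltNge; lra.
    have -> : (t + 4^-1 <= 2^-1) = false by apply/negbTE; rewrite -ltNge; lra.
    have -> : 2 * (t + 4^-1) - 1 <= 2^-1 by lra.
    by congr g; lra.
  rewrite [Num.min (t + _) _]min_r; last lra.
  rewrite min_r; last lra.
  have -> : ((t + 1) / 2 <= 2^-1) = false by apply/negbTE; rewrite -ltNge; lra.
  have -> : (2 * ((t + 1) / 2) - 1 <= 2^-1) = false.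
    by apply/negbTE; rewrite -ltNge; lra.
  by congr h; lra.
Qed.

Lemma path_homotopic_cancel f g : continuous f -> continuous g -> f 1 = g 0 ->
  path_homotopic (loop_concat_fun (path_rev f) (loop_concat_fun f g)) g.
Proof.
move=> cf cg fg; have cr := path_rev_cont cf.
apply: (@path_homotopic_trans (loop_concat_fun (loop_concat_fun (path_rev f) f) g)).
  by apply/path_homotopic_sym/path_homotopicA => //; rewrite path_rev1.
apply: (@path_homotopic_trans (loop_concat_fun (fun=> g 0) g)).
  apply: path_homotopic_concat; rewrite ?concat1 //.
    by rewrite -fg; exact: path_homotopic_invl.
  exact: path_homotopic_refl.
exact: path_homotopic_cstl.
Qed.

End path_homotopy.

(** * Loops and tethered paths in the fundamental group *)

Section loop_classes.
Context {R : realType} {T : topologicalType} (p : T).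
Implicit Types (f g h : R -> T) (s t : R).
Local Notation I01 := (`[0, 1]%classic : set R).
Local Notation P := (pi1 R p).

Definition based f := [/\ continuous f, f 0 = p & f 1 = p].

Definition based_loop f (h : based f) : loop R p :=
  let: And3 cf f0 f1 := h in Loop (continuous_subspaceT cf) f0 f1.

(* The junk value on functions that are not loops at p is 1. *)
Definition loop_cls f : P :=
  if pselect (based f) is left h then \pi_P (based_loop h) else 1%g.

Lemma loop_clsE f (h : based f) : loop_cls f = \pi_P (based_loop h).
Proof.
rewrite /loop_cls; case: pselect => // h'.
by rewrite (Prop_irrelevance h h').
Qed.

Lemma loop_cls_loop (l : loop R p) : \pi_P l = loop_cls (l \o clamp).
Proof.
have h : based (l \o clamp).
  split; first exact: loop_clamp_continuous.
    by rewrite /= (clamp_id in01_0) loop_at0.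
  by rewrite /= (clamp_id in01_1) loop_at1.
rewrite (loop_clsE h); apply/pi1_eq/homotopic_eq => t It.
by case: h => * /=; rewrite clamp_id.
Qed.

Lemma loop_cls_homotopic f g : based f -> based g -> path_homotopic f g ->
  loop_cls f = loop_cls g.
Proof.
move=> hf hg [H [cH H0 H1 He]]; rewrite (loop_clsE hf) (loop_clsE hg).
apply/pi1_eq; apply: (homotopic_clamp cH).
- by move=> t It; rewrite H0 //; case: hf.
- by move=> t It; rewrite H1 //; case: hg.
- by move=> s _; have [-> ->] := He s; case: hf.
Qed.

Lemma based_concat f g : based f -> based g -> based (loop_concat_fun f g).
Proof.
move=> [cf f0 f1] [cg g0 g1]; split; rewrite ?concat0 ?concat1 //.
by apply: concat_continuous => //; rewrite f1.
Qed.

Lemma loop_cls_concat f g : based f -> based g ->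
  loop_cls (loop_concat_fun f g) = (loop_cls f * loop_cls g)%g.
Proof.
move=> hf hg; have h := based_concat hf hg.
rewrite (loop_clsE hf) (loop_clsE hg) (loop_clsE h).
rewrite -[RHS]/(pi1_mul _ _) pi1_mulE; apply/pi1_eq/homotopic_eq => t It.
by case: hf; case: hg; case: h.
Qed.

End loop_classes.

(* Tethering both ends of a path f to the base point by a fixed family of paths
   sigma makes the homotopy classes of all paths elements of one group. *)
Section tethered_classes.
Context {R : realType} {T : topologicalType} (p : T).
Variable sigma : T -> R -> T.
Hypothesis sigma_cont : forall x, continuous (sigma x).
Hypothesis sigma0 : forall x, sigma x 0 = p.
Hypothesis sigma1 : forall x, sigma x 1 = x.
Hypothesis sigmap : sigma p = (fun=> p).
Implicit Types (f g h : R -> T) (s t : R).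
Local Notation I01 := (`[0, 1]%classic : set R).
Local Notation "f \* g" := (loop_concat_fun f g) (at level 40, left associativity).

Definition tether f := sigma (f 0) \* (f \* path_rev (sigma (f 1))).

Definition path_cls f : pi1 R p := loop_cls p (tether f).

Lemma tail_cont f : continuous f -> continuous (f \* path_rev (sigma (f 1))).
Proof.
move=> cf; apply: concat_continuous => //; first exact: path_rev_cont.
by rewrite path_rev0 sigma1.
Qed.

Lemma based_tether f : continuous f -> based p (tether f).
Proof.
move=> cf; split; rewrite /tether ?concat0 ?concat1 ?path_rev1 //.
by apply: concat_continuous => //; [exact: tail_cont|rewrite concat0 sigma1].
Qed.

Lemma path_cls_homotopic f g : continuous f -> continuous g ->
  path_homotopic f g -> path_cls f = path_cls g.
Proof.
move=> cf cg fg; apply: loop_cls_homotopic; try exact: based_tether.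
have [e0 e1] := path_homotopic_ends fg.
rewrite /tether -e0 -e1; apply: path_homotopic_concat.
- by rewrite concat0 sigma1.
- exact: path_homotopic_refl.
- apply: path_homotopic_concat => //; first by rewrite path_rev0 sigma1.
  exact/path_homotopic_refl/path_rev_cont.
Qed.

Lemma eq_path_cls f g : continuous f -> continuous g ->
  (forall t, I01 t -> f t = g t) -> path_cls f = path_cls g.
Proof. by move=> cf cg fg; apply: path_cls_homotopic => //; exact: path_homotopic_eq. Qed.

(** The tail of [f] and the head of [g] run along the same tether in opposite directions and
    cancel. *)
Lemma path_cls_concat f g : continuous f -> continuous g -> f 1 = g 0 ->
  path_cls (f \* g) = (path_cls f * path_cls g)%g.
Proof.
move=> cf cg fg; have cfg := concat_continuous cf cg fg.
have tf := tail_cont cf; have tg := tail_cont cg; have tfg := tail_cont cfg.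
have cr x : continuous (path_rev (sigma x)) by exact: path_rev_cont.
rewrite -loop_cls_concat; try exact: based_tether.
apply/esym/loop_cls_homotopic; [|exact: based_tether|].
  by apply: based_concat; exact: based_tether.
set a := sigma (f 0); set b := sigma (f 1); set c := path_rev (sigma (g 1)).
have fb : f 1 = path_rev b 0 by rewrite path_rev0 /b sigma1.
have af : a 1 = f 0 by rewrite /a sigma1.
have bg : b 1 = g 0 by rewrite /b sigma1.
have gc : g 1 = c 0 by rewrite /c path_rev0 sigma1.
have -> : tether f = a \* (f \* path_rev b) by [].
have -> : tether g = b \* (g \* c) by rewrite /tether -fg.
have -> : tether (f \* g) = a \* ((f \* g) \* c) by rewrite /tether concat0 concat1.
have ca : continuous a by exact: sigma_cont.
have cb : continuous b by exact: sigma_cont.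
have cc : continuous c by exact: cr.
have crb : continuous (path_rev b) by exact: cr.
have cgc : continuous (g \* c) by exact: concat_continuous.
have cbgc : continuous (b \* (g \* c)) by apply: concat_continuous => //; rewrite concat0.
have cfb : continuous (f \* path_rev b) by exact: concat_continuous.
apply: (@path_homotopic_trans _ _ (a \* ((f \* path_rev b) \* (b \* (g \* c))))).
  apply: path_homotopicA => //; rewrite ?concat0 ?concat1 //.
  by rewrite path_rev1.
apply: path_homotopic_concat; [by rewrite !concat0|exact: path_homotopic_refl|].
apply: (@path_homotopic_trans _ _ (f \* (path_rev b \* (b \* (g \* c))))).
  by apply: path_homotopicA => //; rewrite ?path_rev1 ?concat0.
apply: (@path_homotopic_trans _ _ (f \* (g \* c))).
  apply: path_homotopic_concat; [by rewrite concat0|exact: path_homotopic_refl|].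
  by apply: path_homotopic_cancel; rewrite ?concat0.
exact/path_homotopic_sym/path_homotopicA.
Qed.

(** A constant path is its own concatenation with itself, and the only idempotent of a group is
    1. *)
Lemma path_cls_cst x : path_cls (fun=> x) = 1%g.
Proof.
apply: (mulgI (path_cls (fun=> x))); rewrite mulg1 -path_cls_concat //; try exact: cst_cont.
by congr path_cls; apply/funext => t; rewrite /loop_concat_fun if_same.
Qed.

Lemma path_cls_rev f : continuous f -> path_cls (path_rev f) = (path_cls f)^-1%g.
Proof.
move=> cf; apply/esym/mulg1_eq; rewrite -path_cls_concat //; first last.
- by rewrite path_rev0.
- exact: path_rev_cont.
rewrite -(path_cls_cst (f 0)); apply: path_cls_homotopic.
- apply: concat_continuous => //; first exact: path_rev_cont.
  by rewrite path_rev0.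
- exact: cst_cont.
- exact: path_homotopic_invr.
Qed.

Lemma path_cls_loop f : based p f -> path_cls f = loop_cls p f.
Proof.
move=> hf; have [cf f0 f1] := hf.
have cp : continuous (fun _ : R => p) by exact: cst_cont.
apply: loop_cls_homotopic => //; first exact: based_tether.
rewrite /tether f0 f1 sigmap.
apply: (@path_homotopic_trans _ _ (f \* path_rev (fun=> p))).
  rewrite -[X in (fun=> X) \* _]f0 -(concat0 f (path_rev (fun=> p))).
  apply: path_homotopic_cstl.
  by apply: concat_continuous.
rewrite -[X in _ \* X]/(fun=> p) -[in X in _ \* X]f1.
exact: path_homotopic_cstr.
Qed.

(** The case [u < t], where [f] is run backwards, is included, so [path_cls_subpath] holds for
    parameters in any order. *)
Definition subpath f (t u : R) s := f (t + s * (u - t)).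

Lemma subpath_cont f t u : continuous f -> continuous (subpath f t u).
Proof.
move=> cf; apply: comp_cont cf _.
apply: add_cont; first exact: cst_cont.
by apply: mul_cont; [exact: id_cont|exact: cst_cont].
Qed.

Lemma subpath0 f t u : subpath f t u 0 = f t.
Proof. by rewrite /subpath mul0r addr0. Qed.

Lemma subpath1 f t u : subpath f t u 1 = f u.
Proof. by rewrite /subpath mul1r addrC subrK. Qed.

Lemma path_cls_subpath f t u w : continuous f ->
  path_cls (subpath f t w) = (path_cls (subpath f t u) * path_cls (subpath f u w))%g.
Proof.
move=> cf; rewrite -path_cls_concat; try exact: subpath_cont; last first.
  by rewrite subpath0 subpath1.
apply: path_cls_homotopic; first exact: subpath_cont.
  by apply: concat_continuous; try exact: subpath_cont; rewrite subpath0 subpath1.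
have ca (x y : R) : continuous (fun s : R => x + s * (y - x)).
  apply: add_cont; first exact: cst_cont.
  by apply: mul_cont; [exact: id_cont|exact: cst_cont].
apply: (@path_homotopic_reparam_eq _ _ f _ _ (fun s => t + s * (w - t))
  (loop_concat_fun (fun s => t + s * (u - t)) (fun s => u + s * (w - u)))) => //.
- by apply: concat_continuous; rewrite ?mul1r ?mul0r; [exact: ca|exact: ca|lra].
- by rewrite concat0; lra.
- by rewrite concat1; lra.
- by move=> s _; rewrite /loop_concat_fun; case: ifP.
Qed.

End tethered_classes.

(** * Cell complexes *)

Lemma mx_continuous (R S : topologicalType) (m n : nat) (f : S -> 'M[R]_(m, n)) :
  (forall i j, continuous (fun x => f x i j)) -> continuous f.
Proof.
move=> cf x B [P nP PB].
apply: (@filterS _ (nbhs x) _ [set y | forall i j, P i j (f y i j)]).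
  by move=> y Py; exact: PB.
apply: filter_forall => i; apply: filter_forall => j.
exact: cf (nP i j).
Qed.

Section complex_topology.
Context {R : realType} {M : metricType R} (K : regular_complex M).
Implicit Types (i j : cell K) (x y : M).

Definition clamp_rV k (z : 'rV[R]_k) : 'rV[R]_k := \row_j clamp (z ord0 j).

Lemma clamp_rV_cont k : continuous (@clamp_rV k).
Proof.
apply: mx_continuous => i j.
rewrite (_ : (fun _ => _) = fun z : 'rV[R]_k => clamp (z ord0 j)).
  by apply: comp_cont clamp_cont _; exact: coord_continuous.
by apply/funext => z; rewrite mxE.
Qed.

Lemma clamp_rV_in k (z : 'rV[R]_k) : cube k (clamp_rV z).
Proof. by move=> j; rewrite mxE; exact: clamp_in. Qed.

Lemma clamp_rV_id k (z : 'rV[R]_k) : cube k z -> clamp_rV z = z.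
Proof.
by move=> cz; apply/rowP => j; rewrite mxE clamp_id //; exact: cz.
Qed.

Lemma cube_compact k : compact (cube k : set 'rV[R]_k).
Proof.
have := @rV_compact R k (fun=> `[0, 1]%classic) (fun=> @segment_compact R 0 1).
by congr compact.
Qed.

(** Composition with the retraction of the whole space onto the cube makes the characteristic map
    continuous everywhere. *)
Definition total_cell_map i := @cell_map R M K i \o @clamp_rV (cell_dim i).
Arguments total_cell_map : clear implicits.

Lemma total_cell_map_cont i : continuous (total_cell_map i).
Proof.
exact: within_comp (@cell_map_continuous _ _ _ i) (@clamp_rV_cont _) (@clamp_rV_in _).
Qed.

Lemma total_cell_map_in i z : closed_cell i (total_cell_map i z).
Proof. by exists (clamp_rV z) => //; exact: clamp_rV_in. Qed.

(** Images of compact sets are compact, hence closed in a Hausdorff space. This is what makes the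
    inverse [cell_coord] continuous. *)
Lemma cell_map_closed i (C : set 'rV[R]_(cell_dim i)) : closed C ->
  closed (@cell_map _ _ _ i @` (cube (cell_dim i) `&` C)).
Proof.
move=> cC; apply: compact_closed; first exact: metric_hausdorff.
rewrite (_ : _ @` _ = total_cell_map i @` (cube (cell_dim i) `&` C)); last first.
  apply/seteqP; split=> _ [z [cz Cz] <-]; exists z => //; rewrite /total_cell_map /=.
    by rewrite clamp_rV_id.
  by rewrite clamp_rV_id.
apply: continuous_compact.
  by apply: continuous_subspaceT; exact: total_cell_map_cont.
by apply: compact_closedI => //; exact: cube_compact.
Qed.

Lemma closed_cell_closed i : closed (closed_cell i).
Proof.
rewrite /closed_cell -[cube _]setIT; apply: cell_map_closed; exact: closedT.
Qed.

Definition cell_coord i x := xget 0 [set z | cube (cell_dim i) z /\ cell_map z = x].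

Lemma cell_coordP i x : closed_cell i x ->
  cube (cell_dim i) (cell_coord i x) /\ cell_map (cell_coord i x) = x.
Proof.
by move=> [z cz zx]; rewrite /cell_coord; case: xgetP => [? -> //|/(_ z)]; case.
Qed.

Lemma cell_coordK i z : cube (cell_dim i) z -> cell_coord i (cell_map z) = z.
Proof.
move=> cz; have [cz' zz'] : cube (cell_dim i) (cell_coord i (cell_map z)) /\
    cell_map (cell_coord i (cell_map z)) = cell_map z by apply: cell_coordP; exists z.
by apply: cell_map_inj; rewrite ?inE.
Qed.

Lemma cell_coord_cont i : {within closed_cell i, continuous (cell_coord i)}.
Proof.
apply/continuous_closedP => C cC; apply/closed_subspaceP.
exists (@cell_map _ _ _ i @` (cube (cell_dim i) `&` C)).
  exact: cell_map_closed.
apply/seteqP; split=> x [H cx]; split=> //.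
  case: H => z [cz Cz] <-; move: (cell_coordK cz) Cz => {1}<-.
  exact.
by have [? ?] := cell_coordP cx; exists (cell_coord i x).
Qed.

(** In cell coordinates both paths lie in a convex set. *)
Lemma path_homotopic_in_cell i (f g : R -> M) : continuous f -> continuous g ->
  (forall t, closed_cell i (f t)) -> (forall t, closed_cell i (g t)) ->
  f 0 = g 0 -> f 1 = g 1 -> path_homotopic f g.
Proof.
move=> cf cg fi gi e0 e1.
have E (h : R -> M) : (forall t, closed_cell i (h t)) ->
    h = total_cell_map i \o (cell_coord i \o h).
  move=> hi; apply/funext => t; rewrite /total_cell_map /=.
  by have [? ?] := cell_coordP (hi t); rewrite clamp_rV_id.
have cE (h : R -> M) : continuous h -> (forall t, closed_cell i (h t)) ->
    continuous (cell_coord i \o h).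
  by move=> ch hi; exact: within_comp (@cell_coord_cont i) ch hi.
rewrite (E f fi) (E g gi); apply: path_homotopic_linear; rewrite /= ?e0 ?e1 //.
- exact: total_cell_map_cont.
- exact: cE.
- exact: cE.
Qed.

Definition cell_seg i x y (t : R) : M :=
  total_cell_map i ((1 - t) *: cell_coord i x + t *: cell_coord i y).

Lemma cell_seg_cont i x y : continuous (cell_seg i x y).
Proof.
apply: comp_cont (@total_cell_map_cont i) _ => t.
have c1 : continuous (fun t : R => 1 - t).
  by apply: sub_cont; [exact: cst_cont|exact: id_cont].
apply: cvgD; apply: cvgZ; [exact: c1|exact: cvg_cst|exact: cvg_id|exact: cvg_cst].
Qed.

Lemma cell_seg_in i x y t : closed_cell i (cell_seg i x y t).
Proof. exact: total_cell_map_in. Qed.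

Lemma total_cell_map_coord i x : closed_cell i x ->
  total_cell_map i (cell_coord i x) = x.
Proof.
by move=> /cell_coordP[? ?]; rewrite /total_cell_map /= clamp_rV_id.
Qed.

Lemma cell_seg0 i x y : closed_cell i x -> cell_seg i x y 0 = x.
Proof.
move=> ix; rewrite /cell_seg subr0 scale1r scale0r addr0.
exact: total_cell_map_coord.
Qed.

Lemma cell_seg1 i x y : closed_cell i y -> cell_seg i x y 1 = y.
Proof.
move=> iy; rewrite /cell_seg subrr scale1r scale0r add0r.
exact: total_cell_map_coord.
Qed.

End complex_topology.

Arguments total_cell_map {R M K} i.

Section complex_order.
Context {R : realType} {M : metricType R} (K : regular_complex M).
Implicit Types (i j k : cell K) (x y : M).

Lemma cell_of_subproof x : exists i, open_cell i x.
Proof.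
have : [set: M] x by [].
by rewrite -(open_cell_cover K) => -[i _ ix]; exists i.
Qed.

Definition cell_of x : cell K := sval (cid (cell_of_subproof x)).

Lemma cell_ofP x : open_cell (cell_of x) x.
Proof. exact: svalP (cid (cell_of_subproof x)). Qed.

Lemma open_cell_of i x : open_cell i x -> cell_of x = i.
Proof.
move=> ix; apply: (@open_cell_disjoint R M K) => //.
by exists x; split => //; exact: cell_ofP.
Qed.

Lemma open_sub_closed i : open_cell i `<=` closed_cell i.
Proof.
move=> _ [z oz <-]; exists z => // j; have := oz j.
by rewrite !in_itv /= => /andP[? ?]; rewrite !ltW.
Qed.

Lemma closed_cell_of x : closed_cell (cell_of x) x.
Proof. exact/open_sub_closed/cell_ofP. Qed.

Definition cell_le i j := closed_cell i `<=` closed_cell j.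

Lemma cell_le_trans j i k : cell_le i j -> cell_le j k -> cell_le i k.
Proof. exact: subset_trans. Qed.

Lemma closed_cellP i x : closed_cell i x -> open_cell i x \/
  exists2 j, (cell_dim j < cell_dim i)%N /\ cell_le j i & closed_cell j x.
Proof.
move=> [z cz zx]; have [oz|noz] := pselect (open_cube (cell_dim i) z).
  by left; exists z.
right; have : cell_boundary i x by exists z.
rewrite cell_boundaryE => -[j [ji jb] jx]; exists j => //; split=> //.
by apply: subset_trans jb _ => _ [w [cw _] <-]; exists w.
Qed.

Lemma cell_of_le i x : closed_cell i x -> cell_le (cell_of x) i.
Proof.
have [n] := ubnP (cell_dim i); elim: n i => // n IH i; rewrite ltnS => ni ix.
have [/open_cell_of ->|[j [ji le_ji] jx]] := closed_cellP ix; first exact: subset_refl.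
by apply: cell_le_trans le_ji; apply: IH => //; exact: leq_trans ni.
Qed.

(** For a 0-cell, whose cube is a single point, this is the vertex itself. The center serves as a
    point carried by [i] and by no other cell. *)
Definition cell_center i : M := @cell_map _ _ K i (const_mx 2^-1).

Lemma cell_of_center i : cell_of (cell_center i) = i.
Proof.
apply: open_cell_of; exists (const_mx 2^-1) => // j; rewrite mxE in_itv /=.
by apply/andP; split; lra.
Qed.

Lemma closed_cell_center i : closed_cell i (cell_center i).
Proof. by have := closed_cell_of (cell_center i); rewrite cell_of_center. Qed.

(** The center of [i] lies in [j]: either in the open cell, and then [i = j] by disjointness, or in
    a boundary cell of smaller dimension, to which induction applies. *)
Lemma cell_le_dim i j : cell_le i j -> i = j \/ (cell_dim i < cell_dim j)%N.
Proof.
have [n] := ubnP (cell_dim j); elim: n j => // n IH j; rewrite ltnS => nj ij.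
have [/open_cell_of|[k [kj le_kj] kx]] := closed_cellP (ij _ (closed_cell_center i)).
  by rewrite cell_of_center; left.
right; have := cell_of_le kx; rewrite cell_of_center => /(IH k (leq_trans kj nj)).
by case=> [->//|ik]; exact: ltn_trans kj.
Qed.

(** The closed cells missing [x] are finitely many, so a neighbourhood of [x] avoids them all. This
    is the hypothesis [sle_near] of the local system. *)
Lemma cell_le_near x : \forall y \near x, cell_le (cell_of x) (cell_of y).
Proof.
have H i : \forall y \near x, closed_cell i y -> closed_cell i x.
  have [ix|nix] := pselect (closed_cell i x); first exact: filterE.
  have : nbhs x (~` closed_cell i).
    by apply: open_nbhs_nbhs; split=> //; rewrite openC; exact: closed_cell_closed.
  by apply: filterS => y /= niy /niy.
have : \forall y \near x, forall i, closed_cell i y -> closed_cell i x.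
  exact: filter_forall.
by apply: filterS => y /(_ _ (closed_cell_of y)) /cell_of_le.
Qed.

End complex_order.

(** * The graph of a cube and potentials of flat cocycles *)

Section cube_graph.
Context {R : realType} {M : metricType R} (Q : rectangulation M).
Implicit Types (c d e : cell Q) (u w : vertex Q).
Local Notation X := (natural_graph Q).
Local Notation r1 := (1%:pos : {posnum R}).

Definition vert_le u c := cell_le (val u) c.

(** Unlike in [adjacent], the side is confined to [c] and [u = w] is allowed. *)
Definition edge_in c u w :=
  exists e, [/\ cell_dim e = 1%N, cell_le e c, vert_le u e & vert_le w e].

Lemma edge_in_sym c u w : edge_in c u w -> edge_in c w u.
Proof. by move=> [e [? ? ? ?]]; exists e. Qed.

Lemma edge_in_le c d u w : cell_le c d -> edge_in c u w -> edge_in d u w.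
Proof.
by move=> cd [e [? ec ? ?]]; exists e; split=> //; exact: cell_le_trans cd.
Qed.

Lemma edge_in_vert_le c u w : edge_in c u w -> vert_le u c /\ vert_le w c.
Proof. by move=> [e [_ ec ue we]]; split; exact: cell_le_trans ec. Qed.

Lemma rstep_graphP u w : @rstep R X r1 u w <-> u = w \/ exists c, edge_in c u w.
Proof.
rewrite /rstep -[Defs.edist _ _]/(@graph_dist R _ (@Defs.adjacent R M Q) u w); split.
- have [-> //|[s [us sw ->]]] := @graph_distP R _ (@Defs.adjacent R M Q) u w.
  rewrite lee_fin (ler_nat R (size s) 1); case: s us sw => [|x [|//]] /=; first by left.
  rewrite andbT => + <- _ => /andP[_ /asboolP[e [e1 ue xe]]].
  by right; exists e, e; split=> //; exact: subset_refl.
- move=> [->|[c [e [e1 _ ue we]]]]; first by rewrite graph_distxx lee_fin.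
  have [->|uw] := eqVneq u w; first by rewrite graph_distxx lee_fin.
  have /graph_dist_le : path (@Defs.adjacent R M Q) u [:: w].
    by rewrite /= andbT /Defs.adjacent uw; apply/asboolP; exists e.
  by apply.
Qed.

Lemma edge_in_rstep c u w : edge_in c u w -> @rstep R X r1 u w.
Proof. by move=> h; apply/rstep_graphP; right; exists c. Qed.

Lemma vert_le_eq u w : vert_le u (val w) -> u = w.
Proof.
move=> /cell_le_dim[/val_inj //|].
by rewrite (eqP (valP w)).
Qed.

Section one_cell.
Variable c : cell Q.
Local Notation k := (cell_dim c).
Local Notation bits := {ffun 'I_k -> bool}.
Implicit Types (b : bits) (F : cube_face k).

Let phi := sval (cid (rect_cube c)).
Let phi_mem j : cell_le j c <-> exists F, phi F = j.
Proof. by rewrite /phi; case: cid => f [/= h _ _]; exact: h. Qed.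
Let phi_le F F' : cell_le (phi F) (phi F') <-> cube_face_le F F'.
Proof. by rewrite /phi; case: cid => f [/= _ h _]; exact: h. Qed.
Let phi_dim F : cell_dim (phi F) = cube_face_dim F.
Proof. by rewrite /phi; case: cid => f [/= _ _ h]; exact: h. Qed.

Let point_face b : cube_face k := [ffun j => Some (b j)].

Let point_face_dim b : cell_dim (phi (point_face b)) == 0%N.
Proof.
rewrite phi_dim; apply/eqP/eq_card0 => j.
by rewrite !inE ffunE.
Qed.

Definition corner b : vertex Q := Sub (phi (point_face b)) (point_face_dim b).

Lemma corner_le b : vert_le (corner b) c.
Proof. by apply/phi_mem; exists (point_face b). Qed.

Lemma corner_surj u : vert_le u c -> exists b, corner b = u.
Proof.
move=> /phi_mem[F FE]; have : cube_face_dim F = 0%N.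
  by rewrite -phi_dim FE; apply/eqP; exact: valP u.
move=> /card0_eq F0.
exists [ffun j => odflt false (F j)]; apply: val_inj => /=; rewrite -FE.
congr phi; apply/ffunP => j; rewrite !ffunE.
by have := F0 j; rewrite !inE; case: (F j).
Qed.

(* Coordinates are natural numbers here, so that i >= k means b = b'. *)
Definition flip_at (i : nat) b b' := forall j : 'I_k, j != i :> nat -> b j = b' j.

Lemma corner_flip i b b' : flip_at i b b' ->
  corner b = corner b' \/ edge_in c (corner b) (corner b').
Proof.
move=> bb'; case: (ltnP i k) => ik; last first.
  left; congr corner; apply/ffunP => j; apply: bb'.
  by rewrite neq_ltn (leq_trans (ltn_ord j) ik).
(* The side through both corners leaves coordinate [i] free and fixes the others as in [b]. *)
right; pose F : cube_face k := [ffun j => if j == Ordinal ik then None else Some (b j)].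
exists (phi F); split.
- rewrite phi_dim -(card1 (Ordinal ik)); apply: eq_card => j.
  by rewrite !inE ffunE; case: (j == Ordinal ik).
- by apply/phi_mem; exists F.
- apply/phi_le/forallP => j; rewrite !ffunE.
  by case: (j == Ordinal ik); rewrite ?eqxx ?orbT.
- apply/phi_le/forallP => j; rewrite !ffunE.
  have [//|ji] := eqVneq j (Ordinal ik).
  by rewrite /= bb' ?eqxx //; apply: contra_neq ji => e; exact: val_inj.
Qed.

Lemma flip_edge_in b b' : edge_in c (corner b) (corner b') -> exists i, flip_at i b b'.
Proof.
move=> [e [e1 /phi_mem[F FE] be b'e]]; rewrite -FE in e1 be b'e.
move: e1; rewrite phi_dim => e1; have [i Fi] := mem_card1 e1.
exists i => j ji; have /phi_le/forallP/(_ j) := be.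
have /phi_le/forallP/(_ j) := b'e; rewrite !ffunE.
have := Fi j; rewrite !inE => ->; rewrite (negbTE (contra_neq _ ji)) /=; last by move=> ->.
by move=> /eqP <- /eqP[].
Qed.

(** For n = 0, ..., k these are the successive corners of a standard walk from the origin to [b],
    which adjusts coordinate n at step n. *)
Definition trunc_bits (n : nat) b : bits := [ffun j : 'I_k => (j < n)%N && b j].

Lemma trunc_bits0 b b' : trunc_bits 0 b = trunc_bits 0 b'.
Proof. by apply/ffunP => j; rewrite !ffunE. Qed.

Lemma trunc_bits_full b : trunc_bits k b = b.
Proof. by apply/ffunP => j; rewrite !ffunE ltn_ord. Qed.

Lemma flip_trunc n b : flip_at n (trunc_bits n b) (trunc_bits n.+1 b).
Proof. by move=> j jn; rewrite !ffunE ltnS [(j <= n)%N]leq_eqVlt (negbTE jn). Qed.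

Lemma trunc_flip i n b b' : flip_at i b b' ->
  flip_at i (trunc_bits n b) (trunc_bits n b').
Proof. by move=> bb' j ji; rewrite !ffunE bb'. Qed.

(** An induction principle along the sides of [c]: the standard walks join every corner to the
    origin. *)
Lemma cell_connected (P : vertex Q -> Prop) :
  (forall u w, edge_in c u w -> P u -> P w) ->
  forall u w, vert_le u c -> vert_le w c -> P u -> P w.
Proof.
move=> H.
have step n b : P (corner (trunc_bits n b)) <-> P (corner (trunc_bits n.+1 b)).
  have [->//|e] := corner_flip (@flip_trunc n b).
  by split; apply: H => //; exact: edge_in_sym.
have all b : P (corner b) <-> P (corner (trunc_bits 0 b)).
  rewrite -{1}(trunc_bits_full b); elim: k => // n IH.
  by rewrite -step.
move=> u w /corner_surj[b <-] /corner_surj[b' <-].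
by rewrite (all b) (all b') (trunc_bits0 b b').
Qed.

Section potential.
Context {G : groupType} (l : X -> X -> G).
Hypothesis lflat : flat r1 l.

Let corner_rstep i b b' : flip_at i b b' -> @rstep R X r1 (corner b) (corner b').
Proof.
by move=> /corner_flip[->|/edge_in_rstep //]; exact: (@rstep_refl R X r1).
Qed.

Fixpoint corner_pot (n : nat) b : G :=
  if n is n'.+1 then
    (corner_pot n' b * l (corner (trunc_bits n' b)) (corner (trunc_bits n b)))%g
  else 1%g.

(** The standard walks to [b] and [b'] form a ladder whose rungs flip coordinate [i]. Its squares
    are 4-cycles, possibly degenerate, so flatness makes the potential on corners consistent along
    every side. *)
Lemma corner_pot_flip i n b b' : flip_at i b b' ->
  (corner_pot n b * l (corner (trunc_bits n b)) (corner (trunc_bits n b')) =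
   corner_pot n b')%g.
Proof.
move=> bb'; elim: n => [|n IH] /=.
  by rewrite mul1g (trunc_bits0 b b') (flatxx lflat).
rewrite -mulgA -IH -[RHS]mulgA; congr (_ * _)%g; apply: (flat_square lflat).
- exact: corner_rstep (@flip_trunc n b).
- exact: corner_rstep (trunc_flip n.+1 bb').
- exact: corner_rstep (trunc_flip n bb').
- exact: corner_rstep (@flip_trunc n b').
Qed.

Lemma flat_potential : exists h : vertex Q -> G, forall u w, edge_in c u w ->
  l u w = ((h u)^-1 * h w)%g.
Proof.
have /choice[b bP] : forall u, exists b, vert_le u c -> corner b = u.
  move=> u; have [/corner_surj[b <-]|nu] := pselect (vert_le u c).
    by exists b.
  by exists [ffun=> false].
exists (fun u => corner_pot k (b u)) => u w uw.
have [uc wc] := edge_in_vert_le uw; have := uw.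
rewrite -{1 2}(bP u uc) -{1 2}(bP w wc) => /flip_edge_in[i bb'].
have := corner_pot_flip k bb'; rewrite !trunc_bits_full (bP u uc) (bP w wc) => <-.
by rewrite mulKg.
Qed.

End potential.

Definition root_vertex : vertex Q := corner [ffun=> false].

Lemma root_vertex_le : vert_le root_vertex c.
Proof. exact: corner_le. Qed.

End one_cell.

Lemma root_vertexE u : root_vertex (val u) = u.
Proof. by apply: vert_le_eq; exact: root_vertex_le. Qed.

End cube_graph.

(** * Sides as curves between vertices *)

Section edges.
Context {R : realType} {M : metricType R} (Q : rectangulation M).
Implicit Types (c e : cell Q) (u w : vertex Q).
Local Notation X := (natural_graph Q).
Local Notation r1 := (1%:pos : {posnum R}).

Definition vertex_point u : M := cell_center (val u).

Lemma cell_of_vertex u : cell_of Q (vertex_point u) = val u.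
Proof. exact: cell_of_center. Qed.

Lemma vertex_point_inj : injective vertex_point.
Proof.
move=> u w /(congr1 (cell_of Q)); rewrite !cell_of_vertex; exact: val_inj.
Qed.

Lemma vertex_point_in u c : vert_le u c -> closed_cell c (vertex_point u).
Proof. by apply; exact: closed_cell_center. Qed.

Definition edge_path e (t : R) : M := edge_curve e (clamp t).

Lemma edge_pathE e t : edge_path e t = total_cell_map e (const_mx t).
Proof.
rewrite /edge_path /edge_curve /total_cell_map /=; congr cell_map.
by apply/rowP => j; rewrite !mxE.
Qed.

Lemma const_rV_cont k : continuous (fun t : R => const_mx t : 'rV[R]_k).
Proof.
apply: mx_continuous => i j; rewrite (_ : (fun _ => _) = id); first exact: id_cont.
by apply/funext => t; rewrite mxE.
Qed.

Lemma edge_path_cont e : continuous (edge_path e).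
Proof.
rewrite (_ : edge_path e = fun t => total_cell_map e (const_mx t)).
  exact: comp_cont (@total_cell_map_cont _ _ _ e) (@const_rV_cont _).
by apply/funext => t; exact: edge_pathE.
Qed.

Lemma edge_path_in e t : closed_cell e (edge_path e t).
Proof. by rewrite edge_pathE; exact: total_cell_map_in. Qed.

Lemma edge_path_open e t : 0 < t < 1 -> open_cell e (edge_path e t).
Proof.
move=> /andP[t0 t1]; exists (const_mx t); first by move=> j; rewrite mxE in_itv /= t0.
by rewrite /edge_path clamp_id // /= in_itv /= !ltW.
Qed.

(** An interior point of the side is carried by [e], of dimension 1, while a vertex is carried by a
    0-cell. *)
Lemma edge_path_ends e u : cell_dim e = 1%N -> vert_le u e ->
  vertex_point u = edge_path e 0 \/ vertex_point u = edge_path e 1.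
Proof.
move=> e1 /vertex_point_in ue; have [z cz zu] := ue.
have ltj : (0 < cell_dim e)%N by rewrite e1.
pose j0 := Ordinal ltj; pose t := z ord0 j0.
have zE : z = const_mx t.
  apply/rowP => j; rewrite mxE /t; congr (z _ _); apply: val_inj => /=.
  by have := ltn_ord j; rewrite {2}e1 ltnS leqn0 => /eqP.
have tin : `[0, 1]%classic t by exact: cz.
have uE : vertex_point u = edge_path e t.
  by rewrite /edge_path clamp_id // -zu zE.
move: (tin); rewrite /= in_itv /= => /andP[].
rewrite le_eqVlt => /predU1P[t0 _|t0]; first by left; rewrite uE -t0.
rewrite le_eqVlt => /predU1P[t1|t1]; first by right; rewrite uE t1.
have /open_cell_of : open_cell e (vertex_point u).
  by rewrite uE; apply: edge_path_open; rewrite t0.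
by rewrite cell_of_vertex => ue'; have := valP u; rewrite /= ue' e1.
Qed.

Definition edge_between e u w (f : R -> M) :=
  [/\ continuous f, f 0 = vertex_point u, f 1 = vertex_point w,
      (forall t : R, 0 < t < 1 -> open_cell e (f t)) & forall t, closed_cell e (f t)].

Lemma edge_betweenP e u w : cell_dim e = 1%N -> vert_le u e -> vert_le w e ->
  u != w -> edge_between e u w (edge_path e) \/
            edge_between e u w (path_rev (edge_path e)).
Proof.
move=> e1 ue we uw.
have cp := @edge_path_cont e.
case: (edge_path_ends e1 ue) (edge_path_ends e1 we) => uE [] wE.
- by case/eqP: uw; apply: vertex_point_inj; rewrite uE.
- left; split=> //; [exact: edge_path_open|exact: edge_path_in].
- right; split; rewrite ?path_rev0 ?path_rev1 //; first exact: path_rev_cont.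
    by move=> t /andP[? ?]; apply: edge_path_open; apply/andP; split; lra.
  by move=> t; exact: edge_path_in.
- by case/eqP: uw; apply: vertex_point_inj; rewrite uE.
Qed.

End edges.

(** * The local system of a flat cocycle *)

Section cell_monodromy.
Context {R : realType} {M : metricType R} (Q : rectangulation M).
Implicit Types (c d e : cell Q) (u w : vertex Q) (x y z : M).
Local Notation X := (natural_graph Q).
Local Notation r1 := (1%:pos : {posnum R}).
Context {G : groupType} (l : X -> X -> G).
Hypothesis lflat : flat r1 l.

(** The holonomy of [l] along the sides of [c], read off from a chosen potential; it has this
    meaning only for vertices of [c], where it is independent of the choice. *)
Definition transport c u w : G :=
  let h := sval (cid (flat_potential c lflat)) in ((h u)^-1 * h w)%g.

Lemma transportM c u w v : (transport c u w * transport c w v)%g = transport c u v.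
Proof. by rewrite /transport mulgA mulgK. Qed.

Lemma transportxx c u : transport c u u = 1%g.
Proof. by rewrite /transport mulVg. Qed.

Lemma transport_edge c u w : edge_in c u w -> transport c u w = l u w.
Proof. by move=> uw; rewrite /transport; case: cid => h /= ->. Qed.

Lemma transport_le c d u w : cell_le c d -> vert_le u c -> vert_le w c ->
  transport c u w = transport d u w.
Proof.
move=> cd uc wc.
apply: (@cell_connected _ _ _ c (fun w => transport c u w = transport d u w)) uc wc _.
  move=> w1 w2 e12 IH; rewrite -(transportM c u w1) -(transportM d u w1) IH.
  by rewrite (transport_edge e12) (transport_edge (edge_in_le cd e12)).
by rewrite !transportxx.
Qed.

Definition sle x y := cell_le (cell_of Q x) (cell_of Q y).

(** The fibre over a point is placed at the root vertex of its cell. When [sle x y], both roots are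
    vertices of the cell of [y], and transport takes place there. *)
Definition cell_tau x y : G :=
  transport (cell_of Q y) (root_vertex (cell_of Q x)) (root_vertex (cell_of Q y)).

Lemma cell_tauM x y z : sle x y -> sle y z ->
  cell_tau x z = (cell_tau x y * cell_tau y z)%g.
Proof.
move=> xy yz; rewrite /cell_tau (@transport_le (cell_of Q y) (cell_of Q z)) ?transportM //.
  by apply: cell_le_trans xy; exact: root_vertex_le.
exact: root_vertex_le.
Qed.

Lemma cell_tauxx x : cell_tau x x = 1%g.
Proof. exact: transportxx. Qed.

Definition cell_monodromy (f : R -> M) : G := monodromy cell_tau f.

Lemma edge_monodromy e u w f : cell_dim e = 1%N -> vert_le u e -> vert_le w e ->
  edge_between e u w f -> cell_monodromy f = l u w.
Proof.
move=> e1 ue we [cf f0 f1 fo fc].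
(* An explicit lift: a step function that changes only where the carrier does, on leaving [u] and on
   reaching [w]. *)
pose g (t : R) : G := if t <= 0 then 1%g else
  if t < 1 then transport e u (root_vertex e) else transport e u w.
have f0E (t : R) : t <= 0 -> f (clamp t) = vertex_point u.
  by move=> t0; rewrite /clamp min_r ?(le_trans t0) // max_l.
have f1E t : 1 <= t -> f (clamp t) = vertex_point w.
  by move=> t1; rewrite /clamp min_l // max_r.
have foE (t : R) : 0 < t < 1 -> cell_of Q (f (clamp t)) = e.
  move=> /[dup] /fo ft /andP[t0 t1]; rewrite clamp_id; first exact: open_cell_of.
  by rewrite /= in_itv /= !ltW.
have g0E (t : R) : t <= 0 -> g t = 1%g by rewrite /g => ->.
have goE (t : R) : 0 < t < 1 -> g t = transport e u (root_vertex e).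
  by move=> /andP[t0 t1]; rewrite /g leNgt t0 t1.
have g1E (t : R) : 1 <= t -> g t = transport e u w.
  by move=> t1; rewrite /g leNgt (lt_le_trans ltr01 t1) ltNge t1.
have gl : lift cell_tau (f \o clamp) g.
  move=> t /=; have [t0|t0|t0] := ltgtP t 0.
  - near=> s; have s0 : s <= 0 by rewrite ltW //; near: s; exact: lt_nbhsl.
    by rewrite !g0E ?(ltW t0) // !f0E ?(ltW t0) // cell_tauxx mulg1.
  - have [t1|t1|t1] := ltgtP t 1.
    + near=> s; have s01 : 0 < s < 1.
        by apply/andP; split; near: s; [exact: lt_nbhsr|exact: lt_nbhsl].
      have t01 : 0 < t < 1 by rewrite t0.
      by rewrite !goE // /cell_tau !foE // transportxx mulg1.
    + near=> s; have s1 : 1 <= s by rewrite ltW //; near: s; exact: lt_nbhsr.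
      by rewrite !g1E ?(ltW t1) // !f1E ?(ltW t1) // cell_tauxx mulg1.
    + near=> s; have s0 : 0 < s by near: s; apply: lt_nbhsr; rewrite t1.
      rewrite t1 [g 1]g1E // [f (clamp 1)]f1E //; have [s1|s1] := leP 1 s.
        by rewrite g1E // f1E // cell_tauxx mulg1.
      have s01 : 0 < s < 1 by rewrite s0.
      by rewrite goE // /cell_tau foE // cell_of_vertex root_vertexE transportM.
  - near=> s; have s1 : s < 1 by near: s; apply: lt_nbhsl; rewrite t0.
    rewrite t0 [g 0]g0E // [f (clamp 0)]f0E // mul1g; have [s0|s0] := leP s 0.
      by rewrite g0E // f0E // cell_tauxx.
    have s01 : 0 < s < 1 by rewrite s0.
    by rewrite goE // /cell_tau foE // cell_of_vertex root_vertexE.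
rewrite /cell_monodromy (monodromyE gl) g0E // g1E // invg1 mul1g; apply: transport_edge.
by exists e; split=> //; exact: subset_refl.
Unshelve. all: by end_near. Qed.

End cell_monodromy.

Section connected_graph.
Context {R : realType} {M : metricType R} (Q : rectangulation M).
Local Notation X := (natural_graph Q).
Local Notation r1 := (1%:pos : {posnum R}).

Definition walk (u w : X) s := path (rstep r1) u s /\ last u s = w.

Lemma walk_cat u v w s t : walk u v s -> walk v w t -> walk u w (s ++ t).
Proof.
by move=> [us <-] [vt <-]; rewrite /walk cat_path last_cat us vt.
Qed.

Lemma walk_rev u w s : walk u w s -> walk w u (rev (belast u s)).
Proof.
by move=> [us <-]; split; [exact: path_rev_walk|exact: last_rev_belast_last].
Qed.

Lemma walk_in_cell (c : cell Q) (u w : vertex Q) : vert_le u c -> vert_le w c ->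
  exists s, walk u w s.
Proof.
move=> uc wc; apply: (@cell_connected _ _ _ c (fun w => exists s, walk u w s)) uc wc _.
  move=> w1 w2 /edge_in_rstep w12 [s ws]; exists (s ++ [:: w2]).
  by apply: walk_cat ws _; split=> //=; rewrite w12.
by exists [::].
Qed.

(** Along a path in M, the root of the current cell stays reachable from [u]: nearby cells have the
    current one as a face, and the vertices of a cell are joined along its sides. *)
Lemma graph_connected : @path_connected R M -> forall u w : vertex Q,
  exists s, walk u w s.
Proof.
move=> Mpath u w.
have [f0 [cf0 f00 f01]] := Mpath (vertex_point u) (vertex_point w).
pose f := f0 \o clamp.
have cf : continuous f by exact: within_comp cf0 clamp_cont clamp_in.
pose P t := exists s, walk u (root_vertex (cell_of Q (f t))) s.
suff /(_ 1) : forall t, P t.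
  by rewrite /P /f /= (clamp_id in01_1) f01 cell_of_vertex root_vertexE.
apply: (@locally_constant_real R P 0) => [t|]; last first.
  by exists [::]; split=> //; rewrite /f /= (clamp_id in01_0) f00 cell_of_vertex root_vertexE.
near=> s; have ts : cell_le (cell_of Q (f t)) (cell_of Q (f s)).
  by near: s; exact: cf (cell_le_near Q (f t)).
have tr : vert_le (root_vertex (cell_of Q (f t))) (cell_of Q (f s)).
  by apply: cell_le_trans ts; exact: root_vertex_le.
have [q qP] := walk_in_cell tr (@root_vertex_le _ _ _ (cell_of Q (f s))).
split=> -[q' q'P]; last by exists (q' ++ q); exact: walk_cat qP.
by exists (q' ++ rev (belast (root_vertex (cell_of Q (f t))) q));
   apply: walk_cat q'P _; exact: walk_rev.
Unshelve. all: by end_near. Qed.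

End connected_graph.

(** * Lengths *)

Section length_bounds.
Context {R : realType} {M : metricType R}.
Implicit Types (f g : R -> M) (L : R) (s : seq R).
Local Notation I01 := (`[0, 1]%classic : set R).

Fixpoint polygon_length f (a : R) s : R :=
  if s is x :: s' then mdist (f a) (f x) + polygon_length f x s' else 0.

Lemma polygon_lengthE f a b s :
  \sum_(0 <= k < size s) mdist (f (nth b (a :: s) k)) (f (nth b (a :: s) k.+1)) =
  polygon_length f a s.
Proof.
elim: s a => [|x s IH] a /=; first by rewrite big_geq.
by rewrite big_nat_recl //= -IH.
Qed.

Lemma polygon_length_rcons f a s x :
  polygon_length f a (rcons s x) = polygon_length f a s + mdist (f (last a s)) (f x).
Proof. by elim: s a => [|y s IH] a /=; rewrite ?addr0 ?add0r // IH addrA. Qed.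

Lemma polygon_length_ge0 f a s : 0 <= polygon_length f a s.
Proof. by elim: s a => //= x s IH a; rewrite addr_ge0 // mdist_ge0. Qed.

Lemma curve_lengthE (a b : R) f : curve_length a b f =
  ereal_sup [set (polygon_length f a s)%:E | s in itv_partition a b].
Proof.
rewrite /curve_length; congr ereal_sup; congr image.
by apply/funext => s; rewrite polygon_lengthE.
Qed.

Lemma curve_length_ge0 (b : R) f : 0 <= b -> (0 <= curve_length 0 b f)%E.
Proof.
rewrite curve_lengthE le_eqVlt => /predU1P[<-|b0].
  by apply: ereal_sup_ubound; exists [::] => //; rewrite /itv_partition /=.
apply: (@le_trans _ _ (polygon_length f 0 [:: b])%:E).
  by rewrite lee_fin polygon_length_ge0.
by apply: ereal_sup_ubound; exists [:: b] => //; rewrite /itv_partition /= b0.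
Qed.

Lemma curve_length_superadd f x y : 0 <= x -> x <= y ->
  (curve_length 0 x f + (mdist (f x) (f y))%:E <= curve_length 0 y f)%E.
Proof.
move=> x0; rewrite le_eqVlt => /predU1P[<-|xy]; first by rewrite mdistxx adde0.
rewrite -leeBrDr // !curve_lengthE; apply: ge_ereal_sup => _ [s [ps /eqP ls] <-].
rewrite leeBrDr // -EFinD; apply: ereal_sup_ubound; exists (rcons s y).
  by split; rewrite ?last_rcons // rcons_path ps ls.
by rewrite polygon_length_rcons ls.
Qed.

(* A rectifiable curve has length at most L when its distances are controlled by
   the increments of a function (its arc length), which makes concatenation of
   length bounds immediate. *)
Definition length_le f L := exists2 V : R -> R, V 1 - V 0 <= L &
  forall x y, 0 <= x -> x <= y -> y <= 1 -> mdist (f x) (f y) <= V y - V x.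

Lemma length_le_curve_length f L : length_le f L -> (curve_length 0 1 f <= L%:E)%E.
Proof.
move=> [V VL H]; rewrite curve_lengthE.
have main s a : 0 <= a -> path <%R a s -> last a s <= 1 ->
    polygon_length f a s <= V (last a s) - V a.
  elim: s a => [|x s IH] a /= a0; first by rewrite subrr.
  move=> /andP[ax xs] l1; have xl : x <= last x s.
    elim: s x xs {IH a a0 ax l1} => //= y s IH x /andP[xy ys].
    by apply: le_trans (IH y ys); exact: ltW.
  have x0 : 0 <= x by rewrite (le_trans a0) // ltW.
  by have := IH x x0 xs l1; have := H a x a0 (ltW ax) (le_trans xl l1); lra.
apply: ge_ereal_sup => _ [s [ps /eqP ls] <-]; rewrite lee_fin.
by apply: le_trans VL; have := main s 0 (lexx 0) ps; rewrite ls; apply.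
Qed.

(** Arc length from 0 serves as [V]; by superadditivity it is bounded by the total length, hence
    finite. *)
Lemma curve_length_length_le f : (curve_length 0 1 f < +oo)%E ->
  length_le f (fine (curve_length 0 1 f)).
Proof.
move=> foo.
have fin x : 0 <= x -> x <= 1 -> curve_length 0 x f \is a fin_num.
  move=> x0 x1; rewrite ge0_fin_numE ?curve_length_ge0 //.
  apply: le_lt_trans foo; apply: le_trans (curve_length_superadd f x0 x1).
  by rewrite leeDl // lee_fin mdist_ge0.
exists (fun x => fine (curve_length 0 x f)) => [|x y x0 xy y1].
  by rewrite gerBl fine_ge0 // curve_length_ge0.
have y0 := le_trans x0 xy; have x1 := le_trans xy y1.
rewrite -lee_fin EFinB !fineK ?fin // leeBrDl ?fin //.
exact: curve_length_superadd.
Qed.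

Lemma length_le_cst x L : 0 <= L -> length_le (fun=> x) L.
Proof. by move=> L0; exists (fun=> 0) => [|? ? *]; rewrite ?subrr ?mdistxx. Qed.

Lemma length_le_rev f L : length_le f L -> length_le (path_rev f) L.
Proof.
move=> [V VL H]; exists (fun t => - V (1 - t)) => [|x y x0 xy y1].
  by rewrite subrr subr0 opprK addrC.
by rewrite opprK addrC metric_sym; apply: H; lra.
Qed.

Lemma length_le_concat f g L L' : f 1 = g 0 -> length_le f L -> length_le g L' ->
  length_le (loop_concat_fun f g) (L + L').
Proof.
move=> fg [V VL H] [V' VL' H'].
exists (fun t => if t <= 2^-1 then V (2 * t) else V 1 + V' (2 * t - 1) - V' 0).
  have -> : (1 <= 2^-1 :> R) = false by apply/negbTE; rewrite -ltNge; lra.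
  have -> : (0 <= 2^-1 :> R) by lra.
  have -> : 2 * 1 - 1 = 1 :> R by lra.
  by rewrite mulr0; lra.
move=> x y x0 xy y1; rewrite /loop_concat_fun.
have [y2|y2] := leP y 2^-1.
  have -> : x <= 2^-1 by lra.
  by apply: H; lra.
have [x2|x2] := leP x 2^-1; last first.
  by have := H' (2 * x - 1) (2 * y - 1); lra.
have := H (2 * x) 1; have := H' 0 (2 * y - 1).
have := metric_triangle (f (2 * x)) (f 1) (g (2 * y - 1)); rewrite {2}fg; lra.
Qed.

Lemma length_le0_cst f t : length_le f 0 -> I01 t -> f t = f 0.
Proof.
move=> [V VL H]; rewrite /= in_itv /= => /andP[t0 t1].
apply/esym/mdist_positivity/eqP; rewrite eq_le mdist_ge0 andbT.
have := H 0 t; have := H t 1; have := mdist_ge0 (f t) (f 1); lra.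
Qed.

Lemma length_le_ge0 f L : length_le f L -> 0 <= L.
Proof. by move=> [V VL H]; have := H 0 1; have := mdist_ge0 (f 0) (f 1); lra. Qed.

Definition short f := exists2 L, length_le f L &
  (L%:E <= noncontractible_length M * (5^-1)%:E)%E.

Lemma noncontractible_length_ge0 : (0 <= noncontractible_length M)%E.
Proof.
apply: le_ereal_inf_tmp => _ [p [g [_ ->]]]; exact: curve_length_ge0.
Qed.

Lemma short_cst x : short (fun=> x).
Proof.
exists 0; first exact: length_le_cst.
by rewrite mule_ge0 // ?noncontractible_length_ge0 // lee_fin; lra.
Qed.

Lemma short_rev f : short f -> short (path_rev f).
Proof. by move=> [L fL ?]; exists L => //; exact: length_le_rev. Qed.

(** Let l be the infimum. If the closed chain were not contractible, its length would be at least l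
    and at most 4l/5, forcing l = 0; but a curve of length 0 is constant. An infinite l is excluded,
    as the chain has finite length. *)
Lemma short_quad_null f1 f2 f3 f4 :
  [/\ continuous f1, continuous f2, continuous f3 & continuous f4] ->
  [/\ short f1, short f2, short f3 & short f4] ->
  [/\ f1 1 = f2 0, f2 1 = f3 0, f3 1 = f4 0 & f4 1 = f1 0] ->
  path_homotopic (loop_concat_fun (loop_concat_fun f1 f2) (loop_concat_fun f3 f4))
    (fun=> f1 0).
Proof.
move=> [c1 c2 c3 c4] [[L1 l1 s1] [L2 l2 s2] [L3 l3 s3] [L4 l4 s4]] [e1 e2 e3 e4].
set g := loop_concat_fun _ _.
have lg : length_le g ((L1 + L2) + (L3 + L4)).
  by apply: length_le_concat; rewrite ?concat0 ?concat1 //; exact: length_le_concat.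
have cg : continuous g.
  by apply: concat_continuous; rewrite ?concat0 ?concat1 //; exact: concat_continuous.
have g0 : g 0 = f1 0 by rewrite /g !concat0.
have g1 : g 1 = f1 0 by rewrite /g !concat1.
pose G : loop R (f1 0) := Loop (continuous_subspaceT cg) g0 g1.
have [/homotopicP[H [cH H0 H1 He]]|nG] := pselect (contractible G).
  by exists H; split=> // s; have [-> ->] := He s; rewrite g0 g1.
have ell : (noncontractible_length M <= ((L1 + L2) + (L3 + L4))%:E)%E.
  apply: le_trans (length_le_curve_length lg).
  by apply: ereal_inf_lbound; exists (f1 0), G.
have ellfin : noncontractible_length M \is a fin_num.
  rewrite ge0_fin_numE ?noncontractible_length_ge0 //.
  by apply: le_lt_trans ell _; rewrite ltry.
have := noncontractible_length_ge0.
rewrite -(fineK ellfin) in s1 s2 s3 s4 ell *; move: (fine _) s1 s2 s3 s4 ell => r.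
rewrite -!EFinM !lee_fin => s1 s2 s3 s4 ell r0.
have := length_le_ge0 l1; have := length_le_ge0 l2; have := length_le_ge0 l3.
have := length_le_ge0 l4 => *.
have lg0 : length_le g 0.
  by move: lg; have -> : (L1 + L2) + (L3 + L4) = 0 by lra.
by apply: path_homotopic_eq => // t It; rewrite (length_le0_cst lg0 It).
Qed.

End length_bounds.

(** * Realization of edge paths *)

Section edge_cocycle.
Context {R : realType} {M : metricType R} (Q : rectangulation M).
Hypothesis Qfine : fine_enough Q.
Variables (p : M) (sigma : M -> R -> M).
Hypothesis sigma_cont : forall x, continuous (sigma x).
Hypothesis sigma0 : forall x, sigma x 0 = p.
Hypothesis sigma1 : forall x, sigma x 1 = x.
Implicit Types (c d e : cell Q) (u w : vertex Q) (x y z : M) (f g : R -> M).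
Local Notation X := (natural_graph Q).
Local Notation r1 := (1%:pos : {posnum R}).
Local Notation cls := (path_cls p sigma).
Local Notation cls_concat := (path_cls_concat sigma_cont sigma0 sigma1).
Local Notation cls_rev := (path_cls_rev sigma_cont sigma0 sigma1).
Local Notation cls_cst := (path_cls_cst sigma_cont sigma0 sigma1).
Local Notation cls_homotopic := (path_cls_homotopic sigma_cont sigma0 sigma1).

Lemma short_edge e : cell_dim e = 1%N -> short (edge_path e).
Proof.
move=> e1; have foo := rect_edge_finite e1; have := Qfine e1.
have [V VL H] := curve_length_length_le foo; rewrite /edge_length.
have fin : curve_length 0 1 (edge_curve e) \is a fin_num.
  by rewrite ge0_fin_numE // curve_length_ge0.
rewrite -{1}(fineK fin) => fl; exists (fine (curve_length 0 1 (edge_curve e))) => //.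
exists V => // x y x0 xy y1; rewrite /edge_path !clamp_id; first exact: H.
  by rewrite /= in_itv /= y1 (le_trans x0).
by rewrite /= in_itv /= x0 (le_trans xy).
Qed.

Definition vertex_curve u w f :=
  [/\ continuous f, f 0 = vertex_point u, f 1 = vertex_point w & short f].

Lemma vertex_curve_rev u w f : vertex_curve u w f -> vertex_curve w u (path_rev f).
Proof.
move=> [cf f0 f1 sf]; split; rewrite ?path_rev0 ?path_rev1 //.
  exact: path_rev_cont.
exact: short_rev.
Qed.

Lemma vertex_curve_cst u : vertex_curve u u (fun=> vertex_point u).
Proof. by split=> //; [exact: cst_cont|exact: short_cst]. Qed.

Lemma vertex_curve_edge e u w : cell_dim e = 1%N -> vert_le u e -> vert_le w e ->
  u != w -> exists2 f, vertex_curve u w f & edge_between e u w f.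
Proof.
move=> e1 ue we uw; have se := short_edge e1.
have [h|h] := edge_betweenP e1 ue we uw; have [cf f0 f1 _ _] := h.
  by exists (edge_path e) => //; split.
by exists (path_rev (edge_path e)) => //; split=> //; exact: short_rev.
Qed.

Lemma vertex_curve_exists u w : @rstep R X r1 u w -> exists f, vertex_curve u w f.
Proof.
move=> /rstep_graphP[->|[c [e [e1 _ ue we]]]].
  by exists (fun=> vertex_point w); exact: vertex_curve_cst.
have [->|uw] := eqVneq u w.
  by exists (fun=> vertex_point w); exact: vertex_curve_cst.
by have [f] := vertex_curve_edge e1 ue we uw; exists f.
Qed.

Lemma vertex_curve_quad u1 u2 u3 u4 f1 f2 f3 f4 : vertex_curve u1 u2 f1 ->
  vertex_curve u2 u3 f2 -> vertex_curve u3 u4 f3 -> vertex_curve u4 u1 f4 ->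
  (cls f1 * cls f2 * (cls f3 * cls f4) = 1)%g.
Proof.
move=> [c1 a1 b1 s1] [c2 a2 b2 s2] [c3 a3 b3 s3] [c4 a4 b4 s4].
have e1 : f1 1 = f2 0 by rewrite b1.
have e2 : f2 1 = f3 0 by rewrite b2.
have e3 : f3 1 = f4 0 by rewrite b3.
have e4 : f4 1 = f1 0 by rewrite b4.
rewrite -cls_concat // -cls_concat // -cls_concat; first last.
- by rewrite concat0 concat1.
- exact: concat_continuous.
- exact: concat_continuous.
rewrite -(cls_cst (f1 0)); apply: cls_homotopic.
- by apply: concat_continuous; rewrite ?concat0 ?concat1 //; exact: concat_continuous.
- exact: cst_cont.
- exact: short_quad_null.
Qed.

(** Two constant curves complete [f] followed by the reverse of [g] to a quadrilateral. *)
Lemma vertex_curve_cls u w f g : vertex_curve u w f -> vertex_curve u w g ->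
  cls f = cls g.
Proof.
move=> uf ug; have [cg _ _ _] := ug.
have := vertex_curve_quad uf (vertex_curve_rev ug) (vertex_curve_cst u) (vertex_curve_cst u).
rewrite cls_cst !mulg1 cls_rev // => /eqP; rewrite mulg_eq1 invgK => /eqP //.
Qed.

(** Any short curve from [u] to [w] gives the same class; the default value is 1. *)
Definition mu u w : pi1 R p :=
  if pselect (exists f, vertex_curve u w f) is left h then cls (sval (cid h)) else 1%g.

Lemma muE u w f : vertex_curve u w f -> mu u w = cls f.
Proof.
move=> uf; rewrite /mu; case: pselect => [h|[]]; last by exists f.
by apply: vertex_curve_cls uf; exact: svalP (cid h).
Qed.

Lemma mu_flat : flat r1 (mu : X -> X -> pi1 R p).
Proof.
split=> [u|u w y z /vertex_curve_exists[f uf] /vertex_curve_exists[g ug]].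
  by rewrite (muE (vertex_curve_cst u)) cls_cst.
move=> /vertex_curve_exists[f' uf'] /vertex_curve_exists[g' ug'].
rewrite (muE uf) (muE ug) (muE uf') (muE ug').
have := vertex_curve_quad uf ug (vertex_curve_rev ug') (vertex_curve_rev uf').
have [cf' _ _ _] := uf'; have [cg' _ _ _] := ug'.
by rewrite !cls_rev // -invgM => /eqP; rewrite mulg_eq1 invgK => /eqP.
Qed.

End edge_cocycle.

(** * Classes of paths inside one cell *)

Section cell_classes.
Context {R : realType} {M : metricType R} (K : regular_complex M).
Variables (p : M) (sigma : M -> R -> M).
Hypothesis sigma_cont : forall x, continuous (sigma x).
Hypothesis sigma0 : forall x, sigma x 0 = p.
Hypothesis sigma1 : forall x, sigma x 1 = x.
Implicit Types (c d e : cell K) (x y z : M) (f g : R -> M).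
Local Notation I01 := (`[0, 1]%classic : set R).
Local Notation cls := (path_cls p sigma).
Local Notation cls_concat := (path_cls_concat sigma_cont sigma0 sigma1).
Local Notation cls_homotopic := (path_cls_homotopic sigma_cont sigma0 sigma1).

Definition cell_cls c x y := cls (cell_seg c x y).

Lemma path_cls_clamp f : continuous f -> cls (f \o clamp) = cls f.
Proof.
move=> cf; apply: (eq_path_cls sigma_cont sigma0 sigma1) => //.
  exact: comp_cont cf clamp_cont.
by move=> t It /=; rewrite clamp_id.
Qed.

Lemma path_cls_in_cell c f : continuous f -> (forall t, I01 t -> closed_cell c (f t)) ->
  cls f = cell_cls c (f 0) (f 1).
Proof.
move=> cf fc; rewrite -path_cls_clamp //.
have fc0 : closed_cell c (f 0) by apply: fc; exact: in01_0.
have fc1 : closed_cell c (f 1) by apply: fc; exact: in01_1.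
have cfc : continuous (f \o clamp) by exact: comp_cont cf clamp_cont.
apply: cls_homotopic => //; first exact: cell_seg_cont.
apply: (@path_homotopic_in_cell _ _ _ c) => //.
- exact: cell_seg_cont.
- by move=> t; apply: fc; exact: clamp_in.
- by move=> t; exact: cell_seg_in.
- by rewrite /= (clamp_id in01_0) cell_seg0.
- by rewrite /= (clamp_id in01_1) cell_seg1.
Qed.

Lemma cell_clsM c x y z : closed_cell c x -> closed_cell c y -> closed_cell c z ->
  (cell_cls c x y * cell_cls c y z = cell_cls c x z)%g.
Proof.
move=> cx cy cz; rewrite /cell_cls -cls_concat; try exact: cell_seg_cont; last first.
  by rewrite cell_seg0 // cell_seg1.
rewrite (@path_cls_in_cell c); first by rewrite concat0 concat1 cell_seg0 // cell_seg1.
  by apply: concat_continuous; try exact: cell_seg_cont; rewrite cell_seg0 // cell_seg1.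
by move=> t _; rewrite /loop_concat_fun; case: ifP => _; exact: cell_seg_in.
Qed.

Lemma cell_clsxx c x : closed_cell c x -> cell_cls c x x = 1%g.
Proof. by move=> cx; apply: (mulgI (cell_cls c x x)); rewrite cell_clsM // mulg1. Qed.

Lemma cell_clsV c x y : closed_cell c x -> closed_cell c y ->
  cell_cls c y x = (cell_cls c x y)^-1%g.
Proof. by move=> cx cy; apply/esym/mulg1_eq; rewrite cell_clsM // cell_clsxx. Qed.

Lemma cell_cls_le c d x y : cell_le c d -> closed_cell c x -> closed_cell c y ->
  cell_cls c x y = cell_cls d x y.
Proof.
move=> cd cx cy; rewrite {1}/cell_cls (@path_cls_in_cell d).
- by rewrite cell_seg0 // cell_seg1.
- exact: cell_seg_cont.
- by move=> t _; apply: cd; exact: cell_seg_in.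
Qed.

(** The two halves of the boundary of the square have the same ends and are joined by a
    straight-line homotopy in the plane, to which [H] is applied. *)
Lemma path_cls_square (H : R * R -> M) : continuous H ->
  (cls (fun t => H (0%R, t)) * cls (fun s => H (s, 1%R)) =
   cls (fun s => H (s, 0%R)) * cls (fun t => H (1%R, t)))%g.
Proof.
move=> cH.
have c1 (a : R) : continuous (fun t : R => (a, t)).
  by apply: pair_cont; [exact: cst_cont|exact: id_cont].
have c2 (a : R) : continuous (fun t : R => (t, a)).
  by apply: pair_cont; [exact: id_cont|exact: cst_cont].
have cH1 a : continuous (fun t => H (a, t)) by exact: comp_cont cH (c1 a).
have cH2 a : continuous (fun t => H (t, a)) by exact: comp_cont cH (c2 a).
rewrite -!cls_concat //; apply: cls_homotopic; try exact: concat_continuous.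
pose phi := loop_concat_fun (fun t : R => (0, t) : R^o * R^o) (fun t : R => (t, 1)).
pose psi := loop_concat_fun (fun t : R => (t, 0) : R^o * R^o) (fun t : R => (1, t)).
have -> : loop_concat_fun (fun t => H (0, t)) (fun s => H (s, 1)) = H \o phi.
  by apply/funext => t; rewrite /= /phi /loop_concat_fun; case: ifP.
have -> : loop_concat_fun (fun s => H (s, 0)) (fun t => H (1, t)) = H \o psi.
  by apply/funext => t; rewrite /= /psi /loop_concat_fun; case: ifP.
apply: (@path_homotopic_linear R M (R^o * R^o)%type H) => //.
- exact: concat_continuous.
- exact: concat_continuous.
- by rewrite /phi /psi !concat0.
- by rewrite /phi /psi !concat1.
Qed.

End cell_classes.

(** * Radial projection of a top cell from its center *)

Section radial_push.
Context {R : realType} {M : metricType R} (K : regular_complex M).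
Implicit Types (c d : cell K) (x y z : M).

Lemma rV_coord_le_norm k (v : 'rV[R]_k) j : `|v ord0 j| <= `|v|.
Proof.
rewrite [leRHS]/Num.Def.normr /= mx_normrE; apply/bigmax_geP; right => /=.
by exists (ord0, j).
Qed.

Lemma rV_norm_le k (v : 'rV[R]_k) a : 0 <= a -> (forall j, `|v ord0 j| <= a) ->
  `|v| <= a.
Proof.
move=> a0 va; rewrite /Num.Def.normr /= mx_normrE; apply/bigmax_leP; split=> // -[i j] _ /=.
by rewrite (ord1 i).
Qed.

Lemma rV_norm_attained k (v : 'rV[R]_k) : `|v| != 0 -> exists j, `|v| = `|v ord0 j|.
Proof. move=> /mx_norm_neq0[[i j] vE]; exists j.
by rewrite [LHS]vE /= (ord1 i). Qed.

Variables (S : {set cell K}) (e : cell K).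
Hypothesis Sface : forall c d, c \in S -> cell_le d c -> d \in S.
Hypothesis eS : e \in S.
Hypothesis emax : forall c, c \in S -> (cell_dim c <= cell_dim e)%N.

Definition rest : set M := [set x | cell_of K x \in S :\ e].

(** A cell of maximal dimension is a face only of itself, so removing it keeps the set closed under
    faces. *)
Lemma rest_face c d : c \in S :\ e -> cell_le d c -> d \in S :\ e.
Proof.
rewrite !inE => /andP[ce cS] dc; rewrite (Sface cS dc) andbT.
apply/eqP => de; have [ec|] := cell_le_dim dc; first by case/eqP: ce; rewrite -ec.
by rewrite de ltnNge (emax cS).
Qed.

Lemma rest_closed : closed rest.
Proof.
rewrite (_ : rest = \bigcup_(d in [set d | d \in S :\ e]) closed_cell d).
  by apply: closed_bigcup => [|d _]; [exact: finite_finset|exact: closed_cell_closed].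
apply/seteqP; split=> [x xS|x [d dS dx]].
  by exists (cell_of K x) => //; exact: closed_cell_of.
by apply: rest_face dS _; exact: cell_of_le.
Qed.

Lemma not_rest x : cell_of K x \in S -> ~ rest x -> cell_of K x = e.
Proof.
move=> xS nx; apply/eqP/negPn/negP => xe; apply: nx.
by rewrite /rest /= !inE xe.
Qed.

(** The norm is the sup norm, so in these coordinates the cube is the ball of radius 1/2 around 0
    and its boundary is the sphere. *)
Definition centered x : 'rV[R]_(cell_dim e) := cell_coord e x - const_mx 2^-1.

Lemma centered_norm_le x : closed_cell e x -> `|centered x| <= 2^-1.
Proof.
move=> /cell_coordP[cz _]; apply: rV_norm_le => [|j]; first lra.
have := cz j; rewrite !mxE in_itv /= ler_norml => /andP[? ?].
by apply/andP; split; lra.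
Qed.

Lemma centered_norm_gt0 x : closed_cell e x -> x <> cell_center e -> 0 < `|centered x|.
Proof.
move=> /cell_coordP[_ zx] xc; rewrite normr_gt0; apply/eqP => w0; apply: xc.
by rewrite -zx /cell_center; congr cell_map; apply/eqP; rewrite -subr_eq0; apply/eqP.
Qed.

Lemma rest_centered_norm x : closed_cell e x -> rest x -> `|centered x| = 2^-1.
Proof.
move=> ex Lx; apply/eqP; rewrite eq_le centered_norm_le //= leNgt; apply/negP => lt.
have [cz zx] := cell_coordP ex.
have /open_cell_of xe : open_cell e x.
  exists (cell_coord e x) => // j.
  have := le_lt_trans (rV_coord_le_norm (centered x) j) lt.
  rewrite !mxE ltr_norml in_itv /= => /andP[? ?].
  by apply/andP; split; lra.
by move: Lx; rewrite /rest /= xe !inE eqxx.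
Qed.

(* Radial projection in cell coordinates: the point with centered coordinates w
   moves to w / (2 |w|), which has norm 1/2 and so lies on the boundary. *)
Definition push x (s : R) : M :=
  if `[< closed_cell e x >] then total_cell_map e (const_mx 2^-1 +
    ((1 - s) + s * (2 * `|centered x|)^-1) *: centered x) else x.

Lemma push_in x s : closed_cell e x -> closed_cell e (push x s).
Proof. by move=> ex; rewrite /push asboolT //; exact: total_cell_map_in. Qed.

Lemma push_out x s : ~ closed_cell e x -> push x s = x.
Proof. by move=> ex; rewrite /push asboolF. Qed.

Lemma push0 x : push x 0 = x.
Proof.
rewrite /push; case: asboolP => // ex.
rewrite subr0 mul0r addr0 scale1r /centered addrC subrK.
exact: total_cell_map_coord.
Qed.

Lemma push_rest x s : rest x -> push x s = x.
Proof.
move=> Lx; have [ex|nex] := pselect (closed_cell e x); last exact: push_out.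
rewrite /push asboolT // rest_centered_norm // mulfV // invr1 mulr1 subrK scale1r.
by rewrite /centered addrC subrK; exact: total_cell_map_coord.
Qed.

Lemma push1 x : cell_of K x \in S -> x <> cell_center e -> rest (push x 1).
Proof.
move=> xS xc; have [Lx|nLx] := pselect (rest x); first by rewrite push_rest.
have xe := not_rest xS nLx.
have ex : closed_cell e x by rewrite -xe; exact: closed_cell_of.
have w0 := centered_norm_gt0 ex xc.
set w := centered x in w0.
pose v := (2 * `|w|)^-1 *: w.
have nv j : `|v ord0 j| <= 2^-1.
  rewrite mxE normrM normfV normrM normr_id ger0_norm //.
  rewrite ler_pdivrMl ?mulr_gt0 //.
  by have := rV_coord_le_norm w j; lra.
(* In a coordinate where the norm is attained the projected point has an endpoint value, which puts
   it on the boundary. *)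
have [j wj] := rV_norm_attained (lt0r_neq0 w0).
have vj : `|v ord0 j| = 2^-1.
  by rewrite mxE normrM normfV normrM normr_id ger0_norm // -wj invfM mulfVK ?lt0r_neq0.
have cE i : (const_mx 2^-1 + v) ord0 i = 2^-1 + v ord0 i.
  by rewrite mxE [X in X + _]mxE.
have cz : cube (cell_dim e) (const_mx 2^-1 + v).
  move=> i; have := nv i; rewrite cE ler_norml in_itv /= => /andP[? ?].
  by apply/andP; split; lra.
have -> : push x 1 = cell_map (const_mx 2^-1 + v).
  by rewrite /push asboolT // subrr add0r mul1r /total_cell_map /= clamp_rV_id.
have : cell_boundary e (cell_map (const_mx 2^-1 + v)).
  exists (const_mx 2^-1 + v) => //; split=> // /(_ j).
  rewrite cE in_itv /= => /andP[? ?].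
  have : `|v ord0 j| < 2^-1 by rewrite ltr_norml; apply/andP; split; lra.
  by rewrite vj ltxx.
rewrite cell_boundaryE => -[d [de db] dx].
have le_de : cell_le d e by apply: subset_trans db _ => _ [u [cu _] <-]; exists u.
have := cell_of_le dx => le_xd; rewrite /rest /= !inE.
rewrite (Sface eS (cell_le_trans le_xd le_de)) andbT; apply/eqP => xe'.
have [ed|] := cell_le_dim le_xd; first by rewrite -ed xe' ltnn in de.
by rewrite xe' ltnNge (ltnW de).
Qed.

(** Two closed pieces cover the plane: over [e], the formula is continuous since the center is
    avoided; over [rest], nothing moves. *)
Lemma push_cont (g : R -> M) : continuous g -> (forall t, cell_of K (g t) \in S) ->
  (forall t, g t <> cell_center e) ->
  continuous (fun x : R * R => push (g x.2) x.1).
Proof.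
move=> cg gS gc.
have cg2 : continuous (fun x : R * R => g x.2) by apply: comp_cont cg _; exact: snd_cont.
pose B1 : set (R * R) := (fun x : R * R => g x.2) @^-1` closed_cell e.
pose B2 : set (R * R) := (fun x : R * R => g x.2) @^-1` rest.
have cB1 : closed B1 by apply: preimage_closed => //; exact: closed_cell_closed.
have cB2 : closed B2 by apply: preimage_closed => //; exact: rest_closed.
have : {within B1 `|` B2, continuous (fun x : R * R => push (g x.2) x.1)}.
  apply: withinU_continuous => //; last first.
    apply: (@subspace_eq_continuous _ B2 _ (fun x : R * R => g x.2)).
      by move=> x; rewrite inE => Lx; rewrite /from_subspace /= push_rest.
    exact: continuous_subspaceT.
  pose z (x : R * R) := centered (g x.2).
  apply: (@subspace_eq_continuous _ B1 _ (fun x : R * R => total_cell_map e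
      (const_mx 2^-1 + ((1 - x.1) + x.1 * (2 * `|z x|)^-1) *: z x))).
    by move=> x; rewrite inE => ex; rewrite /from_subspace /= /push asboolT.
  apply/subspace_continuousP => x ex.
  have z0 : 2 * `|z x| != 0 by rewrite mulf_neq0 // lt0r_neq0 // centered_norm_gt0.
  have cx1 : (fun x : R * R => x.1) @ within B1 (nbhs x) --> x.1.
    by apply: cvg_within_filter; exact: fst_cont.
  have cz : z @ within B1 (nbhs x) --> z x.
    apply: cvgB; last exact: cvg_cst.
    have /subspace_continuousP/(_ _ ex) cc := @cell_coord_cont _ _ K e.
    have gw : (fun x : R * R => g x.2) @ within B1 (nbhs x) -->
        within (closed_cell e) (nbhs (g x.2)) by move=> B nB; exact: (cg2 x _ nB).
    exact: cvg_comp gw cc.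
  apply: (@cvg_comp _ _ _ _ (total_cell_map e) _ (nbhs (const_mx 2^-1 +
    ((1 - x.1) + x.1 * (2 * `|z x|)^-1) *: z x))); last exact: total_cell_map_cont.
  apply: cvgD; first exact: cvg_cst.
  apply: cvgZ => //; apply: cvgD; first by apply: cvgB => //; exact: cvg_cst.
  apply: cvgM => //; apply: cvgV => //; apply: cvgM; first exact: cvg_cst.
  exact: cvg_norm.
have -> : B1 `|` B2 = setT.
  apply/seteqP; split=> // x _; have [?|nL] := pselect (rest (g x.2)); first by right.
  by left; rewrite /B1 /= -(not_rest (gS x.2) nL); exact: closed_cell_of.
by move=> H x; rewrite /continuous_at -(nbhs_subspaceT x); exact: H.
Qed.

End radial_push.

(** * Every path is homotopic to an edge path up to tails *)

Section edge_path_generation.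
Context {R : realType} {M : metricType R} (Q : rectangulation M).
Hypothesis Qfine : fine_enough Q.
Variables (p : M) (sigma : M -> R -> M).
Hypothesis sigma_cont : forall x, continuous (sigma x).
Hypothesis sigma0 : forall x, sigma x 0 = p.
Hypothesis sigma1 : forall x, sigma x 1 = x.
Implicit Types (c d e : cell Q) (u w : vertex Q) (x y z : M) (f : R -> M).
Local Notation X := (natural_graph Q).
Local Notation r1 := (1%:pos : {posnum R}).
Local Notation I01 := (`[0, 1]%classic : set R).
Local Notation cls := (path_cls p sigma).
Local Notation cellc := (cell_cls p sigma).
Local Notation mu := (mu p sigma : X -> X -> pi1 R p).
Local Notation cls_concat := (path_cls_concat sigma_cont sigma0 sigma1).
Local Notation cls_rev := (path_cls_rev sigma_cont sigma0 sigma1).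
Local Notation cls_cst := (path_cls_cst sigma_cont sigma0 sigma1).
Local Notation cellcM := (cell_clsM sigma_cont sigma0 sigma1).
Local Notation cellcV := (cell_clsV sigma_cont sigma0 sigma1).
Local Notation cellcxx := (cell_clsxx sigma_cont sigma0 sigma1).
Local Notation cellc_le := (cell_cls_le sigma_cont sigma0 sigma1).
Local Notation muflat := (mu_flat Qfine sigma_cont sigma0 sigma1).

Definition root_of x : vertex Q := root_vertex (cell_of Q x).

Definition to_root x := cellc (cell_of Q x) x (vertex_point (root_of x)).

(* The class g of a path from x to y is that of an edge path, up to the tails
   joining x and y to the root vertices of their cells. *)
Definition edge_generated x y (g : pi1 R p) := exists2 s,
  walk (root_of x) (root_of y) s &
  g = (to_root x * hol mu (root_of x) s * (to_root y)^-1)%g.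

Lemma edge_generatedM y x z g h : edge_generated x y g -> edge_generated y z h ->
  edge_generated x z (g * h)%g.
Proof.
move=> [s sP ->] [t tP ->]; exists (s ++ t); first exact: walk_cat tP.
by case: sP => _ sl; rewrite hol_cat sl !mulgA mulgVK.
Qed.

Lemma cell_cls_edge c u w : edge_in c u w ->
  cellc c (vertex_point u) (vertex_point w) = mu u w.
Proof.
move=> uw; have [uc wc] := edge_in_vert_le uw.
have [e [e1 ec ue we]] := uw.
have [<-|nuw] := eqVneq u w.
  by rewrite (flatxx muflat) cellcxx //; exact: vertex_point_in.
have [f fP [cf f0 f1 _ fe]] := vertex_curve_edge Qfine e1 ue we nuw.
rewrite (muE sigma_cont sigma0 sigma1 fP).
rewrite (@path_cls_in_cell _ _ _ _ _ sigma_cont sigma0 sigma1 c) ?f0 ?f1 //.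
by move=> t _; exact: ec.
Qed.

(** The roots of the cells carrying [x] and [y] are vertices of [c], hence joined by sides of [c];
    within [c] the class of a path depends only on its ends. *)
Lemma edge_generated_cell c x y : closed_cell c x -> closed_cell c y ->
  edge_generated x y (cellc c x y).
Proof.
move=> cx cy; have xc := cell_of_le cx; have yc := cell_of_le cy.
have uc : vert_le (root_of x) c by apply: cell_le_trans xc; exact: root_vertex_le.
have wc : vert_le (root_of y) c by apply: cell_le_trans yc; exact: root_vertex_le.
have pu := vertex_point_in uc; have pw := vertex_point_in wc.
have rootE z : cell_le (cell_of Q z) c ->
    to_root z = cellc c z (vertex_point (root_of z)).
  move=> zc; apply: cellc_le => //; first exact: closed_cell_of.
  by apply: vertex_point_in; exact: root_vertex_le.
have [s sP sE] : exists2 s, walk (root_of x) (root_of y) s &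
    hol mu (root_of x) s =
    cellc c (vertex_point (root_of x)) (vertex_point (root_of y)).
  pose P w := exists2 s, walk (root_of x) w s &
    hol mu (root_of x) s = cellc c (vertex_point (root_of x)) (vertex_point w).
  apply: (@cell_connected _ _ _ c P _ (root_of x)) => //; last first.
    by exists [::]; rewrite ?cellcxx //=.
  move=> w1 w2 w12 [s [sp sl] sE]; have [w1c w2c] := edge_in_vert_le w12.
  exists (s ++ [:: w2]).
    by split; rewrite ?cat_path ?last_cat //= sp sl (edge_in_rstep w12).
  rewrite hol_cat sE sl /= mulg1 -(cell_cls_edge w12).
  by rewrite cellcM //; exact: vertex_point_in.
exists s => //; rewrite !rootE // sE -(cellcV cy pw) !cellcM //.
Qed.

Lemma edge_generated_refl x : edge_generated x x 1%g.
Proof.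
rewrite -(cellcxx (closed_cell_of Q x)).
by apply: edge_generated_cell; exact: closed_cell_of.
Qed.

(** The projection spreads a square whose far side lies in [rest]. The tracks of the two ends stay
    in [e] or are constant, so [edge_generated_cell] handles them. *)
Lemma edge_generated_push (S : {set cell Q}) e :
  (forall c d, c \in S -> cell_le d c -> d \in S) -> e \in S ->
  (forall c, c \in S -> (cell_dim c <= cell_dim e)%N) ->
  (forall f, continuous f -> (forall t, cell_of Q (f t) \in S :\ e) ->
     edge_generated (f 0) (f 1) (cls f)) ->
  forall f, continuous f -> (forall t, cell_of Q (f t) \in S) ->
    (forall t, f t <> cell_center e) -> edge_generated (f 0) (f 1) (cls f).
Proof.
move=> Sface eS emax IH f cf fS fc.
pose H (x : R * R) := push e (f x.2) x.1.
have cH : continuous H by apply: (@push_cont _ _ _ S e) => //.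
have c1 (a : R) : continuous (fun t : R => H (a, t)).
  by apply: comp_cont cH _; apply: pair_cont; [exact: cst_cont|exact: id_cont].
have c2 (a : R) : continuous (fun s : R => H (s, a)).
  by apply: comp_cont cH _; apply: pair_cont; [exact: id_cont|exact: cst_cont].
have H0 t : H (0, t) = f t by rewrite /H push0.
have side t : edge_generated (f t) (H (1, t)) (cls (fun s => H (s, t))) /\
    edge_generated (H (1, t)) (f t) ((cls (fun s => H (s, t)))^-1)%g.
  have [ef|nef] := pselect (closed_cell e (f t)); last first.
    have HE s : H (s, t) = f t by rewrite /H push_out.
    have -> : (fun s => H (s, t)) = (fun=> f t) by apply/funext.
    by rewrite HE cls_cst invg1; split; exact: edge_generated_refl.
  have He s : closed_cell e (H (s, t)) by exact: push_in.
  rewrite (@path_cls_in_cell _ _ _ _ _ sigma_cont sigma0 sigma1 e) // H0 -cellcV //.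
  by split; exact: edge_generated_cell.
have mid : edge_generated (H (1, 0)) (H (1, 1)) (cls (fun t => H (1, t))).
  by apply: IH => // t; exact: push1.
have -> : cls f = (cls (fun s => H (s, 0%R)) * cls (fun t => H (1%R, t)) *
    (cls (fun s => H (s, 1%R)))^-1)%g.
  rewrite -(path_cls_square sigma_cont sigma0 sigma1 cH) mulgK; congr cls.
  by apply/funext => t; rewrite H0.
apply: edge_generatedM (side 1).2; apply: edge_generatedM mid; exact: (side 0).1.
Qed.

(** Induction on the number of cells allowed. Connectedness of the line reduces the claim to short
    pieces of [f], each of which stays in [e] or avoids its center. *)
Lemma edge_generated_path f : continuous f -> edge_generated (f 0) (f 1) (cls f).
Proof.
move=> cf; suff main n (S : {set cell Q}) : (#|S| <= n)%N ->
    (forall c d, c \in S -> cell_le d c -> d \in S) ->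
    forall f, continuous f -> (forall t, cell_of Q (f t) \in S) ->
    edge_generated (f 0) (f 1) (cls f).
  by apply: (main _ [set: cell Q]%SET (leqnn _)) => // *; rewrite inE.
elim: n S {f cf} => [|n IH] S Sn Sface f cf fS.
  by have := fS 0; move: Sn; rewrite leqn0 cards_eq0 => /eqP ->; rewrite inE.
have [e eS emax] := @arg_maxnP _ (cell_of Q (f 0)) (mem S) (@cell_dim _ _ Q) (fS 0).
have {}IH : forall f, continuous f -> (forall t, cell_of Q (f t) \in S :\ e) ->
     edge_generated (f 0) (f 1) (cls f).
  apply: IH; first by move: Sn; rewrite (cardsD1 e) [e \in S]eS.
  by move=> c d; exact: (rest_face Sface emax).
have cb (t u : R) : continuous (subpath f t u \o clamp).
  by apply: comp_cont clamp_cont; exact: subpath_cont.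
have clsb (t u : R) : cls (subpath f t u) = cls (subpath f t u \o clamp).
  by rewrite (path_cls_clamp sigma_cont sigma0 sigma1) //; exact: subpath_cont.
have conv (x t u d : R) : ball x d t -> ball x d u -> forall s,
    ball x d (t + clamp s * (u - t)).
  rewrite /ball /= !ltr_norml => /andP[t1 t2] /andP[u1 u2] s.
  have := clamp_in s; rewrite /= in_itv /=; move: (clamp s) => {}s /andP[s0 s1].
  rewrite ltr_norml; have [tu|ut] := leP t u.
    have h0 : 0 <= s * (u - t) by rewrite mulr_ge0 // subr_ge0.
    have h1 : s * (u - t) <= u - t by rewrite ler_piMl // subr_ge0.
    by apply/andP; split; lra.
  have h0 : 0 <= s * (t - u) by rewrite mulr_ge0 // subr_ge0 ltW.
  have h1 : s * (t - u) <= t - u by rewrite ler_piMl // subr_ge0 ltW.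
  by apply/andP; split; lra.
have loc (x : R) : exists2 d : R, 0 < d & forall t u : R, ball x d t -> ball x d u ->
    edge_generated (f t) (f u) (cls (subpath f t u)).
  (* If [f x] is outside the closed set [rest], so are the nearby points, which are then carried by
     [e]; otherwise [f x] is not the center, and nearby points avoid it. *)
  have [xe|xne] := pselect (rest S e (f x)); last first.
    have : nbhs (f x) (~` rest S e).
      apply: open_nbhs_nbhs; split=> //; rewrite openC.
      exact: rest_closed.
    move=> /cf/nbhs_ballP[d /= d0 dP]; exists d => // t u tx ux.
    have fe (r : R) : ball x d r -> closed_cell e (f r).
      by move=> /dP/(not_rest (fS r)) <-; exact: closed_cell_of.
    rewrite (@path_cls_in_cell _ _ _ _ _ sigma_cont sigma0 sigma1 e); [|exact: subpath_cont|].
      rewrite subpath0 subpath1; apply: edge_generated_cell; exact: fe.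
    move=> s Is; apply: fe; have := conv _ _ _ _ tx ux s.
    by rewrite clamp_id.
  have : nbhs (f x) (~` [set cell_center e]).
    apply: open_nbhs_nbhs; split.
      rewrite openC; apply: accessible_closed_set1.
      by apply: hausdorff_accessible; exact: metric_hausdorff.
    move=> /= fxe; move: xe; rewrite fxe /rest /=.
    by rewrite cell_of_center !inE eqxx.
  move=> /cf/nbhs_ballP[d /= d0 dP]; exists d => // t u tx ux; rewrite clsb.
  have := edge_generated_push Sface eS emax IH (cb t u).
  rewrite /= (clamp_id in01_0) (clamp_id in01_1) subpath0 subpath1; apply.
    by move=> s; exact: fS.
  by move=> s; exact: dP (conv _ _ _ _ tx ux s).
suff : edge_generated (f 0) (f 1) (cls (subpath f 0 1)).
  by congr (edge_generated _ _ (cls _)); apply/funext => t; rewrite /subpath; congr f; lra.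
pose P t := edge_generated (f 0) (f t) (cls (subpath f 0 t)).
suff /(_ 1) : forall t, P t by [].
apply: (@locally_constant_real R P 0) => [x|]; last first.
  by have [d d0 h] := loc 0; apply: h; exact: ballxx.
have [d d0 h] := loc x; apply/nbhs_ballP; exists d => //= t tx.
have step a b : ball x d a -> ball x d b -> P a -> P b.
  move=> ax bx; rewrite /P (path_cls_subpath sigma_cont sigma0 sigma1 0 a b cf).
  by move=> Pa; apply: edge_generatedM Pa _; exact: h.
by split; apply: step => //; exact: ballxx.
Qed.

End edge_path_generation.

(** * The isomorphism *)

Section realization.
Context {R : realType} {M : metricType R} (Q : rectangulation M).
Hypothesis Qfine : fine_enough Q.
Variables (p : M) (sigma : M -> R -> M).
Hypothesis sigma_cont : forall x, continuous (sigma x).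
Hypothesis sigma0 : forall x, sigma x 0 = p.
Hypothesis sigma1 : forall x, sigma x 1 = x.
Hypothesis sigmap : sigma p = (fun=> p).
Local Notation X := (natural_graph Q).
Local Notation r1 := (1%:pos : {posnum R}).
Variables (v : vertex Q) (rho : X -> seq X).
Hypothesis rhov : rho v = [::].
Hypothesis rhoP : forall u, walk v u (rho u).
Implicit Types (u w : vertex Q) (x y : M) (f : R -> M).
Local Notation cls := (path_cls p sigma).
Local Notation mu := (mu p sigma : X -> X -> pi1 R p).
Local Notation muflat := (mu_flat Qfine sigma_cont sigma0 sigma1).
Local Notation A := (@discrete_pi1 R X r1 v).
Local Notation P := (pi1 R p).

Lemma hol_rev (G : groupType) (l : X -> X -> G) : flat r1 l ->
  forall (u : X) s, path (rstep r1) u s ->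
  (hol l u s * hol l (last u s) (rev (belast u s)) = 1)%g.
Proof.
move=> lflat u s; elim: s u => [|w s IH] u /=; first by rewrite mulg1.
move=> /andP[uw ws]; rewrite rev_cons -cats1 hol_cat last_rev_belast_last /= mulg1.
rewrite mulgA -[(l u w * _ * _)%g]mulgA (IH _ ws) mulg1.
exact: (flat_inv lflat).
Qed.

Definition realize : A -> P := @pi1_hol R X r1 P mu v.

Lemma realizeM : {morph realize : a b / (a * b)%g}.
Proof. exact: pi1_holM muflat v. Qed.

Local Notation tau := (cell_tau (univ_cocycle_flat rhoP)).
Local Notation lam := (@univ_cocycle R X r1 v rho).
Local Notation mono := (cell_monodromy (univ_cocycle_flat rhoP)).

Let near_tau := @cell_le_near R M Q.
Let tauM := @cell_tauM R M Q A lam (univ_cocycle_flat rhoP).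

Definition class_monodromy (a : P) : A := mono (repr a).

Lemma class_monodromyE (l : loop R p) : class_monodromy (\pi_P l) = mono l.
Proof.
rewrite /class_monodromy; have [H [cH H0 H1 He]] := homotopicP (pi1_repr l).
rewrite /cell_monodromy -(eq_monodromy _ H0) -(eq_monodromy _ H1).
apply: (monodromy_homotopy near_tau tauM cH) => s; have [? ?] := He s; eassumption.
Qed.

Lemma class_monodromyM : {morph class_monodromy : a b / (a * b)%g}.
Proof.
elim/quotW => a; elim/quotW => b.
have -> : (\pi_P a * \pi_P b)%g = \pi_P (loop_concat a b) by exact: pi1_mulE.
rewrite !class_monodromyE; apply: (@monodromy_concat _ _ _ _ _ near_tau tauM a b).
  exact: (@loop_clamp_continuous _ _ _ (loop_concat a b)).
by rewrite loop_at0 loop_at1.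
Qed.

Lemma class_monodromy1 : class_monodromy 1%g = 1%g.
Proof.
by apply: (mulgI (class_monodromy 1%g)); rewrite -class_monodromyM !mulg1.
Qed.

Lemma class_monodromy_path f : continuous f ->
  class_monodromy (cls f) =
  (mono (sigma (f 0%R)) * mono f * (mono (sigma (f 1%R)))^-1)%g.
Proof.
move=> cf; have bt := based_tether sigma_cont sigma0 sigma1 cf.
have [ct _ _] := bt.
rewrite /path_cls (loop_clsE bt) class_monodromyE.
have -> : loop_fun (based_loop bt) = tether sigma f by case: bt.
have cc (g : R -> M) : continuous g -> continuous (g \o clamp).
  by move=> cg; exact: comp_cont cg clamp_cont.
have ctail := tail_cont sigma_cont sigma1 cf.
rewrite /tether /cell_monodromy (monodromy_concat near_tau tauM); first last.
- by rewrite concat0 sigma1.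
- exact: cc.
rewrite (monodromy_concat near_tau tauM); first last.
- by rewrite path_rev0 sigma1.
- exact: cc.
by rewrite (monodromy_rev near_tau tauM) ?mulgA //; exact: cc.
Qed.

(** Monodromy carries [mu] to the universal cocycle up to the coboundary of the monodromies of the
    tethers. Along a walk these factors telescope, leaving a conjugation on closed walks. *)
Lemma class_monodromy_mu u w : @rstep R X r1 u w ->
  class_monodromy (mu u w) =
  (mono (sigma (vertex_point u)) * lam u w * (mono (sigma (vertex_point w)))^-1)%g.
Proof.
move=> /rstep_graphP uw; have [->|nuw] := eqVneq u w.
  rewrite (flatxx muflat) class_monodromy1.
  by rewrite (flatxx (univ_cocycle_flat rhoP)) mulg1 mulgV.
case: uw nuw => [->|[c [e [e1 _ ue we]]] nuw]; first by rewrite eqxx.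
have [f fP fe] := vertex_curve_edge Qfine e1 ue we nuw; have [cf f0 f1 _] := fP.
rewrite (muE sigma_cont sigma0 sigma1 fP) class_monodromy_path // f0 f1.
by rewrite (edge_monodromy (univ_cocycle_flat rhoP) e1 ue we fe).
Qed.

Lemma class_monodromy_hol u s : path (@rstep R X r1) u s ->
  class_monodromy (hol mu u s) =
  (mono (sigma (vertex_point u)) * hol lam u s *
   (mono (sigma (vertex_point (last u s))))^-1)%g.
Proof.
elim: s u => [|w s IH] u /=; first by rewrite class_monodromy1 mulg1 mulgV.
move=> /andP[uw ws]; rewrite class_monodromyM class_monodromy_mu // IH //.
by rewrite !mulgA mulgVK.
Qed.

(** Following [realize] by the monodromy conjugates by [z], because the holonomy of the universal
    cocycle along a loop is the class of that loop. *)
Lemma realize_inj : injective realize.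
Proof.
move=> a b; set z := mono (sigma (vertex_point v)).
suff E c : class_monodromy (realize c) = (z * c * z^-1)%g.
  by move=> /(congr1 class_monodromy); rewrite !E => /mulIg/mulgI.
elim/quotW: c => c; rewrite /realize (pi1_holE muflat) /loop_hol.
rewrite class_monodromy_hol; last exact: rloop_path.
rewrite (rloop_last c : last (v : vertex Q) _ = v) -/z; congr (_ * _ * _)%g.
exact: (hol_univ_cocycle_loop rhov rhoP c).
Qed.

(** A loop at [p] yields a closed walk at the root [u0], not at [v]. The change of base point, by
    the tail [th] and the holonomy [h] of [rho u0], is compensated in advance by applying this to
    the conjugate of [y] by [c]. *)
Lemma realize_surj (y : P) : exists a, realize a = y.
Proof.
pose u0 := root_of Q p; pose th := to_root Q p sigma p.
have [pq lq] := rhoP u0; pose h := hol mu v (rho u0).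
pose c := (th * h^-1)%g.
have [l lE] : exists l : loop R p, \pi_P l = (c * y * c^-1)%g.
  by exists (repr (c * y * c^-1)%g); rewrite reprK.
have bl : based p (l \o clamp).
  split; first exact: loop_clamp_continuous.
    by rewrite /= (clamp_id in01_0) loop_at0.
  by rewrite /= (clamp_id in01_1) loop_at1.
have := edge_generated_path Qfine sigma_cont sigma0 sigma1 (let: And3 cf _ _ := bl in cf).
rewrite (path_cls_loop sigma_cont sigma0 sigma1 sigmap bl) -loop_cls_loop lE.
case: (bl) => _ -> -> [s [ps ls]]; rewrite -/u0 -/th in ps ls * => sE.
pose q := rho u0 ++ s ++ rev (belast v (rho u0)).
have [pb lb] := walk_rev (rhoP u0).
have hq : @closed_walk R X r1 v q.
  by split; rewrite /q ?cat_path ?last_cat lq ls ?pq ?ps ?pb ?lb.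
exists (\pi_A (Rloop (closed_walk_rloop hq))).
rewrite /realize (pi1_holE muflat) /loop_hol /= -cats1 hol_cat.
case: hq => _ ->; rewrite /= (flatxx muflat) !mulg1 /q !hol_cat lq ls.
have /mulg1_eq <- : (h * hol mu u0 (rev (belast v (rho u0))) = 1)%g.
  by have := hol_rev muflat pq; rewrite (lq : last (v : X) _ = u0).
rewrite -/h.
have -> : hol mu u0 s = (th^-1 * (c * y * c^-1) * th)%g.
  by rewrite sE -/u0 !mulgA mulVg mul1g mulgVK.
by rewrite /c invgM invgK !mulgA !mulgVK mulgV mul1g mulgK.
Qed.

Lemma pi1_isomorphic : group_isomorphic P A.
Proof.
have /choice[inv invK] := realize_surj.
exists inv; split.
  by exists realize => // a; apply: realize_inj; rewrite invK.
by move=> a b; apply: realize_inj; rewrite realizeM !invK.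
Qed.

End realization.

Theorem theorem1p4 (R : realType) (M : metricType R) (n : nat)
    (A : @smooth_atlas R M n) (Mcompact : compact [set: M]%classic)
    (Mpath : @path_connected R M) (Q : @rectangulation R M)
    (Qfine : fine_enough Q) (p : M) (v : vertex Q) :
  group_isomorphic (pi1 R p) (@discrete_pi1 R (natural_graph Q) 1%:pos%R v).
Proof.
(* The walk chosen for [v] is empty and the tether chosen for [p] is constant, so that loops at the
   base points keep their own classes. *)
have /choice[rho rhoP] : forall u : vertex Q, exists s,
    walk v u s /\ (u = v -> s = [::]).
  move=> u; have [->|uv] := eqVneq u v; first by exists [::]; split.
  have [s sP] := graph_connected Mpath v u.
  by exists s; split=> // /eqP; rewrite (negbTE uv).
have /choice[sigma sP] : forall x : M, exists f : R -> M,
    [/\ continuous f, f 0 = p, f 1 = x & x = p -> f = (fun=> p)].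
  move=> x; have [->|xp] := pselect (x = p).
    by exists (fun=> p); split=> //; exact: cst_cont.
  have [f [cf f0 f1]] := Mpath p x; exists (f \o clamp); split=> //.
  - exact: within_comp cf clamp_cont clamp_in.
  - by rewrite /= (clamp_id in01_0).
  - by rewrite /= (clamp_id in01_1).
apply: (@pi1_isomorphic R M Q Qfine p sigma _ _ _ _ v rho).
- by move=> x; case: (sP x).
- by move=> x; case: (sP x).
- by move=> x; case: (sP x).
- by case: (sP p) => _ _ _; exact.
- by case: (rhoP v) => _; exact.
- by move=> u; case: (rhoP u).
Qed.
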